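(* Let $\alpha$ be a fundamental symmetry of a Kreĭn C*-category $\mathscr{C}$. Then there is a family $\mathcal{K}$ of Kreĭn spaces and a faithful representation $\pi:\mathscr{C}\to\mathscr{B}(\mathcal{K})$ that is $\alpha$-covariant, i.e. $\pi$ is an isomorphism of the Kreĭn C*-category $\mathscr{C}$ with a closed Kreĭn C*-category in $\mathscr{B}(\mathcal{K})$ and there exists a family of fundamental symmetries $J_K$ of the Kreĭn spaces $K\in\mathcal{K}$ such that $\pi\circ\alpha=\alpha_J\circ\pi$.
   Context: A $*$-category is a category whose Hom sets are complex vector spaces, with bilinear composition, equipped with a contravariant, involutive, conjugate-linear functor $*$ acting identically on objects. A covariant $*$-functor is a functor that is linear on each Hom space and satisfies $\phi(x^* )=\phi(x)^*$. A Kreĭn C*-category is a $*$-category $\mathscr{C}$ that admits at least one norm making all the spaces $\mathrm{Hom}_{\mathscr{C}}(A,B)$ Banach spaces and at least one covariant $*$-functor $\alpha:\mathscr{C}\to\mathscr{C}$ such that: $\alpha\circ\alpha=\mathrm{Id}_{\mathscr{C}}$; $\alpha(A)=A$ for all objects $A$; $\|\alpha(x^* )x\|=\|x\|^2$ for all morphisms $x$; and, for every morphism $x$ for which $x^*x$ is an endomorphism of the object $A$, the element $\alpha(x^* )x$ is positive in the C*-algebra $\mathrm{Hom}_{\mathscr{C}}(A,A)$ with involution $y\mapsto\alpha(y^* )$. Such an $\alpha$ is called a fundamental symmetry of $\mathscr{C}$. A Kreĭn space is a complex vector space $K$ with a Hermitian sesquilinear form $\langle\cdot\mid\cdot\rangle$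 (linear in the second variable) that admits at least one decomposition $K=K_+\oplus K_-$ into orthogonal subspaces such that $K_+$ is a Hilbert space with the restricted form and $K_-$ is a Hilbert space with the opposite of the restricted form. The operator $J:x_++x_-\mapsto x_+-x_-$ is the associated fundamental symmetry of $K$, and $|K|_J:=K_+\oplus(-K_-)$ (sign of the form reversed on $K_-$) is the associated Hilbert space. All the Hilbert norms so obtained are equivalent and define the topology of $K$. For an (indexed) family $\mathcal{K}$ of Kreĭn spaces, $\mathscr{B}(\mathcal{K})$ is the $*$-category whose objects are the members of $\mathcal{K}$, whose morphisms are the continuous linear maps between them, and whose involution is the Kreĭn space adjoint: for $T:K\to L$, $T^*:L\to K$ is given by $\langle T^*y\mid x\rangle_K=\langle y\mid Tx\rangle_L$. Each Hom space carries the topology of the (mutually equivalent) operator norms determined by the Hilbert spaces $|K|_J$, and ''closed'' means closed in this topology on each Hom space. Given fundamental symmetries $J_K$ for $K\in\mathcal{K}$, $\alpha_J$ denotes the $*$-functor of $\mathscr{B}(\mathcal{K})$ acting identically on objects with $\alpha_J(T):=J_L\,T\,J_K$ for $T:K\to L$. A representation is a covariant $*$-functor into some $\mathscr{B}(\mathcal{K})$; it is faithful if it is injective on morphisms. *)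

(* Defs.v *)
From HB Require Import structures.
From mathcomp Require Import all_boot all_order all_algebra.
From mathcomp Require Import complex ring lra.
From mathcomp Require Import all_classical all_reals all_analysis.

Set Implicit Arguments.
Unset Strict Implicit.
Unset Printing Implicit Defensive.

Import Order.TTheory GRing.Theory Num.Theory.
Import numFieldNormedType.Exports.

Local Open Scope classical_set_scope.
Local Open Scope complex_scope.
Local Open Scope ring_scope.

Definition modulus (R : realType) (z : R[i]) : R := complex.Re `|z|.

(* Norms are data here because the definitions below quantify over them;
   [normed N] is V with the normed-module structure that N induces. *)
Record normOn (R : realType) (V : lmodType R[i]) := NormOn {
  norm_fun :> V -> R;
  norm_triangle : forall x y, norm_fun (x + y) <= norm_fun x + norm_fun y;
  norm_homog : forall (a : R[i]) x, norm_fun (a *: x) = modulus a * norm_fun x;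
  norm_eq0 : forall x, norm_fun x = 0 -> x = 0
}.

Definition normed (R : realType) (V : lmodType R[i]) (N : normOn V) : Type := V.

Section Normed.
Context (R : realType) (V : lmodType R[i]) (N : normOn V).

Lemma modulusE (z : R[i]) : (modulus z)%:C = `|z|.
Proof. by rewrite /modulus; case: (z) => a b /=. Qed.

HB.instance Definition _ := GRing.Lmodule.on (normed N).

Let nrm (x : normed N) : R[i] := (N x)%:C.
Let nrmD x y : nrm (x + y) <= nrm x + nrm y.
Proof. by rewrite /nrm -rmorphD lecR; exact: norm_triangle. Qed.
Let nrmZ (a : R[i]) x : nrm (a *: x) = `|a| * nrm x.
Proof. by rewrite /nrm norm_homog -modulusE; exact: rmorphM. Qed.
Let nrm0 x : nrm x = 0 -> x = 0.
Proof. by move=> [] /norm_eq0. Qed.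
HB.instance Definition _ := Lmodule_isNormed.Build R[i] (normed N) nrmD nrmZ nrm0.

Lemma normedE (x : normed N) : `|x| = (N x)%:C.
Proof. by []. Qed.

Definition banach : Prop :=
  forall F : set_system (normed N), ProperFilter F -> cauchy F -> cvg F.
End Normed.

Definition subvect (R : realType) (V : lmodType R[i]) (S : submodClosed V) : Type := {x : V | x \in S}.
Section Sub.
Context (R : realType) (V : lmodType R[i]) (S : submodClosed V).
HB.instance Definition _ := SubChoice.on (subvect S).
HB.instance Definition _ := [SubChoice_isSubLmodule of subvect S by <:].
End Sub.

(* Conjugate linearity in the first variable follows from the two axioms. *)
Record hermForm (R : realType) (V : lmodType R[i]) := HermForm {
  form_fun :> V -> V -> R[i];
  form_linear : forall x a y z,
    form_fun x (a *: y + z) = a * form_fun x y + form_fun x z;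
  form_herm : forall x y, form_fun y x = (form_fun x y)^*
}.

Section Modulus.
Context (R : realType).
Implicit Types z w : R[i].

Lemma realcD (x y : R) : (x + y)%:C = x%:C + y%:C.
Proof. exact: (rmorphD (real_complex R)). Qed.
Lemma realcM (x y : R) : (x * y)%:C = x%:C * y%:C.
Proof. exact: (rmorphM (real_complex R)). Qed.
Lemma realcX (x : R) n : (x ^+ n)%:C = x%:C ^+ n.
Proof. exact: (rmorphXn (real_complex R)). Qed.
Lemma modulus_ge0 z : 0 <= modulus z.
Proof. by rewrite -lecR modulusE; exact: normr_ge0. Qed.
Lemma modulusM z w : modulus (z * w) = modulus z * modulus w.
Proof. by apply: complexI; rewrite realcM !modulusE normrM. Qed.
Lemma modulusR (x : R) : modulus (x%:C) = `|x|.
Proof.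
by rewrite /modulus normc_def /= expr0n /= addr0 sqrtr_sqr.
Qed.
Lemma addC_conj z : z + z^* = (complex.Re z *+ 2)%:C.
Proof. by rewrite [LHS](addcJ z) mulr_natl mulr2n -realcD. Qed.
Lemma Re_le_modulus z : complex.Re z <= modulus z.
Proof.
case: z => a b; rewrite /modulus /=.
apply: (le_trans (ler_norm a)); rewrite -sqrtr_sqr ler_wsqrtr//.
by rewrite lerDl sqr_ge0.
Qed.
End Modulus.

Section Form.
Context (R : realType) (V : lmodType R[i]) (h : hermForm V).

Lemma formDr x y z : h x (y + z) = h x y + h x z.
Proof. by have := form_linear h x 1 y z; rewrite scale1r mul1r. Qed.
Lemma form0r x : h x 0 = 0.
Proof. by apply: (addrI (h x 0)); rewrite -formDr !addr0. Qed.
Lemma formZr x a y : h x (a *: y) = a * h x y.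
Proof. by have := form_linear h x a y 0; rewrite !addr0 form0r addr0. Qed.
Lemma formNr x y : h x (- y) = - h x y.
Proof. by rewrite -scaleN1r formZr mulN1r. Qed.
Lemma formDl x y z : h (x + y) z = h x z + h y z.
Proof. by rewrite form_herm formDr rmorphD /= -!form_herm. Qed.
Lemma form0l x : h 0 x = 0.
Proof. by rewrite form_herm form0r rmorph0. Qed.
Lemma formZl a x y : h (a *: x) y = a^* * h x y.
Proof. by rewrite form_herm formZr rmorphM /= -form_herm. Qed.
Lemma formNl x y : h (- x) y = - h x y.
Proof. by rewrite form_herm formNr rmorphN /= -form_herm. Qed.
Definition formE := (formDr, formDl, formNr, formNl, formZr, formZl).

Definition posdef : Prop := forall x, x != 0 -> 0 < h x x.

Definition hnorm (x : V) : R := Num.sqrt (complex.Re (h x x)).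

Section Posdef.
Hypothesis pd : posdef.

Lemma posdef_ge0 x : 0 <= h x x.
Proof. by have [->|/pd/ltW//] := eqVneq x 0; rewrite form0r. Qed.

Lemma hnorm_sqr x : ((hnorm x) ^+ 2)%:C = h x x.
Proof.
have := posdef_ge0 x; rewrite /hnorm lecE => /andP[/eqP im0 re0].
by rewrite sqr_sqrtr// ; case: (h x x) im0 => a b /= ->.
Qed.

Lemma hnorm_ge0 x : 0 <= hnorm x. Proof. exact: sqrtr_ge0. Qed.

Lemma hnorm_eq0 x : hnorm x = 0 -> x = 0.
Proof.
move=> n0; apply/eqP/negPn/negP => /pd; rewrite -hnorm_sqr n0 expr0n /=.
by rewrite ltxx.
Qed.

Lemma cauchy_schwarz x y : modulus (h x y) <= hnorm x * hnorm y.
Proof.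
have [->|y0] := eqVneq y 0.
  by rewrite form0r modulusR normr0 mulr_ge0 ?hnorm_ge0.
have a0 := pd y0; set a := h y y in a0.
have aR : a^* = a by rewrite -form_herm.
have := posdef_ge0 (a *: x - h y x *: y).
rewrite !formE aR (form_herm h y x) -/a.
set t := h y x; set b := h x x.
rewrite [X in 0 <= X](_ : _ = a * (a * b - t * t^*)); last by ring.
rewrite pmulr_rge0// subr_ge0 -normCK -modulusE /a /b -!hnorm_sqr -realcX -realcM lecR.
move=> H; rewrite -(@ler_pXn2r _ 2)// ?nnegrE ?modulus_ge0 ?mulr_ge0 ?hnorm_ge0//.
rewrite exprMn mulrC; apply: le_trans H.
by rewrite /modulus norm_conjC.
Qed.

Lemma hnorm_triangle x y : hnorm (x + y) <= hnorm x + hnorm y.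
Proof.
rewrite -(@ler_pXn2r _ 2)// ?nnegrE ?addr_ge0 ?hnorm_ge0// -lecR hnorm_sqr.
have -> : h (x + y) (x + y) = (hnorm x ^+ 2 + hnorm y ^+ 2 + complex.Re (h x y) *+ 2)%:C.
  rewrite !formE !realcD !hnorm_sqr (form_herm h x y).
  rewrite -!addrA; congr (_ + _); rewrite addrA addrC; congr (_ + _).
  by rewrite addrC addC_conj mulr2n realcD.
rewrite lecR sqrrD addrAC lerD2r lerD2l ler_wMn2r//.
exact: le_trans (Re_le_modulus _) (cauchy_schwarz _ _).
Qed.

Lemma hnormZ a x : hnorm (a *: x) = modulus a * hnorm x.
Proof.
apply/eqP; rewrite -(@eqrXn2 _ 2)// ?mulr_ge0 ?modulus_ge0 ?hnorm_ge0//; apply/eqP.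
apply: complexI; rewrite hnorm_sqr exprMn realcM hnorm_sqr !formE.
by rewrite realcX modulusE normCK; ring.
Qed.

Definition form_norm : normOn V := NormOn hnorm_triangle hnormZ hnorm_eq0.
End Posdef.

Definition hilbert : Prop := exists pd : posdef, banach (form_norm pd).
End Form.

Section NormFacts.
Context (R : realType) (V : lmodType R[i]) (N : normOn V).

Lemma norm0 : N 0 = 0.
Proof. by rewrite -(scale0r 0) norm_homog modulusR normr0 mul0r. Qed.
Lemma normN x : N (- x) = N x.
Proof.
rewrite -scaleN1r norm_homog (_ : -1 = (-1)%:C); last by rewrite rmorphN1.
by rewrite modulusR normrN1 mul1r.
Qed.
Lemma norm_ge0 x : 0 <= N x.
Proof.
by have := norm_triangle N x (- x); rewrite subrr norm0 normN -mulr2n pmulrn_lge0.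
Qed.
Lemma norm_distC x y : N (x - y) = N (y - x).
Proof. by rewrite -normN opprB. Qed.
Lemma norm_dist_trans z x y : N (x - y) <= N (x - z) + N (z - y).
Proof. by rewrite -{1}(subrK z x) -addrA norm_triangle. Qed.

Definition cauchy_seq (u : nat -> V) : Prop :=
  forall e, 0 < e -> exists n0, forall m n, (n0 <= m)%N -> (n0 <= n)%N ->
    N (u m - u n) < e.
Definition converges (u : nat -> V) (l : V) : Prop :=
  forall e, 0 < e -> exists n0, forall n, (n0 <= n)%N -> N (u n - l) < e.

Lemma banach_seq : banach N -> forall u, cauchy_seq u -> exists l, converges u l.
Proof.
move=> bN u cu.
have : cvg ((u : nat -> normed N) @ \oo).
  apply: bN; apply/cauchy_ballP => e e0.
  have eR : e = (complex.Re e)%:C by rewrite RRe_real// gtr0_real.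
  have re0 : 0 < complex.Re e by rewrite -ltcR -eR.
  have [n0 H] := cu _ re0; near_simpl.
  near=> m n; rewrite -ball_normE/= normedE eR ltcR; apply: H.
  - by near: m; exists n0.
  - by near: n; exists n0.
move=> /cvg_ex[/= l ul]; exists l => e e0.
have ec0 : 0 < e%:C by rewrite ltcR.
move: ul => /cvgrPdist_lt /(_ _ ec0)[n0 _ H]; exists n0 => n n0n.
by rewrite norm_distC -ltcR -normedE; exact: H.
Unshelve. all: by end_near. Qed.
End NormFacts.

Section Riesz.
Context (R : realType) (V : lmodType R[i]) (h : hermForm V) (pd : posdef h).
Hypothesis hc : forall u, cauchy_seq (form_norm pd) u ->
  exists l, converges (form_norm pd) u l.
Context (f : V -> R[i]) (M : R).
Hypothesis fD : forall x y, f (x + y) = f x + f y.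
Hypothesis fZ : forall a x, f (a *: x) = a * f x.
Hypothesis fM : forall x, modulus (f x) <= M * hnorm h x.

Let n := hnorm h.
Let Phi x := n x ^+ 2 - complex.Re (f x) *+ 2.

Let M0 x : 0 <= M * n x. Proof. exact: le_trans (modulus_ge0 _) (fM x). Qed.

Let n_sqr x : n x ^+ 2 = complex.Re (h x x).
Proof. by have := hnorm_sqr pd x => <-. Qed.

Let nD z w : n (z + w) ^+ 2 = n z ^+ 2 + n w ^+ 2 + complex.Re (h z w) *+ 2.
Proof.
rewrite !n_sqr !formE (form_herm h z w).
by case: (h z w) (h z z) (h w w) => a b [c d] [c' d'] /=; ring.
Qed.

Let PhiD z w : Phi (z + w) = Phi z + n w ^+ 2 + complex.Re (h z w - f w) *+ 2.
Proof.
rewrite /Phi nD fD.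
by case: (h z w) (f z) (f w) => a b [c d] [c' d'] /=; ring.
Qed.

Let Phi_lb x : - (M ^+ 2) <= Phi x.
Proof.
have := le_trans (Re_le_modulus _) (fM x); rewrite -/(n x) /Phi => H.
have : 0 <= (n x - M) ^+ 2 by exact: sqr_ge0.
rewrite sqrrB; move: H; set a := complex.Re _; set b := n x; lra.
Qed.

Let d := inf [set Phi x | x in setT].
Let hi : has_inf [set Phi x | x in setT].
Proof.
split; first by exists (Phi 0), 0.
by exists (- (M ^+ 2)) => _ [x _ <-].
Qed.
Let dle x : d <= Phi x.
Proof. by apply: ge_inf; [case: hi|exists x]. Qed.

Let half x y : n (x - y) ^+ 2 <= (Phi x - d) *+ 2 + (Phi y - d) *+ 2.
Proof.
set m := (2^-1 : R)%:C *: (x + y).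
have Hd := dle m.
set w := (2^-1 : R)%:C *: (x - y).
have h2 : (2^-1 : R)%:C + (2^-1)%:C = 1 :> R[i].
  by rewrite -realcD -[2^-1]mul1r -splitr.
have xE : x = m + w.
  by rewrite /m /w -scalerDr addrACA subrr addr0 scalerDr -scalerDl h2 scale1r.
have yE : y = m - w.
  rewrite /m /w -scalerBr opprB (addrC (x + y)) addrA subrK.
  by rewrite scalerDr -scalerDl h2 scale1r.
have -> : x - y = w *+ 2.
  by rewrite {1}xE {1}yE opprD opprK addrACA subrr add0r.
clearbody m w; rewrite {}xE {}yE !PhiD formNr (_ : f (- w) = - f w); last first.
  by rewrite -scaleN1r fZ mulN1r.
have -> : n (- w) = n w by exact: (normN (form_norm pd)).
rewrite mulr2n nD -n_sqr.
move: Hd; case: (h m w) (f w) => a b [a' b'] /=; set k := n w ^+ 2; lra.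
Qed.

Lemma riesz : exists z, forall x, h z x = f x.
Proof.
have /choice[u uP] : forall k : nat, exists x, Phi x < d + k.+1%:R^-1.
  move=> k; have k0 : 0 < k.+1%:R^-1 :> R by rewrite invr_gt0.
  have [_ [x _ <-] H] := inf_adherent k0 hi.
  by exists x.
have uc : cauchy_seq (form_norm pd) u.
  move=> e e0.
  have e20 : 0 < e ^+ 2 / 4 by rewrite divr_gt0// exprn_gt0.
  have [n0 Hn0] : exists n0 : nat, n0.+1%:R^-1 < e ^+ 2 / 4.
    exists (Num.truncn (e ^+ 2 / 4)^-1).
    by rewrite invf_plt ?posrE// truncnS_gt.
  exists n0 => i j ni nj.
  rewrite -(@ltr_pXn2r _ 2)// ?nnegrE ?norm_ge0 ?(ltW e0)//.
  apply: (le_lt_trans (half _ _)).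
  have Hk k : (n0 <= k)%N -> Phi (u k) - d < e ^+ 2 / 4.
    move=> nk; rewrite ltrBlDl; apply: (lt_trans (uP k)); rewrite ltrD2l.
    by apply: le_lt_trans Hn0; rewrite lef_pV2 ?posrE// ler_nat.
  have := Hk _ ni; have := Hk _ nj.
  by set a := Phi _; set b := Phi _; lra.
have [z zP] := hc uc.
have Pz : Phi z <= d.
  apply/ler_addgt0Pl => e e0.
  pose c := 1 + (n z + `|M|) *+ 2.
  have nz0 : 0 <= n z by exact: hnorm_ge0.
  have c0 : 0 < c by rewrite /c ltr_pwDl// mulrn_wge0// addr_ge0.
  have ec : 0 < e / (c *+ 2) by rewrite divr_gt0// mulrn_wgt0.
  have [n0 Hn0] := zP _ ec.
  have [n1 Hn1] : exists n1 : nat, n1.+1%:R^-1 < e / 2.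
    exists (Num.truncn (e / 2)^-1).
    by rewrite invf_plt ?posrE ?divr_gt0// truncnS_gt.
  pose k := maxn n0 n1.
  have /Hn0 Hk : (n0 <= k)%N by rewrite leq_maxl.
  have Hk1 : Phi (u k) < d + e / 2.
    apply: (lt_trans (uP k)); rewrite ltrD2l; apply: le_lt_trans Hn1.
    by rewrite lef_pV2 ?posrE// ler_nat ltnS leq_maxr.
  pose w := u k - z.
  have := PhiD z w; rewrite {1}/w addrC subrK => E.
  have nw0 : 0 <= n w by exact: hnorm_ge0.
  have nw : n w * (c *+ 2) <= e.
    by rewrite -ler_pdivlMr ?mulrn_wgt0//; exact: ltW.
  have Hlow : - ((n z + `|M|) * n w) <= complex.Re (h z w - f w).
    have H1 := le_trans (Re_le_modulus _) (cauchy_schwarz pd z (- w)).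
    have H2 := le_trans (Re_le_modulus _) (fM w).
    rewrite (_ : hnorm h (- w) = n w) in H1; last exact: (normN (form_norm pd)).
    have H3 : M * n w <= `|M| * n w by rewrite ler_wpM2r// ler_norm.
    rewrite formNr -/(n z) in H1; rewrite -/(n w) in H2.
    move: H1 H2 H3; case: (h z w) (f w) => a b [a' b'] /=; lra.
  have w2 : 0 <= n w ^+ 2 by exact: sqr_ge0.
  have : c * n w *+ 2 <= e by rewrite mulrC -mulrnAr.
  rewrite /c; move: Hlow E Hk1 w2.
  set a := Phi z; set b := Phi (u k); set r := complex.Re _; set s := n w ^+ 2.
  move: nw0; set g := n w; set q := n z; set M' := `|M|.
  rewrite (_ : (1 + (q + M') *+ 2) * g = g + ((q + M') * g) *+ 2); last by ring.
  set p := (q + M') * g.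
  lra.
exists z => x; apply/eqP; rewrite -subr_eq0; apply/eqP.
set c := h z x - f x.
have key a : 0 <= modulus a ^+ 2 * n x ^+ 2 + complex.Re (a * c) *+ 2.
  have := dle (z + a *: x); rewrite PhiD => H.
  have := le_trans Pz H; rewrite -addrA lerDl.
  rewrite formZr fZ -mulrBr -/c.
  by rewrite [n (a *: x)](hnormZ pd) exprMn.
pose s : R := (1 + n x ^+ 2)^-1.
have s0 : 0 < s by rewrite invr_gt0 ltr_pwDl// sqr_ge0.
have := key (- s%:C * c^*).
have -> : modulus (- s%:C * c^*) = s * modulus c.
  rewrite modulusM {1}/modulus normrN -/(modulus _) modulusR gtr0_norm//.
  by congr (_ * _); rewrite /modulus norm_conjC.
have -> : complex.Re (- s%:C * c^* * c) = - (s * modulus c ^+ 2).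
  rewrite -mulrA (mulrC c^*) -normCK -modulusE -realcX mulNr -realcM.
  by [].
set m := modulus c => H.
have sn : s * n x ^+ 2 <= 1.
  by rewrite /s mulrC ler_pdivrMr ?mul1r ?ltr_pwDl ?sqr_ge0// lerDr.
have : s * m ^+ 2 <= 0.
  have E : (s * m) ^+ 2 * n x ^+ 2 = (s * m ^+ 2) * (s * n x ^+ 2) by ring.
  rewrite {}E in H.
  have sm0 : 0 <= s * m ^+ 2 by rewrite mulr_ge0 ?sqr_ge0// ltW.
  have := ler_wpM2l sm0 sn; rewrite mulr1 => H'.
  move: H H' sm0; set P := _ * _ * _; lra.
rewrite pmulr_rle0// => m2.
have : m == 0 by rewrite -sqrf_eq0 eq_le m2 sqr_ge0.
move=> /eqP mE; apply/eqP; rewrite -normr_eq0 -modulusE -/m mE.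
by [].
Qed.
End Riesz.

Section DerivedForms.
Context (R : realType) (V : lmodType R[i]) (h : hermForm V) (S : submodClosed V).

Let opp_linear x a y z : - h x (a *: y + z) = a * - h x y + - h x z.
Proof. by rewrite form_linear opprD mulrN. Qed.
Let opp_herm x y : - h y x = (- h x y)^*.
Proof. by rewrite form_herm rmorphN. Qed.
Definition form_opp : hermForm V := HermForm opp_linear opp_herm.

Let restr_linear (x : subvect S) a (y z : subvect S) :
  h (val x) (val (a *: y + z)) = a * h (val x) (val y) + h (val x) (val z).
Proof. by rewrite linearP form_linear. Qed.
Let restr_herm (x y : subvect S) : h (val y) (val x) = (h (val x) (val y))^*.
Proof. exact: form_herm. Qed.
Definition form_restr : hermForm (subvect S) := HermForm restr_linear restr_herm.
End DerivedForms.

(* The second and third conditions say that V is the direct sum of Kp and Km. *)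
Definition krein_decomposition (R : realType) (V : lmodType R[i])
    (h : hermForm V) (Kp Km : submodClosed V) : Prop :=
  [/\ forall x y, x \in Kp -> y \in Km -> h x y = 0,
      forall x, exists y z, [/\ y \in Kp, z \in Km & x = y + z],
      forall x, x \in Kp -> x \in Km -> x = 0,
      hilbert (form_restr h Kp) &
      hilbert (form_opp (form_restr h Km))].

Record kreinSpace (R : realType) := KreinSpace {
  krein_car :> lmodType R[i];
  krein_form : hermForm krein_car;
  krein_ex : exists Kp Km, krein_decomposition krein_form Kp Km
}.

Record fundSym (R : realType) (K : kreinSpace R) := FundSym {
  fundsym_fun :> K -> K;
  fundsymP : exists Kp Km, krein_decomposition (krein_form K) Kp Km /\
    forall x y, x \in Kp -> y \in Km -> fundsym_fun (x + y) = x - y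
}.

Section FundSymAux.
Context (R : realType) (V : lmodType R[i]) (S : submodClosed V).
Lemma subspN (x : V) : x \in S -> - x \in S.
Proof. by move=> xS; rewrite -scaleN1r rpredZ. Qed.
Lemma subspB (x y : V) : x \in S -> y \in S -> x - y \in S.
Proof. by move=> xS yS; rewrite rpredD// subspN. Qed.
End FundSymAux.

Section FundSym.
Context (R : realType) (K : kreinSpace R) (J : fundSym K).
Let h := krein_form K.

Lemma fundsym_ex : exists J : K -> K, exists Kp Km,
  krein_decomposition (krein_form K) Kp Km /\
    forall x y, x \in Kp -> y \in Km -> J (x + y) = x - y.
Proof.
have [Kp [Km KK]] := krein_ex K; have [_ ex dis _ _] := KK.
have /choice[p /choice[q pq]] := ex.
exists (fun x => p x - q x), Kp, Km; split => // x y xp ym.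
have [p1 q1 e1] := pq (x + y).
have E : x - p (x + y) = q (x + y) - y.
  apply/eqP; rewrite subr_eq addrAC eq_sym subr_eq addrC -e1.
  by rewrite eqxx.
have x0 : x - p (x + y) = 0.
  by apply: dis; [rewrite subspB|rewrite E subspB].
move: E; rewrite x0 => /esym/eqP; rewrite subr_eq0 => /eqP ->.
by move/eqP: x0; rewrite subr_eq0 => /eqP <-.
Qed.

Lemma fundsym_inh : exists J' : fundSym K, True.
Proof. by have [j jP] := fundsym_ex; exists (FundSym jP). Qed.

Lemma fundsym_linear a x y : J (a *: x + y) = a *: J x + J y.
Proof.
have [Kp [Km [[_ ex _ _ _] HJ]]] := fundsymP J.
have [x1 [x2 [x1p x2m ->]]] := ex x; have [y1 [y2 [y1p y2m ->]]] := ex y.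
rewrite scalerDr addrACA !HJ ?rpredD ?rpredZ// scalerBr opprD.
by rewrite addrACA.
Qed.

Lemma fundsymD x y : J (x + y) = J x + J y.
Proof. by have := fundsym_linear 1 x y; rewrite !scale1r. Qed.
Lemma fundsym0 : J 0 = 0.
Proof. by apply: (addrI (J 0)); rewrite -fundsymD !addr0. Qed.
Lemma fundsymZ a x : J (a *: x) = a *: J x.
Proof. by have := fundsym_linear a x 0; rewrite fundsym0 !addr0. Qed.

Lemma fundsymK x : J (J x) = x.
Proof.
have [Kp [Km [[_ ex _ _ _] HJ]]] := fundsymP J.
have [x1 [x2 [x1p x2m ->]]] := ex x.
by rewrite !HJ ?subspN// opprK.
Qed.

Lemma fundsym_sym x y : h (J x) y = h x (J y).
Proof.
have [Kp [Km [[ort ex _ _ _] HJ]]] := fundsymP J.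
have [x1 [x2 [x1p x2m ->]]] := ex x; have [y1 [y2 [y1p y2m ->]]] := ex y.
rewrite !HJ// !formE (ort x1 y2)// (form_herm _ y1 x2) (ort y1 x2)// conjC0.
by rewrite oppr0 !addr0 !add0r.
Qed.

Let fs_linear x a y z : h x (J (a *: y + z)) = a * h x (J y) + h x (J z).
Proof. by rewrite fundsym_linear form_linear. Qed.
Let fs_herm x y : h y (J x) = (h x (J y))^*.
Proof. by rewrite -fundsym_sym form_herm. Qed.
(* For x = x1 + x2 and y = y1 + y2 decomposed along K+ and K-, h x (J y) equals
   h x1 y1 - h x2 y2, the inner product of |K|_J. *)
Definition fundsym_form : hermForm K := HermForm fs_linear fs_herm.

Let hdec Kp Km x1 x2 : krein_decomposition h Kp Km ->
  (forall x y, x \in Kp -> y \in Km -> J (x + y) = x - y) ->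
  x1 \in Kp -> x2 \in Km ->
  fundsym_form (x1 + x2) (x1 + x2) = h x1 x1 - h x2 x2.
Proof.
move=> [ort _ _ _ _] HJ x1p x2m; rewrite /= HJ// !formE.
rewrite (ort x1 x2)// (form_herm _ x1 x2) (ort x1 x2)// conjC0.
by rewrite addr0 add0r.
Qed.

Lemma fundsym_posdef : posdef fundsym_form.
Proof.
have [Kp [Km [D HJ]]] := fundsymP J.
have [_ ex _ [pp _] [pm _]] := D.
move=> x; have [x1 [x2 [x1p x2m ->]]] := ex x.
rewrite (hdec D)//.
have P1 : x1 != 0 -> 0 < h x1 x1.
  by move=> x10; exact: (pp (exist _ x1 x1p)).
have P2 : x2 != 0 -> 0 < - h x2 x2.
  by move=> x20; exact: (pm (exist _ x2 x2m)).
have [x10|/P1 x10] := eqVneq x1 0; have [x20|/P2 x20] := eqVneq x2 0.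
- by rewrite x10 x20 addr0 eqxx.
- by move=> _; rewrite x10 form0r add0r.
- by move=> _; rewrite x20 form0r subr0.
- by move=> _; rewrite addr_gt0.
Qed.

Definition fundsym_norm : normOn K := form_norm fundsym_posdef.

Lemma fundsym_complete u : cauchy_seq fundsym_norm u ->
  exists l, converges fundsym_norm u l.
Proof.
have [Kp [Km [D HJ]]] := fundsymP J.
have [_ ex _ [pp bp] [pm bm]] := D => cu.
have /choice[p /choice[q pq]] : forall n, exists y z, [/\ y \in Kp, z \in Km & u n = y + z].
  by move=> n; exact: ex.
have pP n : p n \in Kp by have [] := pq n.
have qP n : q n \in Km by have [] := pq n.
pose p' n : subvect Kp := exist _ (p n) (pP n).
pose q' n : subvect Km := exist _ (q n) (qP n).
have key (x : subvect Kp) (y : subvect Km) :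
  hnorm fundsym_form (val x + val y) ^+ 2 =
  form_norm pp x ^+ 2 + form_norm pm y ^+ 2.
  apply: complexI; rewrite realcD !hnorm_sqr//; last exact: fundsym_posdef.
  by rewrite (hdec D)//; [exact: (valP x)|exact: (valP y)].
have uE m n : u m - u n = val (p' m - p' n) + val (q' m - q' n).
  by rewrite !linearB/= ; case: (pq m) (pq n) => _ _ -> [_ _ ->]; rewrite opprD addrACA.
have le1 (x : subvect Kp) (y : subvect Km) :
    form_norm pp x <= hnorm fundsym_form (val x + val y).
  rewrite -(@ler_pXn2r _ 2)// ?nnegrE ?norm_ge0 ?hnorm_ge0//.
  by rewrite key lerDl sqr_ge0.
have le2 (x : subvect Kp) (y : subvect Km) :
    form_norm pm y <= hnorm fundsym_form (val x + val y).
  rewrite -(@ler_pXn2r _ 2)// ?nnegrE ?norm_ge0 ?hnorm_ge0//.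
  by rewrite key lerDr sqr_ge0.
have [lp lpP] : exists l, converges (form_norm pp) p' l.
  apply: banach_seq => // e e0; have [n0 H] := cu _ e0; exists n0 => m n nm nn.
  by apply: le_lt_trans (H _ _ nm nn); rewrite uE; exact: le1.
have [lq lqP] : exists l, converges (form_norm pm) q' l.
  apply: banach_seq => // e e0; have [n0 H] := cu _ e0; exists n0 => m n nm nn.
  by apply: le_lt_trans (H _ _ nm nn); rewrite uE; exact: le2.
exists (val lp + val lq) => e e0.
have e20 : 0 < e / 2 by rewrite divr_gt0.
have [n1 H1] := lpP _ e20; have [n2 H2] := lqP _ e20.
exists (maxn n1 n2) => n; rewrite geq_max => /andP[/H1 h1 /H2 h2].
have -> : u n - (val lp + val lq) = val (p' n - lp) + val (q' n - lq).
  by rewrite !linearB/=; case: (pq n) => _ _ ->; rewrite opprD addrACA.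
rewrite -(@ltr_pXn2r _ 2)// ?nnegrE ?norm_ge0 ?(ltW e0)//.
rewrite [X in X < _]key.
have : form_norm pp (p' n - lp) ^+ 2 < (e / 2) ^+ 2.
  by rewrite ltr_pXn2r// ?nnegrE ?norm_ge0// ltW.
have : form_norm pm (q' n - lq) ^+ 2 < (e / 2) ^+ 2.
  by rewrite ltr_pXn2r// ?nnegrE ?norm_ge0// ltW.
have : 0 <= e ^+ 2 by exact: sqr_ge0.
rewrite (_ : (e / 2) ^+ 2 = e ^+ 2 / 4); last by field.
set a := e ^+ 2; set b := _ ^+ 2; set c := _ ^+ 2.
lra.
Qed.

Lemma fundsym_norm_iso x : fundsym_norm (J x) = fundsym_norm x.
Proof.
by congr (Num.sqrt (complex.Re _)); rewrite /= fundsymK -fundsym_sym.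
Qed.

Lemma krein_form_le x y :
  modulus (h x y) <= fundsym_norm x * fundsym_norm y.
Proof.
have := cauchy_schwarz fundsym_posdef x (J y).
by rewrite /= fundsymK [X in _ * X]fundsym_norm_iso.
Qed.
End FundSym.

Lemma modulusD (R : realType) (z w : R[i]) : modulus (z + w) <= modulus z + modulus w.
Proof. by rewrite -lecR realcD !modulusE ler_normD. Qed.
Lemma modulus0 (R : realType) : modulus (0 : R[i]) = 0.
Proof. by rewrite (modulusR (0 : R)) normr0. Qed.

Section NormEquiv.
Context (R : realType) (K : kreinSpace R) (J J' : fundSym K).
Let k := krein_form K.
Let n1 := fundsym_norm J.
Let n2 := fundsym_norm J'.

Let step (x y : K) (r : R) : 0 < r -> 0 < n1 y ->
  exists x', n1 (x' - x) <= r /\ r * n1 y <= modulus (k y x').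
Proof.
move=> r0 y0; pose v := (r / n1 y)%:C *: J y.
have nv : n1 v = r.
  rewrite norm_homog modulusR gtr0_norm ?divr_gt0// [X in _ * X]fundsym_norm_iso.
  by rewrite divfK// gt_eqF.
have kv : modulus (k y v) = r * n1 y.
  have -> : k y v = (r / n1 y)%:C * ((n1 y) ^+ 2)%:C.
    by rewrite formZr [in RHS](hnorm_sqr (fundsym_posdef J)).
  rewrite -realcM modulusR expr2 mulrA divfK ?gt_eqF// ger0_norm//.
  by rewrite mulr_ge0 ?ltW.
have kvN : modulus (k y (- v)) = r * n1 y.
  by rewrite formNr /modulus normrN -/(modulus _).
have : (r * n1 y) *+ 2 <= modulus (k y (x + v)) + modulus (k y (x - v)).
  have -> : (r * n1 y) *+ 2 = modulus (k y (v *+ 2)).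
    rewrite -kv -scaler_nat (formZr k y 2 v) modulusM.
    rewrite (_ : 2%:R = (2%:R : R)%:C :> R[i]); last by rewrite rmorph_nat.
    by rewrite modulusR ger0_norm// mulr_natl.
  have -> : v *+ 2 = (x + v) - (x - v) by rewrite opprB [v - x]addrC addrACA subrr add0r mulr2n.
  rewrite formDr; apply: le_trans (modulusD _ _) _.
  by rewrite lerD2l formNr /modulus normrN.
case: (lerP (r * n1 y) (modulus (k y (x + v)))) => [H _|H1 H2].
- by exists (x + v); rewrite addrC addKr nv.
- exists (x - v); rewrite addrC addKr normN nv; split => //.
  move: H1 H2; set a := modulus _; set b := modulus _; set c := r * _; lra.
Qed.

Lemma fundsym_norm_equiv : exists M, forall x, n1 x <= M * n2 x.
Proof.
apply: contrapT => H.
have H1 M : exists x, M * n2 x < n1 x.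
  by apply: contrapT => H'; apply: H; exists M => x; rewrite leNgt; apply/negP => ?; apply: H'; exists x.
pose c (i : nat) : R := 3^-1 ^+ i.+1.
have c0 i : 0 < c i by rewrite exprn_gt0// invr_gt0.
have /choice[y yP] : forall i : nat, exists y, n2 y <= 1 /\ i.+1%:R / c i <= n1 y.
  move=> i; have [x xP] := H1 (i.+1%:R / c i).
  have x0 : 0 < n2 x.
    rewrite lt_neqAle norm_ge0 andbT; apply/eqP => /esym/norm_eq0 E.
    by move: xP; rewrite E !norm0 mulr0 ltxx.
  exists ((n2 x)^-1%:C *: x); rewrite !norm_homog modulusR gtr0_norm ?invr_gt0//.
  by rewrite mulVf ?gt_eqF//; split => //; rewrite ler_pdivlMl// mulrC ltW.
have y0 i : 0 < n1 (y i).
  by apply: lt_le_trans (yP i).2; rewrite divr_gt0.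
have /choice[S SP] : forall p : nat * K, exists x',
    n1 (x' - p.2) <= c p.1 /\ c p.1 * n1 (y p.1) <= modulus (k (y p.1) x').
  by move=> p; exact: step.
pose fix X (i : nat) : K := if i is j.+1 then S (j, X j) else 0.
have Xd i : n1 (X i.+1 - X i) <= c i by exact: (SP (i, X i)).1.
have Xk i : c i * n1 (y i) <= modulus (k (y i) (X i.+1)) by exact: (SP (i, X i)).2.
have cS i : c i.+1 = c i / 3 by rewrite /c exprS mulrC.
have XD i j : n1 (X (i + j)%N.+1 - X i.+1) <= c i / 2 - c (i + j)%N / 2.
  elim: j => [|j IH]; first by rewrite addn0 !subrr norm0.
  rewrite addnS; apply: le_trans (norm_dist_trans _ (X (i + j).+1) _ _) _.
  have := Xd (i + j).+1; rewrite cS; move: IH.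
  set a := n1 _; set b := n1 _; set d := c _; set d' := c (i + j)%N; lra.
have XD' i j : (i <= j)%N -> n1 (X j.+1 - X i.+1) <= c i / 2.
  move=> ij; have := XD i (j - i)%N; rewrite subnKC// => /le_trans; apply.
  by rewrite gerBl divr_ge0// ltW.
have [l lP] : exists l, converges n1 X l.
  apply: fundsym_complete => e e0.
  have [n0 Hn0] : exists n0, c n0 < e.
    have [n0 Hn] : exists n0 : nat, e^-1 < n0%:R.
      by exists (Num.truncn e^-1).+1; exact: truncnS_gt.
    exists n0; rewrite /c exprVn -[e]invrK ltf_pV2 ?posrE ?invr_gt0 ?exprn_gt0//.
    apply: (lt_trans Hn); rewrite -natrX ltr_nat.
    by apply: leq_trans (ltn_expl _ _) _ => //; rewrite leq_exp2l.
  exists n0.+1 => -[|m] [|n]//; rewrite !ltnS => nm nn.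
  apply: le_lt_trans Hn0.
  apply: le_trans (norm_dist_trans _ (X n0.+1) _ _) _.
  rewrite [leRHS]splitr; apply: lerD; first exact: XD'.
  by rewrite norm_distC; exact: XD'.
have lX i : n1 (l - X i.+1) <= c i / 2.
  apply/ler_addgt0Pl => e e0; have [n0 Hn] := lP _ e0.
  apply: le_trans (norm_dist_trans _ (X (maxn n0 i).+1) _ _) _.
  apply: lerD.
  - by rewrite norm_distC; apply/ltW/Hn; rewrite leqW// leq_maxl.
  - by apply: XD'; rewrite leq_maxr.
have low i : i.+1%:R <= n2 l *+ 2.
  have up : modulus (k (y i) l) <= n2 l.
    apply: le_trans (krein_form_le J' _ _) _.
    by rewrite ler_piMl ?norm_ge0//; exact: (yP i).1.
  have := Xk i; have -> : X i.+1 = l + - (l - X i.+1) by rewrite opprB addrC subrK.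
  rewrite formDr => A; have := le_trans A (modulusD _ _).
  have B : modulus (k (y i) (- (l - X i.+1))) <= n1 (y i) * (c i / 2).
    apply: le_trans (krein_form_le J _ _) _.
    by rewrite ler_wpM2l ?norm_ge0// normN.
  have C : i.+1%:R <= c i * n1 (y i) by rewrite mulrC -ler_pdivrMr//; exact: (yP i).2.
  rewrite mulrA (mulrC (n1 _)) in B.
  move: B C up; set a := modulus _; set b := modulus _; set d := _ * n1 _; set u := n2 l.
  lra.
have := low (Num.truncn (n2 l *+ 2)).
by rewrite leNgt truncnS_gt.
Qed.
End NormEquiv.

Section Bounded.
Context (R : realType) (V W : lmodType R[i]) (N : normOn V) (N' : normOn W).
Variable f : V -> W.
Hypothesis fl : linear f.

Lemma continuous_boundedP :
  continuous (f : normed N -> normed N') <-> exists M, forall x, N' (f x) <= M * N x.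
Proof.
pose g : {linear (normed N) -> (normed N')} :=
  HB.pack (f : normed N -> normed N') (GRing.isLinear.Build _ _ _ _ (f : normed N -> normed N') fl).
rewrite -[continuous _]/(continuous g) -(linear_bounded_continuous g) linear_boundedP.
split.
- move=> /pinfty_ex_gt0[r r0 H]; exists (complex.Re r) => x.
  rewrite -lecR realcM RRe_real ?gtr0_real//; exact: H.
- move=> [M HM]; near=> r => x.
  have rM : `|M|%:C <= r.
    near: r; apply: nbhs_pinfty_ge; apply: ger0_real.
    by rewrite ler0c.
  apply: le_trans (ler_wpM2r (normr_ge0 _) rM).
  rewrite !normedE -realcM lecR; apply: le_trans (HM x) _.
  by rewrite ler_wpM2r ?norm_ge0// ler_norm.
Unshelve. all: by end_near. Qed.
End Bounded.

Section BoundedOperators.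
Context (R : realType).
Implicit Types K L M : kreinSpace R.

(* By [fundsym_norm_equiv] the choice of J and J' is immaterial, here and in
   [closed_subcategory]. *)
Definition continuous_linear K L : {pred (K -> L)} := fun f =>
  `[< linear f /\ forall (J : fundSym K) (J' : fundSym L),
      continuous (f : normed (fundsym_norm J) -> normed (fundsym_norm J')) >].

Arguments continuous_linear : clear implicits.

Lemma continuous_linearP K L (f : K -> L) :
  f \in continuous_linear K L <->
  linear f /\ forall (J : fundSym K) (J' : fundSym L), exists C, forall x,
     fundsym_norm J' (f x) <= C * fundsym_norm J x.
Proof.
split=> [/asboolP[fl fc]|[fl fb]].
- by split => // J J'; apply/(continuous_boundedP _ _ fl); exact: fc.
- by apply/asboolP; split => // J J'; apply/(continuous_boundedP _ _ fl); exact: fb.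
Qed.

Lemma continuous_linear_submod K L : submod_closed (continuous_linear K L).
Proof.
split.
- apply/continuous_linearP; split=> [a x y|J J'].
    by rewrite /= scaler0 addr0.
  by exists 0 => x; rewrite norm0 mul0r.
- move=> a f g /continuous_linearP[fl fb] /continuous_linearP[gl gb].
  have agE z : (a *: f + g) z = a *: f z + g z by [].
  apply/continuous_linearP; split=> [b x y|J J'].
    rewrite !agE fl gl !scalerDr !scalerA addrACA (mulrC b).
    by [].
  have [c cP] := fb J J'; have [d dP] := gb J J'.
  exists (modulus a * c + d) => x.
  rewrite agE.
  apply: le_trans (norm_triangle _ _ _) _; rewrite mulrDl norm_homog.
  by rewrite lerD// -mulrA ler_wpM2l// modulus_ge0.
Qed.

HB.instance Definition _ K L :=
  GRing.isSubmodClosed.Build R[i] (K -> L) (continuous_linear K L)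
    (continuous_linear_submod K L).

Definition bop K L : Type := subvect (continuous_linear K L).
HB.instance Definition _ K L := GRing.Lmodule.on (bop K L).
Definition bop_fun K L (T : bop K L) : K -> L := val T.
Coercion bop_fun : bop >-> Funclass.

Definition mkBop K L (f : K -> L) (fP : f \in continuous_linear K L) : bop K L :=
  exist (fun g => g \in continuous_linear K L) f fP.

Lemma bopP K L (T : bop K L) : linear T /\ forall (J : fundSym K) (J' : fundSym L),
  exists C, forall x, fundsym_norm J' (T x) <= C * fundsym_norm J x.
Proof. by apply/continuous_linearP; exact: (valP T). Qed.

Lemma bop_ext K L (S T : bop K L) : (forall x, S x = T x) -> S = T.
Proof. by move=> H; apply/val_inj/funext. Qed.

Lemma bopD K L (S T : bop K L) x : bop_fun (S + T) x = S x + T x.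
Proof. by []. Qed.
Lemma bopZ K L a (T : bop K L) x : bop_fun (a *: T) x = a *: T x.
Proof. by []. Qed.

Lemma bop_linear K L (T : bop K L) a x y : T (a *: x + y) = a *: T x + T y.
Proof. exact: (bopP T).1. Qed.
Lemma bop_add K L (T : bop K L) x y : T (x + y) = T x + T y.
Proof. by have := bop_linear T 1 x y; rewrite !scale1r. Qed.
Lemma bop0 K L (T : bop K L) : T 0 = 0.
Proof. by apply: (addrI (T 0)); rewrite -bop_add !addr0. Qed.
Lemma bop_scale K L (T : bop K L) a x : T (a *: x) = a *: T x.
Proof. by have := bop_linear T a x 0; rewrite bop0 !addr0. Qed.

Lemma bop_bound K L (T : bop K L) (J : fundSym K) (J' : fundSym L) :
  exists2 C, 0 <= C & forall x, fundsym_norm J' (T x) <= C * fundsym_norm J x.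
Proof.
have [C HC] := (bopP T).2 J J'; exists `|C| => // x.
by apply: le_trans (HC x) _; rewrite ler_wpM2r ?norm_ge0// ler_norm.
Qed.

Section OpNorm.
Context K L (J : fundSym K) (J' : fundSym L).

(* The operator norm from |K|_J to |L|_J'. *)
Definition opnorm_fun (T : bop K L) : R :=
  sup [set fundsym_norm J' (T x) | x in [set x | fundsym_norm J x <= 1]].

Lemma opnorm_has_sup (T : bop K L) :
  has_sup [set fundsym_norm J' (T x) | x in [set x | fundsym_norm J x <= 1]].
Proof.
split; first by exists (fundsym_norm J' (T 0)), 0 => //; change (fundsym_norm J 0 <= 1); rewrite norm0.
have [C C0 HC] := bop_bound T J J'; exists C => _ [x /= x1 <-].
by apply: le_trans (HC x) _; rewrite ler_piMr.
Qed.

Lemma opnorm_ge (T : bop K L) x :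
  fundsym_norm J x <= 1 -> fundsym_norm J' (T x) <= opnorm_fun T.
Proof.
by move=> x1; apply: ub_le_sup; [have [] := opnorm_has_sup T|exists x].
Qed.

Lemma opnorm_le (T : bop K L) C :
  (forall x, fundsym_norm J x <= 1 -> fundsym_norm J' (T x) <= C) ->
  opnorm_fun T <= C.
Proof.
move=> H; apply: ge_sup; first by have [] := opnorm_has_sup T.
by move=> _ [x /= x1 <-]; exact: H.
Qed.

Lemma opnorm_fun_ge0 T : 0 <= opnorm_fun T.
Proof.
apply: le_trans (norm_ge0 _ _) (opnorm_ge T (x := 0) _); by rewrite norm0.
Qed.

Lemma opnorm_bound (T : bop K L) x :
  fundsym_norm J' (T x) <= opnorm_fun T * fundsym_norm J x.
Proof.
have [x0|x0] := eqVneq (fundsym_norm J x) 0.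
  by rewrite (norm_eq0 x0) bop0 !norm0 mulr0.
have n0 : 0 < fundsym_norm J x by rewrite lt_neqAle eq_sym x0 norm_ge0.
have := @opnorm_ge T ((fundsym_norm J x)^-1%:C *: x).
rewrite bop_scale !norm_homog modulusR gtr0_norm ?invr_gt0// mulVf//.
by move=> /(_ (lexx _)); rewrite ler_pdivrMl// mulrC.
Qed.

Let opnormD S T : opnorm_fun (S + T) <= opnorm_fun S + opnorm_fun T.
Proof.
apply: opnorm_le => x x1; rewrite bopD; apply: le_trans (norm_triangle _ _ _) _.
by rewrite lerD// opnorm_ge.
Qed.

Let opnormZ_le (a : R[i]) T : opnorm_fun (a *: T) <= modulus a * opnorm_fun T.
Proof.
apply: opnorm_le => x x1; rewrite bopZ norm_homog.
by rewrite ler_wpM2l ?modulus_ge0// opnorm_ge.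
Qed.

Let opnormZ (a : R[i]) T : opnorm_fun (a *: T) = modulus a * opnorm_fun T.
Proof.
apply/eqP; rewrite eq_le opnormZ_le /=.
have [->|a0] := eqVneq a 0; first by rewrite modulus0 mul0r opnorm_fun_ge0.
have := opnormZ_le a^-1 (a *: T).
have am : 0 < modulus a by rewrite -ltcR modulusE normr_gt0.
rewrite scalerA mulVf// scale1r (_ : modulus a^-1 = (modulus a)^-1).
  by rewrite ler_pdivlMl.
apply: (mulfI (lt0r_neq0 am)); rewrite -modulusM mulfV// mulfV ?gt_eqF//.
by rewrite (modulusR (1 : R)) normr1.
Qed.

Let opnorm0 T : opnorm_fun T = 0 -> T = 0.
Proof.
move=> T0; apply: bop_ext => x; apply: (@norm_eq0 _ _ (fundsym_norm J')).
apply/eqP; rewrite eq_le norm_ge0 andbT.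
by have := opnorm_bound T x; rewrite T0 mul0r.
Qed.

Definition opnorm : normOn (bop K L) := NormOn opnormD opnormZ opnorm0.
End OpNorm.

Lemma idop_subproof K : (fun x : K => x) \in continuous_linear K K.
Proof.
apply/continuous_linearP; split=> // J J'.
exact: fundsym_norm_equiv.
Qed.
Definition idop K : bop K K := mkBop (idop_subproof K).

Lemma compop_subproof K L M (S : bop L M) (T : bop K L) :
  (fun x => S (T x)) \in continuous_linear K M.
Proof.
apply/continuous_linearP; split=> [a x y|J J''].
  by rewrite !bop_linear.
have [J' _] := fundsym_inh L.
have [c c0 cP] := bop_bound S J' J''; have [d d0 dP] := bop_bound T J J'.
exists (c * d) => x; apply: le_trans (cP _) _.
by rewrite -mulrA ler_wpM2l.
Qed.
Definition compop K L M (S : bop L M) (T : bop K L) : bop K M :=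
  mkBop (compop_subproof S T).

Lemma symop_subproof K (J : fundSym K) : (fun x => J x) \in continuous_linear K K.
Proof.
apply/continuous_linearP; split=> [a x y|J1 J2]; first exact: fundsym_linear.
have [c cP] := fundsym_norm_equiv J J1; have [d dP] := fundsym_norm_equiv J2 J.
exists (`|d| * c) => x; apply: le_trans (dP _) _.
apply: (@le_trans _ _ (`|d| * fundsym_norm J (J x))).
  by rewrite ler_wpM2r ?norm_ge0// ler_norm.
by rewrite [X in _ * X]fundsym_norm_iso -mulrA ler_wpM2l.
Qed.
Definition symop K (J : fundSym K) : bop K K := mkBop (symop_subproof J).

Lemma krein_nondeg K (x y : K) :
  (forall z, krein_form K x z = krein_form K y z) -> x = y.
Proof.
have [J _] := fundsym_inh K => H.
apply/eqP/negPn/negP; rewrite -subr_eq0 => /(fundsym_posdef J) /=.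
by rewrite formDl formNl H subrr ltxx.
Qed.

Lemma adjoint_ex K L (T : bop K L) : exists S : bop L K, forall y x,
  krein_form K (S y) x = krein_form L y (T x).
Proof.
have [J _] := fundsym_inh K; have [J' _] := fundsym_inh L.
have [C C0 HC] := bop_bound T J J'.
have fb y x : modulus (krein_form L y (T x)) <=
    (fundsym_norm J' y * C) * fundsym_norm J x.
  apply: le_trans (krein_form_le J' _ _) _.
  by rewrite -mulrA ler_wpM2l ?norm_ge0.
have /choice[S SP] : forall y, exists z, forall x,
    krein_form K z x = krein_form L y (T x).
  move=> y.
  have [|||z zP] := @riesz _ _ _ (fundsym_posdef J)
     (@fundsym_complete _ _ J) (fun x => krein_form L y (T x)) (fundsym_norm J' y * C).
  - by move=> x x'; rewrite bop_add formDr.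
  - by move=> a x; rewrite bop_scale formZr.
  - by move=> x; exact: fb.
  - by exists (J z) => x; rewrite fundsym_sym -zP.
have Sb y : fundsym_norm J (S y) <= C * fundsym_norm J' y.
  have [s0|s0] := eqVneq (fundsym_norm J (S y)) 0.
    by rewrite s0 mulr_ge0 ?norm_ge0.
  have n0 : 0 < fundsym_norm J (S y) by rewrite lt_neqAle eq_sym s0 norm_ge0.
  rewrite -(ler_pM2r n0).
  have := fb y (J (S y)); rewrite -SP [fundsym_norm J (J _)]fundsym_norm_iso.
  rewrite -[krein_form K _ _]/(fundsym_form J (S y) (S y)).
  rewrite -(hnorm_sqr (fundsym_posdef J)) modulusR ger0_norm ?sqr_ge0// expr2.
  by rewrite (mulrC C).
have Sc : S \in continuous_linear L K.
  apply/continuous_linearP; split=> [a x y|J2 J1].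
    apply: krein_nondeg => z.
    by rewrite formDl formZl !SP formDl formZl.
  have [c cP] := fundsym_norm_equiv J1 J; have [d dP] := fundsym_norm_equiv J' J2.
  exists (`|c| * (C * d)) => x; apply: le_trans (cP _) _.
  apply: (@le_trans _ _ (`|c| * fundsym_norm J (S x))).
    by rewrite ler_wpM2r ?norm_ge0// ler_norm.
  rewrite -!mulrA ler_wpM2l//; apply: le_trans (Sb x) _.
  by rewrite ler_wpM2l.
by exists (mkBop Sc).
Qed.

(* The Krein space adjoint, which is unique by [adjop_unique]. *)
Definition adjop K L (T : bop K L) : bop L K := sval (cid (adjoint_ex T)).

Lemma adjopP K L (T : bop K L) y x :
  krein_form K (adjop T y) x = krein_form L y (T x).
Proof. by rewrite /adjop; case: cid. Qed.

Lemma adjop_unique K L (T : bop K L) (S : bop L K) :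
  (forall y x, krein_form K (S y) x = krein_form L y (T x)) -> S = adjop T.
Proof.
by move=> H; apply: bop_ext => y; apply: krein_nondeg => z; rewrite H adjopP.
Qed.

Lemma adjop_conj_linear K L (a : R[i]) (S T : bop K L) :
  adjop (a *: S + T) = a^* *: adjop S + adjop T.
Proof.
apply/esym/adjop_unique => y x.
by rewrite !bopD !bopZ formDl formZl conjCK formDr formZr !adjopP.
Qed.
Lemma adjop_idop K : adjop (idop K) = idop K.
Proof. by apply/esym/adjop_unique. Qed.
Lemma adjop_compop K L M (S : bop L M) (T : bop K L) :
  adjop (compop S T) = compop (adjop T) (adjop S).
Proof.
apply/esym/adjop_unique => y x.
exact: etrans (adjopP T (adjop S y) x) (adjopP S y (T x)).
Qed.
Lemma adjopK K L (T : bop K L) : adjop (adjop T) = T.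
Proof.
apply/esym/adjop_unique => y x.
by rewrite [in RHS]form_herm adjopP; exact: form_herm.
Qed.
End BoundedOperators.

Record starCat (R : realType) := StarCat {
  ob :> Type;
  mor : ob -> ob -> lmodType R[i];
  idmor : forall A, mor A A;
  mcomp : forall A B C, mor B C -> mor A B -> mor A C;
  star : forall A B, mor A B -> mor B A;
  mcomp1f : forall A B (f : mor A B), mcomp (idmor B) f = f;
  mcompf1 : forall A B (f : mor A B), mcomp f (idmor A) = f;
  mcompA : forall A B C D (h : mor C D) (g : mor B C) (f : mor A B),
    mcomp h (mcomp g f) = mcomp (mcomp h g) f;
  mcomp_linearl : forall A B C (f : mor A B),
    linear (fun g : mor B C => mcomp g f);
  mcomp_linearr : forall A B C (g : mor B C),
    linear (fun f : mor A B => mcomp g f);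
  star_conj_linear : forall A B (a : R[i]) (f g : mor A B),
    star (a *: f + g) = a^* *: star f + star g;
  star_idmor : forall A, star (idmor A) = idmor A;
  star_mcomp : forall A B C (g : mor B C) (f : mor A B),
    star (mcomp g f) = mcomp (star f) (star g);
  starK : forall A B (f : mor A B), star (star f) = f
}.
Arguments idmor {R s} A.

(* [F] is the action on objects, [phi] the action on morphisms. *)
Record isStarFunctor (R : realType) (C D : starCat R) (F : C -> D)
    (phi : forall A B, mor A B -> mor (F A) (F B)) : Prop := IsStarFunctor {
  functor_linear : forall A B, linear (@phi A B);
  functor_idmor : forall A, phi A A (idmor A) = idmor (F A);
  functor_comp : forall A B E (g : mor B E) (f : mor A B),
    phi A E (mcomp g f) = mcomp (phi B E g) (phi A B f);
  functor_star : forall A B (f : mor A B), phi B A (star f) = star (phi A B f)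
}.

Section KreinCstar.
Context (R : realType) (C : starCat R).

Definition spectrum (A : C) (a : mor A A) : set R[i] :=
  [set l | ~ exists b : mor A A,
     mcomp b (a - l *: idmor A) = idmor A /\ mcomp (a - l *: idmor A) b = idmor A].

(* Positivity in a unital C*-algebra with involution [sharp]: self-adjoint with
   spectrum in [0, +oo[ (in R[i], 0 <= l forces l to be real). *)
Definition cstar_positive (A : C) (sharp : mor A A -> mor A A) (a : mor A A) : Prop :=
  sharp a = a /\ forall l, spectrum a l -> 0 <= l.

(* [alpha] fixes the objects, so it is given by its action on morphisms.
   Submultiplicativity of N is not an axiom: on each Hom(A, A), completeness and
   the identity N (sharp x * x) = N x ^ 2 already force it (Araki-Elliott,
   Sebestyen), so that Hom(A, A) is a C*-algebra. *)
Definition fundamental_symmetry (alpha : forall A B : C, mor A B -> mor A B) : Prop :=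
  [/\ isStarFunctor (F := fun A => A) alpha,
      forall A B (x : mor A B), alpha A B (alpha A B x) = x,
      exists N : forall A B : C, normOn (mor A B),
        (forall A B, banach (N A B)) /\
        forall A B (x : mor A B),
          N A A (mcomp (alpha B A (star x)) x) = (N A B x) ^+ 2 &
      forall A B (x : mor A B),
        cstar_positive (fun y => alpha A A (star y)) (mcomp (alpha B A (star x)) x)].

Definition krein_Cstar_category : Prop := exists alpha, fundamental_symmetry alpha.
End KreinCstar.

Section KreinCategory.
Context (R : realType) (I : Type) (K : I -> kreinSpace R).

Let mor' (i j : I) : lmodType R[i] := bop (K i) (K j).

Let B1m i j (f : mor' i j) : compop (idop _) f = f.
Proof. exact: bop_ext. Qed.
Let Bm1 i j (f : mor' i j) : compop f (idop _) = f.
Proof. exact: bop_ext. Qed.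
Let BA i j k l (h : mor' k l) (g : mor' j k) (f : mor' i j) :
  compop h (compop g f) = compop (compop h g) f.
Proof. exact: bop_ext. Qed.
Let Bl i j k (f : mor' i j) : linear (fun g : mor' j k => compop g f : mor' i k).
Proof. by move=> a g g'; exact: bop_ext. Qed.
Let Br i j k (g : mor' j k) : linear (fun f : mor' i j => compop g f : mor' i k).
Proof. by move=> a f f'; apply: bop_ext => x; exact: bop_linear. Qed.

Definition kreinCat : starCat R := @StarCat R I mor' (fun i => idop (K i))
  (fun i j k => @compop R (K i) (K j) (K k)) (fun i j => @adjop R (K i) (K j))
  B1m Bm1 BA Bl Br (fun i j => @adjop_conj_linear R (K i) (K j))
  (fun i => adjop_idop (K i)) (fun i j k => @adjop_compop R (K i) (K j) (K k))
  (fun i j => @adjopK R (K i) (K j)).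

Definition alphaJ (J : forall i, fundSym (K i)) (i j : kreinCat) (T : mor i j) :
    mor i j :=
  mcomp (symop (J j) : @mor _ kreinCat j j) (mcomp T (symop (J i) : @mor _ kreinCat i i)).
End KreinCategory.

(* Only the values of [sub_mor] between objects of [sub_ob] matter. *)
Record subStarCat (R : realType) (D : starCat R) := SubStarCat {
  sub_ob : set D;
  sub_mor : forall A B : D, submodClosed (mor A B);
  sub_idmor : forall A, sub_ob A -> idmor A \in sub_mor A A;
  sub_mcomp : forall A B C (g : mor B C) (f : mor A B),
    sub_ob A -> sub_ob B -> sub_ob C ->
    g \in sub_mor B C -> f \in sub_mor A B -> mcomp g f \in sub_mor A C;
  sub_star : forall A B (f : mor A B), sub_ob A -> sub_ob B ->
    f \in sub_mor A B -> star f \in sub_mor B A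
}.

Section SubCategory.
Context (R : realType) (D : starCat R) (E : subStarCat D).

Let sob := {A : D | sub_ob E A}.
Let smor (A B : sob) : lmodType R[i] := subvect (sub_mor E (sval A) (sval B)).

Let sid (A : sob) : smor A A :=
  exist (fun f => f \in sub_mor E (sval A) (sval A)) _ (sub_idmor (svalP A)).
Let scomp (A B C : sob) (g : smor B C) (f : smor A B) : smor A C :=
  exist (fun f => f \in sub_mor E (sval A) (sval C)) _
    (sub_mcomp (svalP A) (svalP B) (svalP C) (svalP g) (svalP f)).
Let sstar (A B : sob) (f : smor A B) : smor B A :=
  exist (fun f => f \in sub_mor E (sval B) (sval A)) _
    (sub_star (svalP A) (svalP B) (svalP f)).

Let S1m A B (f : smor A B) : scomp (sid B) f = f.
Proof. by apply: val_inj; exact: mcomp1f. Qed.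
Let Sm1 A B (f : smor A B) : scomp f (sid A) = f.
Proof. by apply: val_inj; exact: mcompf1. Qed.
Let SA A B C F (h : smor C F) (g : smor B C) (f : smor A B) :
  scomp h (scomp g f) = scomp (scomp h g) f.
Proof. by apply: val_inj; exact: mcompA. Qed.
Let Sl A B C (f : smor A B) : linear (fun g : smor B C => scomp g f).
Proof. by move=> a g g'; apply: val_inj; exact: mcomp_linearl. Qed.
Let Sr A B C (g : smor B C) : linear (fun f : smor A B => scomp g f).
Proof. by move=> a g' f; apply: val_inj; exact: mcomp_linearr. Qed.
Let Ss A B (a : R[i]) (f g : smor A B) :
  sstar (a *: f + g) = a^* *: sstar f + sstar g.
Proof. by apply: val_inj; exact: star_conj_linear. Qed.
Let Ss1 A : sstar (sid A) = sid A.
Proof. by apply: val_inj; exact: star_idmor. Qed.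
Let SsM A B C (g : smor B C) (f : smor A B) :
  sstar (scomp g f) = scomp (sstar f) (sstar g).
Proof. by apply: val_inj; exact: star_mcomp. Qed.
Let SsK A B (f : smor A B) : sstar (sstar f) = f.
Proof. by apply: val_inj; exact: starK. Qed.

Definition subcategory : starCat R :=
  @StarCat R sob smor sid scomp sstar S1m Sm1 SA Sl Sr Ss Ss1 SsM SsK.
End SubCategory.

Section Representations.
Context (R : realType) (I : Type) (K : I -> kreinSpace R).

Definition closed_subcategory (D : subStarCat (kreinCat K)) : Prop :=
  forall i j, sub_ob D i -> sub_ob D j ->
    forall (J : fundSym (K i)) (J' : fundSym (K j)),
      closed ([set` sub_mor D i j] : set (normed (opnorm J J'))).
End Representations.

Definition faithful (R : realType) (C D : starCat R) (F : C -> D)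
    (phi : forall A B : C, mor A B -> mor (F A) (F B)) : Prop :=
  forall A B, injective (@phi A B).

Definition isomorphism_onto (R : realType) (C D : starCat R) (F : C -> D)
    (phi : forall A B : C, mor A B -> mor (F A) (F B)) (E : subStarCat D) : Prop :=
  [/\ isStarFunctor phi, injective F, range F = sub_ob E & forall A B,
    injective (@phi A B) /\ range (@phi A B) = [set` sub_mor E (F A) (F B)]].

(* Main.v *)
(* Put [x# := alpha (x^* )].  Each End(A) is then a C*-algebra, and positivity of
   [x# x] enters only through the invertibility of [x# x + l] for [l > 0].  Spectral
   theory is replaced by two facts about a complete norm with [N (x# x) = N x ^ 2]:
   [t - c] is the square of a self-adjoint element when [c] is self-adjoint and
   [N c < t], and [N u ^ 2 <= N (u ^ 2 + v ^ 2)] for commuting self-adjoint [u], [v].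
   They give [N (t - x# x) <= t] for [t >= N x ^ 2] and [N (s + x# x) = s + N x ^ 2],
   so that the Hahn-Banach theorem provides a state of End(A) that is nonnegative on
   all [y# y], for [y] with domain [A], and attains [N x ^ 2] at [x# x].  Averaged
   over [alpha], it becomes [alpha]-invariant and is still at least [N x ^ 2 / 2].

   The Hilbert space at an object D is the completion of the direct sum, over all
   objects A and all invariant states [w] of End(A), of Hom(A, D) with the form
   [w (x# y)].  Morphisms act on it by composition, [alpha] induces a symmetric
   involution J, and the Krein form is [<x, J y>].  The action is bounded, and bounded
   below by [N / 2], so that its image is closed. *)
From HB Require Import structures.
Require Import Defs.
From mathcomp Require Import all_boot all_order all_algebra.
From mathcomp Require Import complex ring lra.
From mathcomp Require Import all_classical all_reals all_analysis.

Set Implicit Arguments.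
Unset Strict Implicit.
Unset Printing Implicit Defensive.

Import Order.TTheory GRing.Theory Num.Theory.
Import numFieldNormedType.Exports.

Local Open Scope classical_set_scope.
Local Open Scope complex_scope.
Local Open Scope ring_scope.

(** The obstacle is to make the involution J symmetric without losing the lower bound on the action.
    Symmetry of [alpha] for the forms [w (x# y)] is invariance of the state [w], and a state
    attaining [N x ^ 2] at [x# x] need not be invariant. Its average over [alpha] keeps half of that
    value because the other half of the average is nonnegative. A lower bound up to a constant
    replaces isometry, since faithfulness and closedness of the image need no more.

    A morphism from D to E is detected by states of End(D), as the image in Hom(D, E) of the
    identity of D. Hence the space at E has to collect Hom(A, E) for every source A, and the states
    have to be nonnegative on [y# y] for y with any codomain.

    For the inner product, composition with [a] has the adjoint composition with [a#]. Passing to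
    the form [<x, J y>] conjugates this adjoint by J and turns [a#] into [alpha (a#)], which is
    [star a].

    Without submultiplicativity, polarization still bounds products up to a factor 16. Comparing
    powers removes the factor for commuting self-adjoint elements, and the square roots are built
    among these. *)

(* Proves identities between sums of atoms and their opposites in an abelian group. *)
Ltac abel_step :=
  match goal with
  | |- is_true (0 == 0) => exact: eqxx
  | |- is_true (?x + ?y == 0) => by rewrite (subrr, addNr)
  | |- is_true (?x + (?y + _) == 0) => rewrite (addKr, addNKr)
  | |- is_true (?x + _ == 0) =>
    let y := (match x with - ?z => z | _ => constr:(- x) end) in
    match goal with
    | |- context [?a + (?y' + ?c)] => unify y y'; rewrite (addrCA a y' c)
    | |- context [?a + ?y'] => unify y y'; rewrite (addrC a y')
    end
  end.
Ltac abel := apply/eqP; rewrite -subr_eq0 ?mulr2n ?(addr0, add0r, opprD, opprK, oppr0) -?addrA;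
  repeat abel_step.

(** * Norms, real inequalities and limits of sequences *)

Section NormReal.
Context (R : realType) (V : lmodType R[i]) (N : normOn V).

Lemma norm_homogR (t : R) x : N (t%:C *: x) = `|t| * N x.
Proof. by rewrite norm_homog modulusR. Qed.

Lemma norm_mulrn x n : N (x *+ n) = N x *+ n.
Proof.
rewrite -(scaler_nat n x) (_ : n%:R = (n%:R : R)%:C); last by rewrite rmorph_nat.
by rewrite norm_homogR ger0_norm// mulr_natl.
Qed.

Lemma norm_sub_le x y : N (x - y) <= N x + N y.
Proof. by rewrite -(normN N y) norm_triangle. Qed.

Lemma norm_le0_eq0 x : N x <= 0 -> x = 0.
Proof. by move=> x0; apply/(norm_eq0 (n := N))/le_anti; rewrite x0 norm_ge0. Qed.

End NormReal.

Lemma le_of_mul_le (R : realFieldType) (a b : R) : 0 <= b -> a ^+ 2 <= b * a -> a <= b.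
Proof.
move=> b0 h; have [a0|a0] := lerP a 0; first exact: le_trans b0.
by rewrite -(ler_pM2r a0) -expr2.
Qed.

(** By Bernoulli's inequality the powers of [s > 1] are unbounded. The exponents are powers of 2
    because the C*-identity controls a self-adjoint element under repeated squaring. *)
Lemma le1_of_exp2n_bounded (R : archiRealFieldType) (s M : R) :
  0 <= s -> (forall n, s ^+ (2 ^ n)%N <= M) -> s <= 1.
Proof.
move=> s0 sM; rewrite leNgt; apply/negP => s1.
have [d sE] : exists d, s = 1 + d by exists (s - 1); rewrite addrC subrK.
have d0 : 0 < d by move: s1; rewrite sE ltrDl.
have bern k : 1 + d *+ k <= s ^+ k.
  elim: k => [|k IH]; first by rewrite mulr0n addr0 expr0.
  rewrite exprS; apply: le_trans (ler_wpM2l s0 IH).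
  have : 0 <= d * d *+ k by rewrite mulrn_wge0// mulr_ge0// ltW.
  rewrite sE mulrDr mulr1 mulrDl mul1r mulrnAr mulrSr; set a := d * d *+ k; lra.
have dM k : (k <= 2 ^ k)%N by rewrite ltnW// ltn_expl.
have := truncnS_gt (M / d); set n := (Num.truncn _).+1.
rewrite ltr_pdivrMr// => Mn.
have dn : d *+ n <= d *+ (2 ^ n)%N by rewrite ler_pMn2l.
have := le_trans (bern _) (sM n); move: dn Mn;
rewrite mulr_natl; set a := d *+ n; set b := d *+ _; lra.
Qed.

Section Limits.
Context (R : realType) (V : lmodType R[i]) (N : normOn V).

Lemma expr_lt_eps (g e : R) : 0 <= g -> g < 1 -> 0 < e -> exists n, g ^+ n < e.
Proof.
move=> g0 g1 e0; have := @cvg_expr R g; rewrite ger0_norm// => /(_ g1).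
move=> /cvgrPdist_lt/(_ _ e0)[n _ /(_ n (leqnn n))/=].
by rewrite sub0r normrN ger0_norm ?exprn_ge0// => gn; exists n.
Qed.

Lemma cauchy_seq_geometric (u : nat -> V) (g : R) : 0 <= g -> g < 1 ->
  (forall n, N (u n.+1 - u n) <= g ^+ n) -> cauchy_seq N u.
Proof.
move=> g0 g1 ug; have g1' : 0 < 1 - g by rewrite subr_gt0.
have bnd n k : N (u (n + k)%N - u n) <= (g ^+ n - g ^+ (n + k)%N) / (1 - g).
  elim: k => [|k IH]; first by rewrite addn0 !subrr norm0 mul0r.
  rewrite addnS; apply: le_trans (norm_dist_trans _ (u (n + k)%N) _ _) _.
  apply: le_trans (lerD (ug _) IH) _.
  rewrite -(@ler_pM2r _ (1 - g))// mulrDl !divfK ?gt_eqF// exprS.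
  by rewrite le_eqVlt; apply/orP; left; apply/eqP; ring.
move=> e e0; have e2 : 0 < e / 2 * (1 - g) by rewrite mulr_gt0// divr_gt0.
have [n0 gn0] := expr_lt_eps g0 g1 e2.
have tail m : (n0 <= m)%N -> N (u m - u n0) < e / 2.
  move=> /subnKC <-; apply: le_lt_trans (bnd _ _) _.
  by rewrite ltr_pdivrMr//; apply: le_lt_trans gn0; rewrite gerBl exprn_ge0.
exists n0 => m n nm nn; apply: le_lt_trans (norm_dist_trans _ (u n0) _ _) _.
by rewrite [ltRHS]splitr [N (u n0 - _)]norm_distC ltrD// tail.
Qed.

(** Passes an identity to the limit [l]: [x] is the defect of the identity at [l]. Two consecutive
    terms occur because an iteration relates [u n.+1] to [u n]. *)
Lemma eq0_of_converges (u : nat -> V) l (W : lmodType R[i]) (M : normOn W) (x : W) (C : R) :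
  converges N u l -> (forall n, M x <= C * (N (u n - l) + N (u n.+1 - l))) -> x = 0.
Proof.
move=> ul xC; apply: (norm_le0_eq0 (N := M)); apply/ler_addgt0Pl => e e0.
rewrite addr0; pose D := `|C| + 1; have D0 : 0 < D by rewrite ltr_wpDl.
have eD : 0 < e / (D + D) by rewrite divr_gt0// addr_gt0.
have [n0 Hn] := ul _ eD.
apply: le_trans (xC n0) _.
apply: (@le_trans _ _ (D * (N (u n0 - l) + N (u n0.+1 - l)))).
  rewrite ler_wpM2r ?addr_ge0 ?norm_ge0// /D.
  by apply: le_trans (ler_norm _) _; rewrite lerDl.
rewrite mulrC -ler_pdivlMr// (_ : e / D = e / (D + D) + e / (D + D)).
  by apply: lerD; apply: ltW; apply: Hn.
by field; rewrite -mulr2n mulrn_eq0 /= gt_eqF.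
Qed.

End Limits.

(** * Sublinear functionals *)

Section HahnBanach.
Context (R : realType) (V : lmodType R[i]).
Implicit Types p q f : V -> R.

(** Sublinearity over the reals. One inequality suffices for homogeneity, the reverse one being the
    same inequality for [t^-1]. *)
Definition sublinear p : Prop :=
  (forall x y, p (x + y) <= p x + p y) /\
  forall (t : R) x, 0 < t -> p (t%:C *: x) <= t * p x.

Lemma sublinearN p x : sublinear p -> - p (- x) <= p x.
Proof.
move=> [pD pZ]; have := pD 0 0; rewrite addr0; have := pD x (- x); rewrite subrr; lra.
Qed.

(** Serves three times: to bound a chain in Zorn's lemma, to show that a minimal functional is
    additive, and to build the functional that dominates a state. *)
Lemma sublinear_inf (T : Type) (P : set T) (F : T -> V -> R) :
  P !=set0 ->
  (forall x, exists m, forall a, P a -> m <= F a x) ->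
  (forall a b x y, P a -> P b -> exists2 c, P c & F c (x + y) <= F a x + F b y) ->
  (forall a t x, P a -> 0 < t -> exists2 c, P c & F c (t%:C *: x) <= t * F a x) ->
  let p x := inf [set F a x | a in P] in
  sublinear p /\ forall a x, P a -> p x <= F a x.
Proof.
move=> [a0 Pa0] lb FD FZ p.
have pF a x : P a -> p x <= F a x.
  move=> Pa; apply: ge_inf; last by exists a.
  by have [m mP] := lb x; exists m => _ [b Pb <-]; exact: mP.
have glb x m : (forall a, P a -> m <= F a x) -> m <= p x.
  by move=> mP; apply: lb_le_inf; [exists (F a0 x), a0|move=> _ [a Pa <-]; exact: mP].
split=> //; split.
- move=> x y; rewrite -lerBlDr; apply/glb => a Pa.
  rewrite lerBlDr -lerBlDl; apply/glb => b Pb; rewrite lerBlDl.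
  by have [c Pc] := FD a b x y Pa Pb; exact: le_trans (pF _ _ Pc).
- move=> t x t0; rewrite -ler_pdivrMl//; apply/glb => a Pa; rewrite ler_pdivrMl//.
  by have [c Pc] := FZ a t x Pa t0; exact: le_trans (pF _ _ Pc).
Qed.

(* A minimal sublinear functional is linear, and Zorn's lemma provides one
   below [p]. *)
Lemma sublinear_linear p : sublinear p -> exists f,
  [/\ forall x y, f (x + y) = f x + f y,
      forall (t : R) x, f (t%:C *: x) = t * f x &
      forall x, f x <= p x].
Proof.
move=> ps; pose T := {q | sublinear q /\ forall x, q x <= p x}.
(* The order is reversed, so that a maximal element for Zorn's lemma is a minimal functional. *)
pose le (s t : T) := `[< forall x, sval t x <= sval s x >].
have [||||[q [qs qp]] qmin] := @Zorn T le.
- by move=> s; apply/asboolP => x.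
- by move=> r s t /asboolP rs /asboolP st; apply/asboolP => x; exact: le_trans (st x) (rs x).
- move=> [s sp] [t tp] /asboolP /= st /asboolP /= ts; apply: eq_exist; apply/funext => x; apply/le_anti.
  by rewrite st ts.
- move=> C Ctot; have [[s0 Cs0]|C0] := pselect (C !=set0); last first.
    by exists (exist _ p (conj ps (fun=> lexx _))) => s Cs; case: C0; exists s.
  have [|||| rs rC] := @sublinear_inf T C (fun s => sval s).
  + by exists s0.
  + move=> x; exists (- p (- x)) => s Cs; have [ss sp] := svalP s.
    by apply: le_trans (sublinearN x ss); rewrite lerN2.
  + move=> s t x y Cs Ct; have [/asboolP st|/asboolP ts] := Ctot s t Cs Ct.
    * exists t => //; have [[tD _] _] := svalP t.
      by apply: le_trans (tD x y) _; rewrite lerD2r.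
    * exists s => //; have [[sD _] _] := svalP s.
      by apply: le_trans (sD x y) _; rewrite lerD2l.
  + by move=> s t x Cs t0; exists s => //; have [[_ sZ] _] := svalP s; exact: sZ.
  have rp x : inf [set sval s x | s in C] <= p x.
    by apply: le_trans (rC _ x Cs0) _; have [_] := svalP s0.
  pose P q := sublinear q /\ forall x, q x <= p x.
  by exists (exist P _ (conj rs rp)) => s Cs; apply/asboolP => x /=; exact: rC.
have [qD qZ] := qs.
have q0 : q 0 = 0.
  have := qZ 2 0 (ltr0Sn _ _); have := qZ (1 / 2) 0; rewrite divr_gt0// => /(_ isT).
  by rewrite !scaler0 => h1 h2; apply/le_anti/andP; split; lra.
have qZe t x : 0 <= t -> q (t%:C *: x) = t * q x.
  rewrite le_eqVlt => /orP[/eqP <-|t0]; first by rewrite scale0r q0 mul0r.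
  apply/le_anti; rewrite qZ//= -ler_pdivlMl//.
  have := qZ t^-1 (t%:C *: x); rewrite invr_gt0 scalerA -realcM mulVf ?gt_eqF//.
  by rewrite scale1r; exact.
have qD' x y : q (x + y) = q x + q y.
  apply/le_anti; rewrite qD /=.
  (* The infimum over [t >= 0] of [q (z + t y) - t q y] is sublinear and at most [q], hence equal to
     [q] by minimality. The index [t = 1] then gives [q x <= q (x + y) - q y]. *)
  have [|||| rs rC] := @sublinear_inf R [set t | 0 <= t]
      (fun t x => q (x + t%:C *: y) - t * q y).
  + by exists 0 => /=.
  + move=> z; exists (- q (- z)) => t /= t0.
    rewrite -qZe//; have := qD (z + t%:C *: y) (- z).
    by rewrite addrAC subrr add0r; lra.
  + move=> a b z w /= a0 b0; exists (a + b); first exact: addr_ge0.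
    rewrite realcD scalerDl addrACA mulrDl.
    by have := qD (z + a%:C *: y) (w + b%:C *: y); lra.
  + move=> a t z /= a0 t0; exists (t * a); first by rewrite mulr_ge0// ltW.
    by rewrite realcM -scalerA -scalerDr mulrBr mulrA lerD2r qZ.
  set r := fun x => _ in rs rC.
  have rq x' : r x' <= q x'.
    by have := rC 0 x' (lexx _); rewrite scale0r addr0 mul0r subr0.
  have rp x' : r x' <= p x' by exact: le_trans (rq x') (qp x').
  pose P q := sublinear q /\ forall x, q x <= p x.
  have := qmin (exist P r (conj rs rp)) (asboolT rq) => /(congr1 sval)/= rE.
  have := rC 1 x ler01; rewrite -[X in X <= _]/(r x) rE scale1r mul1r; lra.
exists q; split=> // t x.
have qN z : q (- z) = - q z.
  by apply/eqP; rewrite -addr_eq0 -qD' addNr q0.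
have [t0|t0] := lerP 0 t; first exact: qZe.
by apply: oppr_inj; rewrite -qN -scaleNr -rmorphN qZe ?oppr_ge0 ?ltW// mulNr.
Qed.

End HahnBanach.

(** * Complete C*-norms that are not assumed submultiplicative *)

Section CstarNorm.
Context (R : realType) (A : algType R[i]) (N : normOn A) (sh : A -> A).
Hypothesis sh_conj_linear : forall (a : R[i]) x y,
  sh (a *: x + y) = a^* *: sh x + sh y.
Hypothesis shM : forall x y, sh (x * y) = sh y * sh x.
Hypothesis shK : involutive sh.
Hypothesis norm_Cstar : forall x, N (sh x * x) = N x ^+ 2.

Let sa x := sh x = x.
Local Notation "t %:RA" := (t%:C%:A : A) (at level 2, format "t %:RA").

Lemma shD x y : sh (x + y) = sh x + sh y.
Proof. by have := sh_conj_linear 1 x y; rewrite rmorph1 !scale1r. Qed.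

Lemma sh0 : sh 0 = 0.
Proof. by apply: (addrI (sh 0)); rewrite -shD !addr0. Qed.

Lemma shZ (a : R[i]) x : sh (a *: x) = a^* *: sh x.
Proof. by have := sh_conj_linear a x 0; rewrite sh0 !addr0. Qed.

Lemma shN x : sh (- x) = - sh x.
Proof. by rewrite -scaleN1r shZ rmorphN1 scaleN1r. Qed.

Lemma sh1 : sh 1 = 1.
Proof. by have := shM (sh 1) 1; rewrite mulr1 shK mulr1 => {2}->. Qed.

Lemma conjR (t : R) : (t%:C)^* = t%:C.
Proof. exact: conjc_real. Qed.

Lemma saR t : sa t%:RA. Proof. by rewrite /sa shZ conjR sh1. Qed.
Lemma sa1 : sa 1. Proof. exact: sh1. Qed.
Lemma saD x y : sa x -> sa y -> sa (x + y). Proof. by rewrite /sa shD => -> ->. Qed.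
Lemma saN x : sa x -> sa (- x). Proof. by rewrite /sa shN => ->. Qed.
Lemma saB x y : sa x -> sa y -> sa (x - y). Proof. by move=> ? /saN; exact: saD. Qed.
Lemma saZ (t : R) x : sa x -> sa (t%:C *: x).
Proof. by rewrite /sa shZ conjR => ->. Qed.
Lemma saM x y : sa x -> sa y -> GRing.comm x y -> sa (x * y).
Proof. by rewrite /sa shM => -> -> ->. Qed.
Lemma saX x n : sa x -> sa (x ^+ n).
Proof.
move=> xs; elim: n => [|n IH]; first exact: sa1.
by rewrite exprS; apply: saM => //; exact: commrX.
Qed.

Lemma commR t (x : A) : GRing.comm x t%:RA.
Proof. by rewrite /GRing.comm -scalerAr -scalerAl mulr1 mul1r. Qed.
Lemma commZ (a : R[i]) (x y : A) : GRing.comm x y -> GRing.comm x (a *: y).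
Proof. by rewrite /GRing.comm -scalerAr -scalerAl => ->. Qed.

Lemma norm_sqr x : sa x -> N (x * x) = N x ^+ 2.
Proof. by move=> xs; have := norm_Cstar x; rewrite xs. Qed.

Lemma norm1 : N 1 = 1.
Proof.
have := norm_sqr sa1; rewrite mulr1 expr2 => /eqP.
rewrite -subr_eq0 -{1}[N 1]mulr1 -mulrBr mulf_eq0 => /orP[/eqP/norm_eq0/eqP|].
  by rewrite oner_eq0.
by rewrite subr_eq0 eq_sym => /eqP.
Qed.

Lemma normR t : N t%:RA = `|t|.
Proof. by rewrite norm_homogR norm1 mulr1. Qed.

Lemma modulus_i : modulus ('i : R[i]) = 1.
Proof. by rewrite /modulus normCi. Qed.
Lemma modulus1 : modulus (1 : R[i]) = 1.
Proof. by rewrite (modulusR (1 : R)) normr1. Qed.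
Lemma modulus_opp (z : R[i]) : modulus (- z) = modulus z.
Proof. by rewrite /modulus normrN. Qed.

(** Polarization: [4 (sh y * x)] is the sum of [c * q c] over the four fourth roots of unity [c],
    and the C*-identity with the triangle inequality bounds each [q c] by [(N x + N y) ^ 2]. *)
Lemma polar_le x y : N (sh y * x) <= (N x + N y) ^+ 2.
Proof.
pose q c := sh (x + c *: y) * (x + c *: y).
have qB (c : R[i]) : q c - q (- c) = (c *: (sh x * y) + c^* *: (sh y * x)) *+ 2.
  rewrite /q !shD !shZ !mulrDl !mulrDr -!scalerAl -!scalerAr rmorphN /= !scaleNr !scalerN opprK.
  set a := sh x * x; set b := c *: _; set d := c^* *: _; set e := c^* *: _.
  by abel.
have q_le c : modulus c = 1 -> N (q c - q (- c)) <= (N x + N y) ^+ 2 *+ 2.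
  move=> c1; apply: le_trans (norm_sub_le _ _ _) _; rewrite /q !norm_Cstar mulr2n.
  apply: lerD; rewrite ler_pXn2r ?nnegrE ?addr_ge0 ?norm_ge0//.
  - by apply: le_trans (norm_triangle _ _ _) _; rewrite norm_homog c1 mul1r.
  - by apply: le_trans (norm_triangle _ _ _) _; rewrite norm_homog modulus_opp c1 mul1r.
have E : (q 1 - q (-1)) + 'i *: (q 'i - q (- 'i)) = (sh y * x) *+ 4.
  have -> : 'i *: (q 'i - q (- 'i)) = (sh y * x - sh x * y) *+ 2.
    rewrite qB conjCi -scalerMnr scalerDr !scalerA mulrN -expr2 sqrCi opprK.
    by rewrite scale1r scaleN1r addrC.
  rewrite qB rmorph1 !scale1r -mulrnDl (_ : _ + _ = sh y * x *+ 2); last by abel.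
  by rewrite -mulrnA.
have := norm_triangle N (q 1 - q (-1)) ('i *: (q 'i - q (- 'i))).
rewrite E norm_mulrn norm_homog modulus_i mul1r.
move=> /le_trans/(_ (lerD (q_le _ modulus1) (q_le _ modulus_i))).
by rewrite -mulrnDr ler_pMn2r.
Qed.

(** After normalizing [x] and [y], the bound [(N x + N y) ^ 2] becomes [(1 + 1) ^ 2 = 4]. *)
Lemma polar_bound x y : N (sh y * x) <= 4 * (N x * N y).
Proof.
have [->|x0] := eqVneq x 0; first by rewrite mulr0 norm0 mul0r mulr0.
have [->|y0] := eqVneq y 0; first by rewrite sh0 mul0r norm0 mulr0 mulr0.
have pos z : z != 0 -> 0 < N z.
  by move=> z0; rewrite lt_neqAle norm_ge0 andbT eq_sym; apply: contra_neq z0 => /norm_eq0.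
have {x0}x0 := pos _ x0; have {y0 pos}y0 := pos _ y0.
have := polar_le ((N x)^-1%:C *: x) ((N y)^-1%:C *: y).
rewrite shZ conjR -scalerAr -scalerAl !norm_homogR !gtr0_norm ?invr_gt0//.
rewrite !mulVf ?gt_eqF// (_ : (1 + 1) ^+ 2 = 4 :> R); last by ring.
rewrite mulrA -invfM ler_pdivrMl ?mulr_gt0//.
by rewrite [_ * 4]mulrC.
Qed.

(** [N (x * y) ^ 2] is the norm of [sh y * (sh x * (x * y))]; two uses of [polar_bound] give
    [4 * 4 = 16] and leave one factor [N (x * y)] to cancel. *)
Lemma norm_mul_bound x y : N (x * y) <= 16 * (N x * N y).
Proof.
apply: le_of_mul_le; first by rewrite !mulr_ge0 ?norm_ge0.
rewrite -norm_Cstar shM -mulrA.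
apply: le_trans (polar_bound _ _) _.
apply: (@le_trans _ _ (4 * (4 * (N (x * y) * N x) * N y))).
  by rewrite ler_wpM2l// ler_wpM2r ?norm_ge0 ?polar_bound.
by rewrite le_eqVlt; apply/orP; left; apply/eqP; ring.
Qed.

Lemma norm_sh_bound x : N (sh x) <= 16 * N x.
Proof.
apply: le_of_mul_le; first by rewrite mulr_ge0 ?norm_ge0.
rewrite -norm_Cstar shK; apply: le_trans (norm_mul_bound _ _) _.
by rewrite mulrA.
Qed.

(** For self-adjoint [w] the norm of [w ^+ (2 ^ n)] is the same power of [N w]. So the powers
    [2 ^ n] of the ratio of both sides all stay below 16, and the ratio is at most 1. *)
Lemma norm_mul_comm u v : sa u -> sa v -> GRing.comm u v ->
  N (u * v) <= N u * N v.
Proof.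
move=> us vs uv.
have sX w n : sa w -> N (w ^+ (2 ^ n)%N) = N w ^+ (2 ^ n)%N.
  move=> ws; elim: n => [|n IH]; first by rewrite !expr1.
  by rewrite expnS mulnC !exprM expr2 norm_sqr ?IH//; exact: saX.
have [->|u0] := eqVneq u 0; first by rewrite mul0r norm0 mul0r.
have [->|v0] := eqVneq v 0; first by rewrite mulr0 norm0 mulr0.
have pos z : z != 0 -> 0 < N z.
  by move=> z0; rewrite lt_neqAle norm_ge0 andbT eq_sym; apply: contra_neq z0 => /norm_eq0.
have p0 : 0 < N u * N v by rewrite mulr_gt0 ?pos.
suff : N (u * v) / (N u * N v) <= 1 by rewrite ler_pdivrMr// mul1r.
apply: (@le1_of_exp2n_bounded _ _ 16); first by rewrite divr_ge0 ?norm_ge0 ?ltW.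
move=> n; rewrite expr_div_n ler_pdivrMr ?exprn_gt0// -sX; last exact: saM.
by rewrite exprMn_comm// exprMn -!sX// norm_mul_bound.
Qed.

(* [u] is the real part of the normal element [u + 'i v], whose norm squares to the
   right-hand side. *)
Lemma norm_sqrD_ge u v : sa u -> sa v -> GRing.comm u v ->
  N u ^+ 2 <= N (u * u + v * v).
Proof.
move=> us vs uv.
have E c : c ^+ 2 = -1 -> c^* = - c -> N (u + c *: v) ^+ 2 = N (u * u + v * v).
  move=> c2 cJ; rewrite -norm_Cstar shD shZ cJ us vs; congr (N _).
  rewrite mulrDl !mulrDr -!scalerAl -!scalerAr. rewrite scalerA mulNr -(expr2 c) c2 opprK scale1r.
  by rewrite -uv scaleNr addrA -(addrA (u * u)) subrr addr0.
have E1 := E _ (sqrCi _) (conjCi _).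
have E2 : N (u - 'i *: v) ^+ 2 = N (u * u + v * v).
  by rewrite -scaleNr E ?sqrrN ?sqrCi// rmorphN /= conjCi.
have E3 : N (u - 'i *: v) = N (u + 'i *: v).
  by apply/eqP; rewrite -(@eqrXn2 _ 2)// ?norm_ge0// E1 E2.
rewrite -E1 ler_pXn2r ?nnegrE ?norm_ge0//.
have := norm_triangle N (u - 'i *: v) (u + 'i *: v).
by rewrite E3 addrACA [- _ + _]addrC subrr addr0 -!mulr2n norm_mulrn ler_pMn2r.
Qed.

Hypothesis norm_complete : forall u, cauchy_seq N u -> exists l, converges N u l.

(** The iterates are self-adjoint and commute, so [norm_mul_comm] applies to them: they stay in the
    ball of radius [N c], where the iteration contracts with ratio [N c]. The factor 16 for general
    products would not give a contraction. Commutation of [d] with the commutant of [c] allows roots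
    of commuting elements to be multiplied later. *)
Lemma sqrt_one_sub c : sa c -> N c < 1 ->
  exists d, [/\ sa d, 1 - c = d * d & forall y, GRing.comm y c -> GRing.comm y d].
Proof.
move=> cs c1; set g := N c in c1; have g0 : 0 <= g by exact: norm_ge0.
(* [d = 1 - e] for the fixed point [e] of [e |-> (c + e ^ 2) / 2] *)
pose h : R := 2^-1.
have hh : h + h = 1 by rewrite /h; field.
have h0 : 0 <= h by rewrite invr_ge0.
pose fix e n : A := if n is m.+1 then h%:C *: (c + e m * e m) else 0.
have es n : sa (e n).
  by elim: n => [|n IH]; [exact: sh0|apply/saZ/saD => //; exact: saM].
have ec y n : GRing.comm y c -> GRing.comm y (e n).
  move=> yc; elim: n => [|n IH]; first exact: commr0.
  by apply/commZ/commrD => //; exact: commrM.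
have ee m n : GRing.comm (e m) (e n) by apply/ec/commr_sym/ec.
have eg n : N (e n) <= g.
  elim: n => [|n IH]; first by rewrite norm0.
  rewrite norm_homogR ger0_norm//.
  have := norm_triangle N c (e n * e n); rewrite norm_sqr// => /(ler_wpM2l h0)/le_trans; apply.
  have : N (e n) ^+ 2 <= g * 1.
    by rewrite expr2 ler_pM ?norm_ge0//; exact: le_trans IH (ltW c1).
  rewrite mulr1 => /(lerD (lexx g))/(ler_wpM2l h0)/le_trans; apply.
  by rewrite mulrDr -mulrDl hh mul1r.
have sqB x y : GRing.comm x y -> x * x - y * y = (x - y) * (x + y).
  by move=> xy; rewrite mulrDr !mulrBl -xy; abel.
have step n : N (e n.+2 - e n.+1) <= g * N (e n.+1 - e n).
  rewrite [e n.+2]/= [X in _ - X]/= -scalerBr norm_homogR ger0_norm//.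
  rewrite (_ : _ - _ = e n.+1 * e n.+1 - e n * e n); last by abel.
  rewrite sqB//; set z := e n.+1 - e n; set w := _ + _.
  have zw : N (z * w) <= N z * N w.
    apply: norm_mul_comm; [exact: saB|exact: saD|].
    by apply: commrD; apply/commr_sym/commrB => //; exact: commr_refl.
  have wg : N w <= g + g by apply: le_trans (norm_triangle _ _ _) _; exact: lerD.
  apply: le_trans (ler_wpM2l h0 zw) _; rewrite mulrCA mulrC ler_wpM2r ?norm_ge0//.
  by apply: le_trans (ler_wpM2l h0 wg) _; rewrite mulrDr -mulrDl hh mul1r.
have eG n : N (e n.+1 - e n) <= g ^+ n.
  elim: n => [|n IH].
    rewrite /= subr0 mulr0 addr0 expr0 norm_homogR ger0_norm// -/g.
    by have := ler_wpM2l h0 (ltW c1); move: hh h0; rewrite mulr1; lra.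
  by apply: le_trans (step n) _; rewrite exprS ler_wpM2l.
have [l el] := norm_complete (cauchy_seq_geometric g0 c1 eG).
(* Self-adjointness, commutation and the fixed point equation pass to the limit. Here the factor 16
   is harmless; it yields the constants [17 = 1 + 16], [32 N y] and [2 + 16 (1 + N l)]. *)
have ls : sa l.
  apply/eqP; rewrite -subr_eq0; apply/eqP.
  apply: (@eq0_of_converges _ _ _ _ _ _ N _ 17 el) => n.
  have -> : sh l - l = (e n - l) - sh (e n - l) by rewrite shD shN es; abel.
  apply: le_trans (norm_sub_le _ _ _) _.
  have := norm_sh_bound (e n - l); have := norm_ge0 N (e n.+1 - l).
  by set a := N _; set b := N _; lra.
have lc y : GRing.comm y c -> GRing.comm y l.
  move=> yc; apply/eqP; rewrite -subr_eq0; apply/eqP.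
  apply: (@eq0_of_converges _ _ _ _ _ _ N _ (32 * N y) el) => n.
  have -> : y * l - l * y = (e n - l) * y - y * (e n - l).
    by rewrite mulrBl mulrBr (ec y n yc); abel.
  apply: le_trans (norm_sub_le _ _ _) _.
  have := norm_mul_bound (e n - l) y; have := norm_mul_bound y (e n - l).
  have := mulr_ge0 (norm_ge0 N y) (norm_ge0 N (e n.+1 - l)).
  set a := N (_ * y); set b := N (y * _); set z := N (e n - l); set w := N (_ - _); lra.
have lE : l + l = c + l * l.
  apply/eqP; rewrite -subr_eq0; apply/eqP.
  apply: (@eq0_of_converges _ _ _ _ _ _ N _ (2 + 16 * (1 + N l)) el) => n.
  have E : e n.+1 + e n.+1 = c + e n * e n.
    by rewrite /= -scalerDl -realcD hh scale1r.
  have -> : l + l - (c + l * l) = (e n * e n - l * l) - ((e n.+1 - l) + (e n.+1 - l)).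
    rewrite (_ : _ + (e n.+1 - l) = e n.+1 + e n.+1 - l - l); last by abel.
    by rewrite E; abel.
  apply: le_trans (norm_sub_le _ _ _) _.
  rewrite -mulr2n norm_mulrn sqB; last by apply: lc; exact/commr_sym/ec.
  have b1 := norm_mul_bound (e n - l) (e n + l).
  have b2 : N (e n + l) <= 1 + N l.
    apply: le_trans (norm_triangle _ _ _) _; rewrite lerD2r.
    exact: le_trans (eg n) (ltW c1).
  have b3 := ler_wpM2l (norm_ge0 N (e n - l)) b2.
  have b4 := mulr_ge0 (norm_ge0 N l) (norm_ge0 N (e n.+1 - l)).
  have b5 := norm_ge0 N (e n.+1 - l); have b6 := norm_ge0 N (e n - l).
  move: b1 b3 b4 b5 b6; set z := N (e n - l); set w := N (e n.+1 - l); set m := N (_ * _).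
  set p := N (_ + _); set q := N l; nra.
exists (1 - l); split.
- exact: saB sa1 ls.
- rewrite mulrBl !mulrBr !mul1r mulr1.
  have -> : c = l + l - l * l by rewrite lE; abel.
  by abel.
- by move=> y /lc yl; apply: commrB => //; exact: commr1.
Qed.

Lemma sqrt_of_norm_lt c t : sa c -> N c < t ->
  exists d, [/\ sa d, t%:RA - c = d * d & forall y, GRing.comm y c -> GRing.comm y d].
Proof.
move=> cs ct; have t0 : 0 < t by apply: le_lt_trans ct; exact: norm_ge0.
have := @sqrt_one_sub (t^-1%:C *: c).
rewrite norm_homogR gtr0_norm ?invr_gt0// ltr_pdivrMl// mulr1 => /(_ (saZ _ cs) ct).
move=> [d [ds dd dc]]; exists ((Num.sqrt t)%:C *: d); split.
- exact: saZ.
- rewrite -scalerAl -scalerAr scalerA -realcM -expr2 sqr_sqrtr ?ltW// -dd.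
  by rewrite scalerBr scalerA -realcM mulfV ?gt_eqF// scale1r.
- by move=> y yc; apply: commZ; apply: dc; exact: commZ.
Qed.

Lemma raD (s t : R) : (s + t)%:RA = s%:RA + t%:RA.
Proof. by rewrite realcD scalerDl. Qed.
Lemma raN (s : R) : (- s)%:RA = - s%:RA.
Proof. by rewrite rmorphN scaleNr. Qed.
Lemma raB (s t : R) : (s - t)%:RA = s%:RA - t%:RA.
Proof. by rewrite raD raN. Qed.
Lemma raMl (t : R) x : t%:RA * x = t%:C *: x.
Proof. by rewrite -scalerAl mul1r. Qed.

(** For a self-adjoint element of a C*-algebra this amounts to a nonnegative spectrum: a real [l]
    with [|l| <= t] satisfies [|t - l| <= t] exactly when [l >= 0]. *)
Definition cstar_pos y := forall t, N y <= t -> N (t%:RA - y) <= t.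

(* If [r := N (t - b) > t], then [g := b + (r - t)] has an inverse [i]; writing
   [M - i = e ^ 2], [g + h = d ^ 2] and [t + h - b = k ^ 2] one gets
   [M k ^ 2 + (e d) ^ 2 = M (r + 2 h) - 1 - h i], hence
   [M (r - h) <= M (r + 2 h) - 1 + h N(i)], which is absurd for small [h]. *)
Lemma cstar_pos_of_inv b : sa b ->
  (forall l : R, 0 < l -> exists i, i * (b + l%:RA) = 1 /\ (b + l%:RA) * i = 1) ->
  cstar_pos b.
Proof.
move=> bs binv t bt; have t0 : 0 <= t by exact: le_trans (norm_ge0 _ _) bt.
rewrite leNgt; apply/negP; set r := N _ => tr.
have r0 : 0 < r by exact: le_lt_trans tr.
pose l := r - t; have l0 : 0 < l by rewrite subr_gt0.
have [i [ig gi]] := binv l l0; set g := b + l%:RA in ig gi.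
have gs : sa g by apply/saD/saR.
have is_ : sa i.
  have : sh i = (i * g) * sh i by rewrite ig mul1r.
  by rewrite -mulrA -{1}gs -shM ig sh1 mulr1 /sa => ->.
have cg y : GRing.comm y b -> GRing.comm y g by move=> yb; exact/commrD/commR.
have ci y : GRing.comm y b -> GRing.comm y i.
  move=> /cg yg; rewrite /GRing.comm -[LHS]mul1r -ig -[RHS]mulr1 -gi.
  by rewrite !mulrA -(mulrA i y g) yg !mulrA.
(* [N i < M] provides the root of [M - i], and [1 <= M * r] makes the scalar [M (r + 2 h) - 1]
   nonnegative, so that it equals its norm. *)
pose M := N i + 1 + r^-1.
have ri : 0 < r^-1 by rewrite invr_gt0.
have i0 : 0 <= N i := norm_ge0 _ _.
have M0 : 0 < M by rewrite /M; lra.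
have iM : N i < M by rewrite /M; lra.
have Mr : 1 <= M * r.
  by rewrite /M !mulrDl mulVf ?gt_eqF// lerDr; nra.
have [e [es ee ec]] := sqrt_of_norm_lt is_ iM.
(* The inequality to be refuted simplifies to [1 <= h (3 M + N i)]. *)
pose h := (3 * M + N i + 1)^-1.
have D0 : 0 < 3 * M + N i + 1 by lra.
have h0 : 0 < h by rewrite invr_gt0.
have hE : h * (3 * M + N i + 1) = 1 by rewrite mulVf// gt_eqF.
have cs : sa (t%:RA - b) by apply: saB => //; exact: saR.
have cc y : GRing.comm y b -> GRing.comm y (t%:RA - b).
  by move=> yb; apply: commrB => //; exact: commR.
have rrh : N (t%:RA - b) < r + h by rewrite -/r ltrDl.
have [d [ds dd dc]] := sqrt_of_norm_lt cs rrh.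
have bth : N b < t + h by apply: le_lt_trans bt _; rewrite ltrDl.
have [k [ks kk kc]] := sqrt_of_norm_lt bs bth.
have bb : GRing.comm b b by [].
have cbd : GRing.comm b d by apply/dc/cc.
have ced : GRing.comm e d.
  by apply/dc/cc/commr_sym/ec/ci.
have ced_k : GRing.comm k (e * d).
  apply: commrM.
    by apply/ec/ci/commr_sym/kc.
  by apply/dc/cc/commr_sym/kc.
pose k' := (Num.sqrt M)%:C *: k.
have k'k' : k' * k' = M%:C *: ((t + h)%:RA - b).
  by rewrite -scalerAl -scalerAr scalerA -realcM -expr2 sqr_sqrtr ?ltW// kk.
have := @norm_sqrD_ge k' (e * d) (saZ _ ks) (saM es ds ced).
move=> /(_ (commr_sym (commZ _ (commr_sym ced_k)))).
rewrite -norm_sqr; last exact: saZ.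
rewrite k'k' norm_homogR gtr0_norm//.
have -> : M%:C *: ((t + h)%:RA - b) + e * d * (e * d) =
    (M * (r + h + h) - 1)%:RA - h%:C *: i.
  rewrite mulrA -(mulrA e d e) -ced mulrA -mulrA -ee -dd.
  have -> : (r + h)%:RA - (t%:RA - b) = g + h%:RA.
    by rewrite /g /l raB raD; abel.
  rewrite mulrBl raMl mulrDr ig -scalerAr mulr1 addrA -scalerDr.
  have -> : (t + h)%:RA - b + (g + h%:RA) = (r + h + h)%:RA.
    by rewrite /g /l raB !raD; abel.
  by rewrite scalerA -realcM raB scale1r; abel.
move=> /le_trans/(_ (norm_sub_le _ _ _)).
rewrite normR norm_homogR !ger0_norm ?(ltW h0)//; last first.
  by rewrite mulrDr mulrDr; have := mulr_gt0 M0 h0; lra.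
have : r - h <= N ((t + h)%:RA - b).
  have := norm_sub_le N ((t + h)%:RA - b) h%:RA.
  have -> : (t + h)%:RA - b - h%:RA = t%:RA - b by rewrite raD; abel.
  by rewrite normR gtr0_norm// -/r; lra.
move=> /(ler_wpM2l (ltW M0)) a1 /(le_trans a1).
by move: hE; nra.
Qed.

(* With [m := N (s + b)], [k ^ 2 = b + h] and [d ^ 2 = m + h - s - b] one has
   [(k ^ 2) ^ 2 + (k d) ^ 2 = (m - s + 2 h) k ^ 2], so that
   [N (k ^ 2) <= m - s + 2 h]. *)
Lemma norm_realD_pos b s : sa b -> cstar_pos b -> 0 <= s -> s + N b <= N (s%:RA + b).
Proof.
move=> bs bp s0; set m := N (s%:RA + b).
apply/ler_addgt0Pl => e e0; pose h := e / 3.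
have h0 : 0 < h by rewrite divr_gt0.
have eE : e = 3 * h by rewrite /h; field.
have cs : sa ((N b)%:RA - b) by apply: saB => //; exact: saR.
(* Positivity at [t = N b] bounds [N (N b - b)], so that [h + b = (N b + h) - (N b - b)] has a
   square root. *)
have chb : N ((N b)%:RA - b) < N b + h.
  by apply: le_lt_trans (bp _ (lexx _)) _; rewrite ltrDl.
have [k [ks kk kc]] := sqrt_of_norm_lt cs chb.
have {}kk : k * k = h%:RA + b by rewrite -kk raD; abel.
have cs' : sa (s%:RA + b) by apply: saD => //; exact: saR.
have mh : N (s%:RA + b) < m + h by rewrite ltrDl.
have [d [ds dd dc]] := sqrt_of_norm_lt cs' mh.
have bb : GRing.comm b b by [].
have kb : GRing.comm k b.
  by apply/commr_sym/kc/commrB => //; exact: commR.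
have kd : GRing.comm k d by apply/dc/commrD => //; exact: commR.
pose w := m - s + h + h.
(* [w] must be nonnegative before a factor [N (k * k)] can be cancelled. With [q ^ 2 = s],
   [norm_sqrD_ge] gives [s <= N (s + b + h) <= m + h]. *)
have w0 : 0 <= w.
  pose q := (Num.sqrt s)%:RA.
  have qq : q * q = s%:RA by rewrite raMl scalerA -realcM -expr2 sqr_sqrtr.
  have := @norm_sqrD_ge q k (saR _) ks (commr_sym (commR _ _)).
  rewrite -norm_sqr; last exact: saR.
  rewrite qq normR ger0_norm// kk.
  have -> : s%:RA + (h%:RA + b) = s%:RA + b + h%:RA by abel.
  move=> /le_trans/(_ (norm_triangle _ _ _)); rewrite normR gtr0_norm// -/m /w; lra.
have : N (k * k) <= w.
  apply: le_of_mul_le => //.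
  have kks : sa (k * k) by exact: saM.
  have := @norm_sqrD_ge (k * k) (k * d) kks (saM ks ds kd).
  have c1 : GRing.comm (k * k) (k * d).
    by apply: commrM; apply: commr_sym; apply: commrM => //; exact: commr_sym.
  move=> /(_ c1)/le_trans; apply.
  have -> : k * d * (k * d) = k * k * (d * d).
    by rewrite -mulrA (mulrA d k d) -kd -mulrA mulrA.
  rewrite -mulrDr -dd.
  have -> : k * k + ((m + h)%:RA - (s%:RA + b)) = w%:RA.
    by rewrite kk /w !(raD, raN); abel.
  by rewrite commR raMl norm_homogR ger0_norm.
have : N b <= N (k * k) + h.
  rewrite (_ : b = k * k - h%:RA); last by rewrite kk; abel.
  apply: le_trans (norm_sub_le _ _ _) _; by rewrite normR gtr0_norm.
by rewrite /w eE; lra.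
Qed.

(* [f] lies below the infimum of [N (a + s + t b) - s - t N(b)] over [s, t >= 0],
   which is finite by [norm_realD_pos]. *)
Lemma state_ex b : sa b -> cstar_pos b -> exists f : A -> R,
  [/\ forall x y, f (x + y) = f x + f y,
      forall (t : R) x, f (t%:C *: x) = t * f x,
      forall x, f x <= N x,
      forall y, cstar_pos y -> 0 <= f y &
      forall k, sh k = - k -> f k = 0] /\ N b <= f b.
Proof.
move=> bs bp; pose P : set (R * R) := [set u | 0 <= u.1 /\ 0 <= u.2].
pose F (u : R * R) a := N (a + u.1%:RA + u.2%:C *: b) - u.1 - u.2 * N b.
have [|||| ps pF] := @sublinear_inf _ A _ P F.
- by exists (0, 0); split => /=.
- move=> x; exists (- N x) => -[s t] [/= s0 t0]; rewrite /F /=.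
  have : s + t * N b <= N (s%:RA + t%:C *: b).
    move: t0; rewrite le_eqVlt => /orP[/eqP <-|t0].
      by rewrite mul0r scale0r !addr0 normR ger0_norm.
    have := norm_realD_pos bs bp (divr_ge0 s0 (ltW t0)).
    move=> /(ler_wpM2l (ltW t0)).
    rewrite mulrDr mulrCA mulfV ?gt_eqF// mulr1 => /le_trans; apply.
    rewrite -{1}(gtr0_norm t0) -norm_homogR scalerDr scalerA -realcM.
    by rewrite mulrCA mulfV ?gt_eqF// mulr1.
  have := norm_sub_le N (x + s%:RA + t%:C *: b) x.
  have -> : x + s%:RA + t%:C *: b - x = s%:RA + t%:C *: b by abel.
  lra.
- move=> [s t] [s' t'] x y [/= s0 t0] [/= s'0 t'0].
  exists (s + s', t + t'); first by split; rewrite addr_ge0.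
  rewrite /F /= raD realcD scalerDl.
  have -> : x + y + (s%:RA + s'%:RA) + (t%:C *: b + t'%:C *: b) =
    (x + s%:RA + t%:C *: b) + (y + s'%:RA + t'%:C *: b) by abel.
  have := norm_triangle N (x + s%:RA + t%:C *: b) (y + s'%:RA + t'%:C *: b).
  by rewrite mulrDl; lra.
- move=> [s t] u x [/= s0 t0] u0; exists (u * s, u * t).
    by split; rewrite /= mulr_ge0// ltW.
  rewrite /F /= !realcM -!scalerA -!scalerDr norm_homogR gtr0_norm//.
  by rewrite !mulrBr mulrA.
have [f [fD fZ fp]] := sublinear_linear ps.
have f0 : f 0 = 0 by have := fZ 0 0; rewrite scaler0 mul0r.
have fN x : f (- x) = - f x by apply/eqP; rewrite -addr_eq0 -fD addNr f0.
have fF s t x : 0 <= s -> 0 <= t -> f x <= F (s, t) x.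
  by move=> s0 t0; apply: le_trans (fp _) _; apply: pF.
have F0 s x : F (s, 0) x = N (x + s%:RA) - s.
  by rewrite /F /= scale0r mul0r subr0 addr0.
(* For skew [k], [N (k + s) ^ 2 = N (s ^ 2 - k ^ 2)] is at most [s ^ 2 + N (k ^ 2)], while
   [f k + s <= N (k + s)]. If [f k > 0], this fails for large [s]; the choice below makes [s * f k]
   equal to [N (k ^ 2) + 1]. *)
have fk0 k : sh k = - k -> f k <= 0.
  move=> ks; rewrite leNgt; apply/negP => fk.
  pose s := (N (k * k) + 1) / f k.
  have s0 : 0 < s by rewrite divr_gt0// ltr_wpDl// norm_ge0.
  have := fF s 0 k (ltW s0) (lexx _); rewrite F0 lerBrDr.
  rewrite -(@ler_pXn2r _ 2) ?nnegrE ?norm_ge0 ?addr_ge0 ?(ltW fk) ?(ltW s0)//.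
  rewrite -norm_Cstar shD ks saR.
  have -> : (- k + s%:RA) * (k + s%:RA) = (s ^+ 2)%:RA - k * k.
    rewrite mulrDl !mulrDr !mulNr (commR s k) !raMl scalerA -realcM -expr2.
    by abel.
  move=> /le_trans/(_ (norm_sub_le _ _ _)).
  rewrite normR ger0_norm ?sqr_ge0//.
  have : f k * s = N (k * k) + 1 by rewrite mulrC divfK// gt_eqF.
  rewrite sqrrD; have := sqr_ge0 (f k); have := norm_ge0 N (k * k).
  by set z := f k * s; set w := f k ^+ 2; set q := s ^+ 2; lra.
exists f; split; first split=> //.
- by move=> x; have := fF 0 0 x (lexx _) (lexx _); rewrite F0 scale0r addr0 subr0.
(* The index [s = N y] gives [f (- y) <= N (N y - y) - N y <= 0]. *)
- move=> y yp; rewrite -oppr_le0 -fN.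
  have := fF (N y) 0 (- y) (norm_ge0 _ _) (lexx _); rewrite F0 [- y + _]addrC.
  by have := yp _ (lexx _); lra.
- move=> k ks; apply/le_anti; rewrite fk0//= -oppr_le0 -fN fk0//.
  by rewrite shN ks.
(* At [- b] the index [(0, 1)] contributes [N 0 - N b], whence [f (- b) <= - N b]. *)
- have := fF 0 1 (- b) (lexx _) ler01.
  by rewrite /F /= scale0r addr0 scale1r addNr norm0 fN; lra.
Qed.

End CstarNorm.

(** * Completion of a positive semidefinite form *)

Section ComplexLimits.
Context (R : realType).
Implicit Types (z w : nat -> R[i]) (a b : nat -> R).

Lemma realcN (x : R) : (- x)%:C = - x%:C.
Proof. exact: (rmorphN (real_complex R)). Qed.

Lemma cvg0P a : (forall n, 0 <= a n) ->
  a @ \oo --> (0 : R) <-> forall e, 0 < e -> exists n0, forall n, (n0 <= n)%N -> a n < e.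
Proof.
move=> a0; split=> [/cvgrPdist_lt h e e0|h].
  have [n0 _ H] := h e e0; exists n0 => n nn; have := H n nn.
  by rewrite /= sub0r normrN ger0_norm.
apply/cvgrPdist_lt => e e0; have [n0 H] := h e e0; exists n0 => // n /= nn.
by rewrite sub0r normrN ger0_norm// H.
Qed.

Lemma cvg0_le a b : (forall n, 0 <= a n) -> (forall n, a n <= b n) ->
  b @ \oo --> (0 : R) -> a @ \oo --> (0 : R).
Proof.
move=> a0 ab b0; apply: (squeeze_cvgr _ (cvg_cst (0 : R)) b0).
by apply: nearW => n; rewrite a0 ab.
Qed.

Definition tends z (l : R[i]) : Prop := (fun n => modulus (z n - l)) @ \oo --> (0 : R).

Lemma tends_cst l : tends (fun=> l) l.
Proof. by rewrite /tends subrr modulus0; exact: cvg_cst. Qed.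

Lemma tends_le z l b : b @ \oo --> (0 : R) -> (forall n, modulus (z n - l) <= b n) ->
  tends z l.
Proof. by move=> b0 zb; apply: cvg0_le b0 => // n; exact: modulus_ge0. Qed.

Lemma cvg0D a b : a @ \oo --> (0 : R) -> b @ \oo --> (0 : R) ->
  (fun n => a n + b n) @ \oo --> (0 : R).
Proof. by move=> a0 b0; rewrite -[0 in X in _ --> X]addr0; exact: cvgD. Qed.

Lemma cvg0Ml a (c : R) : a @ \oo --> (0 : R) -> (fun n => c * a n) @ \oo --> (0 : R).
Proof. by move=> a0; rewrite -(mulr0 c); apply: cvgM => //; exact: cvg_cst. Qed.

Lemma tendsD z w l k : tends z l -> tends w k -> tends (fun n => z n + w n) (l + k).
Proof.
move=> zl wk; apply: (tends_le (cvg0D zl wk)) => n.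
by rewrite opprD addrACA modulusD.
Qed.

Lemma tendsZ (c : R[i]) z l : tends z l -> tends (fun n => c * z n) (c * l).
Proof.
move=> zl; apply: (tends_le (cvg0Ml (modulus c) zl)) => n.
by rewrite -mulrBr modulusM.
Qed.

Lemma modulus_conj (c : R[i]) : modulus c^* = modulus c.
Proof. by rewrite /modulus norm_conjC. Qed.

Lemma tends_conj z l : tends z l -> tends (fun n => (z n)^*) l^*.
Proof. by move=> zl; apply: (tends_le zl) => n; rewrite -rmorphB modulus_conj. Qed.

Lemma modulus_le0 (c : R[i]) : modulus c <= 0 -> c = 0.
Proof.
move=> c0; apply/eqP; rewrite -normr_eq0 -modulusE (_ : modulus c = 0)//.
by apply/le_anti; rewrite c0 modulus_ge0.
Qed.

Lemma modulus_subC (c d : R[i]) : modulus (c - d) = modulus (d - c).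
Proof. by rewrite /modulus distrC. Qed.

Lemma modulus_dist_trans (e c d : R[i]) : modulus (c - d) <= modulus (c - e) + modulus (e - d).
Proof. by apply: le_trans (modulusD _ _); rewrite addrA subrK. Qed.

Lemma tends_near z w l : (fun n => modulus (z n - w n)) @ \oo --> (0 : R) ->
  tends w l -> tends z l.
Proof.
by move=> zw wl; apply: (tends_le (cvg0D zw wl)) => n; exact: modulus_dist_trans.
Qed.

Lemma tends_unique z l k : tends z l -> tends z k -> l = k.
Proof.
move=> zl zk; apply/eqP; rewrite -subr_eq0; apply/eqP/modulus_le0.
apply: (cvgr_to_ge (cvg0D zl zk)); apply: nearW => n.
by rewrite (modulus_subC (z n) l) modulus_dist_trans.
Qed.

Lemma Im_le_modulus (c : R[i]) : `|complex.Im c| <= modulus c.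
Proof.
by case: c => x y; rewrite /modulus /= -sqrtr_sqr ler_wsqrtr// lerDr sqr_ge0.
Qed.

Lemma normRe_le_modulus (c : R[i]) : `|complex.Re c| <= modulus c.
Proof.
by case: c => x y; rewrite /modulus /= -sqrtr_sqr ler_wsqrtr// lerDl sqr_ge0.
Qed.

Lemma ReB (c d : R[i]) : complex.Re (c - d) = complex.Re c - complex.Re d.
Proof. by case: c d => ? ? []. Qed.

Lemma ImB (c d : R[i]) : complex.Im (c - d) = complex.Im c - complex.Im d.
Proof. by case: c d => ? ? []. Qed.

Lemma tends_Re z l : tends z l -> (fun n => complex.Re (z n)) @ \oo --> complex.Re l.
Proof.
move=> zl; apply/subr_cvg0/cvgrPdist_lt => e e0.
have [n0 H] := (cvg0P (fun n => modulus_ge0 (z n - l))).1 zl e e0.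
exists n0 => // n /= nn; apply: le_lt_trans (H n nn).
rewrite sub0r normrN; rewrite -ReB; exact: normRe_le_modulus.
Qed.

Lemma real_cauchy_cvg a :
  (forall e, 0 < e -> exists n0, forall m n, (n0 <= m)%N -> (n0 <= n)%N -> `|a m - a n| < e) ->
  exists l, (fun n => `|a n - l|) @ \oo --> (0 : R).
Proof.
move=> ca; have /cvg_ex[/= l al] : cvg (a @ \oo).
  apply: cauchy_cvg; apply/cauchy_ballP => e e0.
  have [n0 H] := ca _ e0; near_simpl.
  near=> m n; rewrite -ball_normE /=; apply: H.
  - by near: m; exists n0.
  - by near: n; exists n0.
exists l; apply/cvg0P => // e e0.
move: al => /cvgrPdist_lt/(_ _ e0)[n0 _ H]; exists n0 => n nn.
by rewrite distrC; exact: H.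
Unshelve. all: by end_near. Qed.

Lemma modulus_le_ReIm (c : R[i]) : modulus c <= `|complex.Re c| + `|complex.Im c|.
Proof.
case: c => x y; rewrite /modulus /= -[leRHS]ger0_norm ?addr_ge0//.
by rewrite -[leRHS]sqrtr_sqr ler_wsqrtr// sqrrD !real_normK ?num_real// lerD2r lerDl
  mulrn_wge0// mulr_ge0.
Qed.

Lemma complex_cauchy_tends z :
  (forall e, 0 < e -> exists n0, forall m n, (n0 <= m)%N -> (n0 <= n)%N ->
     modulus (z m - z n) < e) -> exists l, tends z l.
Proof.
move=> cz.
have [|x zx] := @real_cauchy_cvg (fun n => complex.Re (z n)).
  move=> e /cz[n0 H]; exists n0 => m n nm nn; apply: le_lt_trans (H m n nm nn).
  by rewrite -ReB; exact: normRe_le_modulus.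
have [|y zy] := @real_cauchy_cvg (fun n => complex.Im (z n)).
  move=> e /cz[n0 H]; exists n0 => m n nm nn; apply: le_lt_trans (H m n nm nn).
  by rewrite -ImB; exact: Im_le_modulus.
exists (x +i* y); apply: (tends_le (cvg0D zx zy)) => n.
by apply: le_trans (modulus_le_ReIm _) _; rewrite ReB ImB.
Qed.

End ComplexLimits.

Lemma invS_lt (R : archiRealFieldType) (e : R) : 0 < e ->
  exists n0, forall n, (n0 <= n)%N -> n.+1%:R^-1 < e.
Proof.
move=> e0; exists (Num.truncn e^-1) => n nn.
rewrite invf_plt ?posrE//; apply: lt_le_trans (truncnS_gt _) _.
by rewrite ler_nat ltnS.
Qed.

(** A Cauchy filter has a large ball of radius [1 / (n + 1)] for every [n]; the centres form a
    Cauchy sequence, and the filter converges to its limit. *)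
Lemma banach_of_seq (R : realType) (V : lmodType R[i]) (N : normOn V) :
  (forall u, cauchy_seq N u -> exists l, converges N u l) -> banach N.
Proof.
move=> cN; rewrite /banach /= => F FF cF.
have gt0 n : 0 < (n.+1%:R^-1 : R) by rewrite invr_gt0.
have /choice[x xP] : forall n : nat, exists x : normed N,
    F [set y | N (x - y) < n.+1%:R^-1].
  move=> n; have en : 0 < (n.+1%:R^-1 : R)%:C by rewrite ltcR.
  have [x Fx] := (cauchyP F).1 cF _ en; exists x; apply: filterS Fx => y.
  by rewrite -ball_normE /= normedE ltcR.
have [l xl] : exists l, converges N x l.
  apply: cN => e e0; have e2 : 0 < e / 2 by rewrite divr_gt0.
  have [n0 Hn] := invS_lt e2; exists n0 => m n nm nn.
  have [y [ym yn]] := filter_ex (filterI (xP m) (xP n)).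
  apply: (le_lt_trans (norm_dist_trans N y (x m) (x n))); rewrite [ltRHS]splitr ltrD//.
  - exact: lt_trans ym (Hn _ nm).
  - by rewrite norm_distC; exact: lt_trans yn (Hn _ nn).
apply/cvg_ex; exists l; apply/cvgrPdist_lt => e e0.
have eE : e = (complex.Re e)%:C by rewrite RRe_real// gtr0_real.
have re0 : 0 < complex.Re e by rewrite -ltcR -eE.
have e2 : 0 < complex.Re e / 2 by rewrite divr_gt0.
have [n0 Hn0] := invS_lt e2; have [n1 Hn1] := xl _ e2.
pose n := maxn n0 n1.
apply: filterS (xP n) => y /= xy; rewrite normedE eE ltcR.
apply: (le_lt_trans (norm_dist_trans N (x n) l y)); rewrite [ltRHS]splitr ltrD//.
- by rewrite norm_distC; apply: Hn1; rewrite leq_maxr.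
- by apply: lt_trans xy _; apply: Hn0; rewrite leq_maxl.
Qed.

Lemma subvect_val_linear (R : realType) (V : lmodType R[i]) (P : submodClosed V) :
  linear (val : subvect P -> V).
Proof. by move=> a x y; rewrite linearP. Qed.

Section PsdForm.
Context (R : realType) (V : lmodType R[i]) (h : hermForm V).
Hypothesis h_ge0 : forall x, 0 <= h x x.
Local Notation nrm := (hnorm h).

Lemma psd_sqr x : (nrm x ^+ 2)%:C = h x x.
Proof.
have := h_ge0 x; rewrite /hnorm lecE => /andP[/eqP im0 re0].
by rewrite sqr_sqrtr//; case: (h x x) im0 => a b /= ->.
Qed.

Lemma psd_cauchy_schwarz x y : modulus (h x y) <= nrm x * nrm y.
Proof.
rewrite -(@ler_pXn2r _ 2) ?nnegrE ?modulus_ge0 ?mulr_ge0 ?hnorm_ge0// exprMn.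
set X := nrm x ^+ 2; set Y := nrm y ^+ 2; set T := _ ^+ 2.
have T0 : 0 <= T by exact: sqr_ge0.
have X0 : 0 <= X by exact: sqr_ge0.
have Y0 : 0 <= Y by exact: sqr_ge0.
have TE : T%:C = h x y * h y x.
  by rewrite /T realcX modulusE normCK -form_herm.
have XE : X%:C = h x x by exact: psd_sqr.
have YE : Y%:C = h y y by exact: psd_sqr.
clearbody T X Y.
(* Nonnegativity of the form at [x - s h(y, x) y]. When [Y] is nonzero, [s = Y^-1] is the usual
   choice; when [Y = 0], which a semidefinite form allows for nonzero [y], a large [s] forces
   [T = 0]. *)
have key (s : R) : 0 <= X - 2 * s * T + s ^+ 2 * T * Y.
  rewrite -lecR; have := h_ge0 (x - (s%:C * h y x) *: y).
  suff -> : h (x - (s%:C * h y x) *: y) (x - (s%:C * h y x) *: y) =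
    (X - 2 * s * T + s ^+ 2 * T * Y)%:C by [].
  rewrite !formE rmorphM /= -(form_herm h y x) [(s%:C)^*]conjc_real.
  rewrite -XE -YE !realcD realcN !realcM TE.
  rewrite (_ : 2%:C = 2); last by rewrite rmorph_nat.
  by ring.
have [Y1|Y1] := eqVneq Y 0.
  rewrite Y1 mulr0; have := key ((X + 1) / (2 * T)).
  have [->//|T1] := eqVneq T 0.
  rewrite Y1 mulr0 addr0 (_ : 2 * _ * T = X + 1); last by field.
  lra.
have := key Y^-1; rewrite (_ : _ + _ = X - T / Y); last by field.
by rewrite subr_ge0 ler_pdivrMr// lt_neqAle eq_sym Y1.
Qed.

Lemma psd_normD x y : nrm (x + y) <= nrm x + nrm y.
Proof.
rewrite -(@ler_pXn2r _ 2) ?nnegrE ?addr_ge0 ?hnorm_ge0//.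
have sqrE z : nrm z ^+ 2 = complex.Re (h z z) by rewrite -psd_sqr.
have := le_trans (Re_le_modulus _) (psd_cauchy_schwarz x y).
rewrite sqrrD !sqrE !formE (form_herm h x y).
by case: (h x y) (h x x) (h y y) => a b [c d] [c' d'] /=; lra.
Qed.

Lemma psd_normZ a x : nrm (a *: x) = modulus a * nrm x.
Proof.
apply/eqP; rewrite -(@eqrXn2 _ 2) ?mulr_ge0 ?modulus_ge0 ?hnorm_ge0//; apply/eqP.
apply: complexI; rewrite psd_sqr exprMn realcM psd_sqr !formE.
by rewrite realcX modulusE normCK; ring.
Qed.

Lemma psd_norm0 : nrm 0 = 0.
Proof. by rewrite -(scale0r 0) psd_normZ modulus0 mul0r. Qed.

Definition psd_cauchy (u : nat -> V) : Prop := forall e, 0 < e ->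
  exists n0, forall m n, (n0 <= m)%N -> (n0 <= n)%N -> nrm (u m - u n) < e.

Lemma psd_cauchy_bounded u : psd_cauchy u -> exists M, forall n, nrm (u n) <= M.
Proof.
move=> /(_ 1 ltr01)[n0 H].
have fin k : exists M, forall n, (n <= k)%N -> nrm (u n) <= M.
  elim: k => [|k [M HM]]; first by exists (nrm (u 0%N)) => n; rewrite leqn0 => /eqP ->.
  exists (Num.max M (nrm (u k.+1))) => n; rewrite leq_eqVlt ltnS => /orP[/eqP ->|/HM nM].
    by rewrite le_max lexx orbT.
  by rewrite le_max nM.
have [M HM] := fin n0; exists (M + 1) => n.
have [nn|/ltnW nn] := leqP n n0; first by apply: le_trans (HM n nn) _; rewrite lerDl.
have := H _ _ nn (leqnn n0) => {}H.
have := psd_normD (u n - u n0) (u n0); rewrite subrK => /le_trans; apply.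
by rewrite addrC; apply: lerD; [exact: HM|exact: ltW].
Qed.

Lemma form_cauchy u w : psd_cauchy u -> psd_cauchy w ->
  exists l, tends (fun n => h (u n) (w n)) l.
Proof.
move=> cu cw; have [M uM] := psd_cauchy_bounded cu; have [K wK] := psd_cauchy_bounded cw.
have M0 : 0 <= M by exact: le_trans (hnorm_ge0 _ _) (uM 0%N).
have K0 : 0 <= K by exact: le_trans (hnorm_ge0 _ _) (wK 0%N).
apply: complex_cauchy_tends => e e0.
have D0 : 0 < M + K + 1 by rewrite ltr_wpDl// addr_ge0.
have eD : 0 < e / (M + K + 1) by rewrite divr_gt0.
have [n1 H1] := cu _ eD; have [n2 H2] := cw _ eD.
exists (maxn n1 n2) => m n; rewrite !geq_max => /andP[m1 m2] /andP[k1 k2].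
have -> : h (u m) (w m) - h (u n) (w n) = h (u m - u n) (w m) + h (u n) (w m - w n).
  by rewrite !formE; ring.
apply: le_lt_trans (modulusD _ _) _.
have h1 := psd_cauchy_schwarz (u m - u n) (w m).
have h2 := psd_cauchy_schwarz (u n) (w m - w n).
have h3 : nrm (u m - u n) * nrm (w m) <= e / (M + K + 1) * K.
  by rewrite ler_pM ?hnorm_ge0// ltW// H1.
have h4 : nrm (u n) * nrm (w m - w n) <= M * (e / (M + K + 1)).
  by rewrite ler_pM ?hnorm_ge0// ltW// H2.
have eE : e / (M + K + 1) * (M + K + 1) = e by rewrite divfK// gt_eqF.
move: (e / _) eD {H1 H2} h3 h4 eE => d d0 h3 h4 eE.
by move: d0 (le_trans h1 h3) (le_trans h2 h4); lra.
Qed.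

Lemma psd_cauchy_cst v : psd_cauchy (fun=> v).
Proof. by move=> e e0; exists 0%N => m n _ _; rewrite subrr psd_norm0. Qed.

Lemma psd_cauchyZD (a : R[i]) u w : psd_cauchy u -> psd_cauchy w ->
  psd_cauchy (fun n => a *: u n + w n).
Proof.
move=> cu cw e e0; have D0 : 0 < modulus a + 1 by rewrite ltr_wpDl// modulus_ge0.
have e1 : 0 < e / 2 / (modulus a + 1) by rewrite !divr_gt0.
have e2 : 0 < e / 2 by rewrite divr_gt0.
have [n1 H1] := cu _ e1; have [n2 H2] := cw _ e2.
exists (maxn n1 n2) => m n; rewrite !geq_max => /andP[m1 m2] /andP[k1 k2].
rewrite opprD addrACA -scalerBr; apply: le_lt_trans (psd_normD _ _) _.
rewrite psd_normZ [ltRHS]splitr; apply: ler_ltD; last exact: H2.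
apply: (@le_trans _ _ ((modulus a + 1) * nrm (u m - u n))).
  by rewrite ler_wpM2r ?hnorm_ge0// lerDl.
by rewrite mulrC -ler_pdivlMr//; apply/ltW/H1.
Qed.

(** Cauchy sequences whose difference tends to 0 define the same functional, so neither null vectors
    nor null sequences have to be divided out. *)
Definition completion_pred : {pred (V -> R[i])} := fun f =>
  `[< exists2 u, psd_cauchy u & forall v, tends (fun n => h v (u n)) (f v) >].

Lemma completion_submod : submod_closed completion_pred.
Proof.
split.
  apply/asboolP; exists (fun=> 0); first exact: psd_cauchy_cst.
  by move=> v; rewrite Defs.form0r; exact: tends_cst.
move=> a f g /asboolP[u cu uf] /asboolP[w cw wg]; apply/asboolP.
exists (fun n => a *: u n + w n); first exact: psd_cauchyZD.
move=> v; have -> : (fun n => h v (a *: u n + w n)) = (fun n => a * h v (u n) + h v (w n)).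
  by apply/funext => n; rewrite form_linear.
exact: tendsD (tendsZ _ (uf v)) (wg v).
Qed.

HB.instance Definition _ :=
  GRing.isSubmodClosed.Build R[i] (V -> R[i]) completion_pred completion_submod.

(* The Hilbert space completion of V, realized by the functionals [v |-> <v, x>]
   that its elements x define on V. *)
Definition completion : Type := subvect completion_pred.
HB.instance Definition _ := GRing.Lmodule.on completion.

Definition represents (u : nat -> V) (f : completion) : Prop :=
  psd_cauchy u /\ forall v, tends (fun n => h v (u n)) (val f v).

Lemma represents_ex f : exists u, represents u f.
Proof. by have /asboolP[u cu uf] := valP f; exists u. Qed.

Lemma represents_unique u f g : represents u f -> represents u g -> f = g.
Proof.
move=> [_ uf] [_ ug]; apply/val_inj/funext => v; exact: tends_unique (uf v) (ug v).
Qed.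

Lemma representsZD a u w f g : represents u f -> represents w g ->
  represents (fun n => a *: u n + w n) (a *: f + g).
Proof.
move=> [cu uf] [cw wg]; split; first exact: psd_cauchyZD.
move=> v; have -> : (fun n => h v (a *: u n + w n)) = (fun n => a * h v (u n) + h v (w n)).
  by apply/funext => n; rewrite form_linear.
have -> : val (a *: f + g) v = a * val f v + val g v.
  exact: (congr1 (fun F => F v) (subvect_val_linear a f g)).
exact: tendsD (tendsZ _ (uf v)) (wg v).
Qed.

End PsdForm.

Section CompletionForm.
Context (R : realType) (V : lmodType R[i]) (h : hermForm V).
Hypothesis h_ge0 : forall x, 0 <= h x x.
Local Notation nrm := (hnorm h).
Local Notation H := (completion h_ge0).
Implicit Types (f g : H) (u w : nat -> V).

(** The difference between [h (u n) (w n)] and the limit of [h (u n) (w m)] over [m] is controlled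
    by a bound for [u] and the Cauchy property of [w]. The diagonal limit thus depends on [w] only
    through [g]. *)
Lemma form_represents u w g l : psd_cauchy h u -> represents w g ->
  tends (fun n => h (u n) (w n)) l -> tends (fun n => val g (u n)) l.
Proof.
move=> cu [cw wg]; apply: tends_near.
have [M uM] := psd_cauchy_bounded h_ge0 cu.
have M0 : 0 <= M by exact: le_trans (hnorm_ge0 _ _) (uM 0%N).
apply/cvg0P => [n|e e0]; first exact: modulus_ge0.
have eM : 0 < e / (M + 1) / 2 by rewrite !divr_gt0// ltr_wpDl.
have [n0 H0] := cw _ eM; exists n0 => n nn.
apply: (@le_lt_trans _ _ (M * (e / (M + 1) / 2))); last first.
  rewrite -[ltRHS](@divfK _ (M + 1)) ?gt_eqF ?ltr_wpDl//.
  have d0 : 0 < e / (M + 1) by rewrite divr_gt0// ltr_wpDl.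
  by move: (e / _) d0 => d d0; nra.
rewrite modulus_subC.
have t : tends (fun m => h (u n) (w n) - h (u n) (w m)) (h (u n) (w n) - val g (u n)).
  have := tendsD (tends_cst (h (u n) (w n))) (tendsZ (-1) (wg (u n))).
  by rewrite mulN1r; congr (tends _ _); apply/funext => m; rewrite mulN1r.
rewrite leNgt; apply/negP => lt.
have d0 : 0 < modulus (h (u n) (w n) - val g (u n)) - M * (e / (M + 1) / 2).
  by rewrite subr_gt0.
have [n1 H1] := (cvg0P (fun n => modulus_ge0 _)).1 t _ d0.
pose m := maxn n0 n1.
have {}H1 := H1 m (leq_maxr _ _).
have := modulus_dist_trans (h (u n) (w n) - h (u n) (w m)) (h (u n) (w n) - val g (u n)) 0.
rewrite !subr0 (modulus_subC (_ - val g _)).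
have : modulus (h (u n) (w n) - h (u n) (w m)) <= M * (e / (M + 1) / 2).
  rewrite -Defs.formNr -Defs.formDr; apply: le_trans (psd_cauchy_schwarz h_ge0 _ _) _.
  by rewrite ler_pM ?hnorm_ge0//; apply/ltW/H0 => //; rewrite leq_maxl.
move: H1; set a := modulus _; set b := modulus _; set c := modulus _; lra.
Qed.

Let rep f : nat -> V := sval (cid (represents_ex f)).
Let repP f : represents (rep f) f. Proof. exact: svalP (cid (represents_ex f)). Qed.
Let cform f g : R[i] := sval (cid (form_cauchy h_ge0 (repP f).1 (repP g).1)).
Let cformP' f g : tends (fun n => h (rep f n) (rep g n)) (cform f g).
Proof. exact: svalP (cid (form_cauchy h_ge0 (repP f).1 (repP g).1)). Qed.

Let cform_indep u w u' w' f g l l' : represents u f -> represents w g ->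
  represents u' f -> represents w' g ->
  tends (fun n => h (u n) (w n)) l -> tends (fun n => h (u' n) (w' n)) l' -> l = l'.
Proof.
move=> uf wg u'f w'g uw u'w'.
(* The mixed pair [u], [w'] lets one argument change at a time; conjugation exchanges their
   roles. *)
have [k uw'] := form_cauchy h_ge0 uf.1 w'g.1.
transitivity k.
  exact: tends_unique (form_represents uf.1 wg uw) (form_represents uf.1 w'g uw').
apply: (can_inj conjCK).
have flip (x y : nat -> V) (c : R[i]) : tends (fun n => h (x n) (y n)) c ->
    tends (fun n => h (y n) (x n)) c^*.
  move=> /tends_conj; congr (tends _ _); apply/funext => n; exact/esym/form_herm.
exact: tends_unique (form_represents w'g.1 uf (flip _ _ _ uw'))
  (form_represents w'g.1 u'f (flip _ _ _ u'w')).
Qed.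

Let cformP u w f g : represents u f -> represents w g ->
  tends (fun n => h (u n) (w n)) (cform f g).
Proof.
move=> uf wg; have [l ul] := form_cauchy h_ge0 uf.1 wg.1.
by rewrite -(cform_indep uf wg (repP f) (repP g) ul (cformP' f g)).
Qed.

Let cform_linear f a g k : cform f (a *: g + k) = a * cform f g + cform f k.
Proof.
have t1 := cformP (repP f) (representsZD a (repP g) (repP k)).
have t2 := tendsD (tendsZ a (cformP' f g)) (cformP' f k).
apply: tends_unique t1 _; move: t2; congr (tends _ _).
by apply/funext => n; rewrite form_linear.
Qed.

Let cform_herm f g : cform g f = (cform f g)^*.
Proof.
have := tends_conj (cformP' f g); apply: tends_unique.
by have := cformP' g f; congr (tends _ _); apply/funext => n; exact: form_herm.
Qed.

Definition completion_form : hermForm H := HermForm cform_linear cform_herm.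

Lemma completion_formP u w f g : represents u f -> represents w g ->
  tends (fun n => h (u n) (w n)) (completion_form f g).
Proof. exact: cformP. Qed.

Local Notation cnrm := (hnorm completion_form).

Lemma completion_form_sqr u f : represents u f ->
  (fun n => nrm (u n) ^+ 2) @ \oo --> complex.Re (completion_form f f).
Proof.
move=> uf; have := tends_Re (completion_formP uf uf).
by under eq_fun do rewrite -(psd_sqr h_ge0).
Qed.

Lemma completion_form_ge0 f : 0 <= completion_form f f.
Proof.
have [u uf] := represents_ex f.
have := completion_form_sqr uf => ul.
have r0 : 0 <= complex.Re (completion_form f f).
  by apply: (cvgr_to_ge ul); apply: nearW => n; exact: sqr_ge0.
have := form_herm completion_form f f.
move: r0; case: (completion_form f f) => a b /= a0 [] b0.
by rewrite lecE /= a0 andbT; apply/eqP; move: b0; lra.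
Qed.

Let embed_subproof (v : V) : h^~ v \in completion_pred h.
Proof.
by apply/asboolP; exists (fun=> v); [exact: psd_cauchy_cst|move=> x; exact: tends_cst].
Qed.
Definition embed (v : V) : H :=
  exist (fun f : V -> R[i] => f \in completion_pred h) (h^~ v) (embed_subproof v).

Lemma represents_embed v : represents (fun=> v) (embed v).
Proof. by split; [exact: psd_cauchy_cst|move=> x; exact: tends_cst]. Qed.

Lemma completion_form_embed v x : completion_form (embed v) (embed x) = h v x.
Proof.
apply: tends_unique (completion_formP (represents_embed v) (represents_embed x)) _.
exact: tends_cst.
Qed.

Lemma completion_form_embedl v f : completion_form (embed v) f = val f v.
Proof.
have [u uf] := represents_ex f.
exact: tends_unique (completion_formP (represents_embed v) uf) (uf.2 v).
Qed.

Lemma completion_cauchy_schwarz v f : modulus (val f v) <= nrm v * cnrm f.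
Proof.
rewrite -completion_form_embedl; apply: le_trans (psd_cauchy_schwarz completion_form_ge0 _ _) _.
by rewrite {1}/hnorm completion_form_embed.
Qed.

(** The value of [f] at [v] is its product with [embed v], so by Cauchy-Schwarz an element of norm 0
    is the zero functional. *)
Lemma completion_posdef : posdef completion_form.
Proof.
move=> f f0; rewrite lt_neqAle completion_form_ge0 andbT eq_sym.
apply: contra_neq f0 => ff0.
apply/val_inj/funext => v; apply/modulus_le0.
apply: le_trans (completion_cauchy_schwarz v f) _.
by rewrite [cnrm f](_ : _ = 0) ?mulr0// /hnorm ff0 sqrtr0.
Qed.

Lemma embedB v x : embed (v - x) = embed v - embed x.
Proof. by apply/val_inj/funext => y /=; rewrite Defs.formDr Defs.formNr. Qed.

Lemma cnrm_embed v : cnrm (embed v) = nrm v.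
Proof. by rewrite /hnorm completion_form_embed. Qed.

Lemma cnrm_le u f M : represents u f -> (forall n, nrm (u n) <= M) -> cnrm f <= M.
Proof.
move=> uf uM; have M0 : 0 <= M by exact: le_trans (hnorm_ge0 _ _) (uM 0%N).
rewrite -(@ler_pXn2r _ 2) ?nnegrE ?hnorm_ge0//.
have -> : cnrm f ^+ 2 = complex.Re (completion_form f f).
  by rewrite -(psd_sqr completion_form_ge0).
apply: (cvgr_to_le (completion_form_sqr uf)); apply: nearW => n.
by rewrite ler_pXn2r ?nnegrE ?hnorm_ge0.
Qed.

Lemma represents_shift u f n0 : represents u f -> represents (fun n => u (n0 + n)%N) f.
Proof.
move=> uf; split.
  move=> d /uf.1[k Hk]; exists k => m n km kn; apply: Hk.
  - by rewrite (leq_trans km)// leq_addl.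
  - by rewrite (leq_trans kn)// leq_addl.
move=> v; have := uf.2 v => /(cvg0P (fun n => modulus_ge0 _)) t.
apply/(cvg0P (fun n => modulus_ge0 _)) => d /t[k Hk]; exists k => n kn.
by apply: Hk; rewrite (leq_trans kn)// leq_addl.
Qed.

Lemma embed_dense f e : 0 < e -> exists v, cnrm (embed v - f) <= e.
Proof.
move=> e0; have [u uf] := represents_ex f; have [n0 H0] := uf.1 _ e0.
exists (u n0).
have uf' := represents_shift n0 uf.
have := representsZD (-1) uf' (represents_embed (u n0)).
rewrite scaleN1r addrC => /cnrm_le; apply => n.
by rewrite scaleN1r addrC; apply/ltW/H0; rewrite ?leq_addr.
Qed.

(** Choosing [v k] in V with [embed (v k)] within [1 / (k + 1)] of [F k] yields a Cauchy sequence in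
    V; the element that it represents is the limit. *)
Lemma completion_complete (F : nat -> H) : cauchy_seq (form_norm completion_posdef) F ->
  exists l, converges (form_norm completion_posdef) F l.
Proof.
move=> cF; pose N := form_norm completion_posdef.
have /choice[v vP] : forall k : nat, exists v, N (embed v - F k) <= k.+1%:R^-1.
  by move=> k; apply: embed_dense; rewrite invr_gt0.
have cv : psd_cauchy h v.
  move=> e e0; have e3 : 0 < e / 3 by rewrite divr_gt0.
  have [n0 H0] := cF _ e3; have [n1 H1] := invS_lt e3.
  exists (maxn n0 n1) => m n; rewrite !geq_max => /andP[m0 m1] /andP[k0 k1].
  rewrite -cnrm_embed embedB.
  apply: (@le_lt_trans _ _ (N (embed (v m) - F m) + (N (F m - F n) + N (embed (v n) - F n)))).
    rewrite (norm_distC N (embed (v n))).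
    apply: le_trans (norm_dist_trans N (F m) _ _) _.
    by rewrite lerD2l norm_dist_trans.
  have {}H1m := le_lt_trans (vP m) (H1 _ m1); have {}H1n := le_lt_trans (vP n) (H1 _ k1).
  have := ltrD H1m (ltrD (H0 _ _ m0 k0) H1n).
  by rewrite (_ : e / 3 + (e / 3 + e / 3) = e)//; field.
have /choice[phi phiP] : forall x, exists l, tends (fun n => h x (v n)) l.
  by move=> x; apply: (form_cauchy h_ge0) => //; exact: psd_cauchy_cst.
have phic : phi \in completion_pred h by apply/asboolP; exists v.
pose l : H := exist (fun F : V -> R[i] => F \in completion_pred h) phi phic.
have vl : represents v l by [].
exists l => e e0; have e3 : 0 < e / 3 by rewrite divr_gt0.
have [n0 H0] := cv _ e3; have [n1 H1] := invS_lt e3.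
exists (maxn n0 n1) => n; rewrite geq_max => /andP[m0 m1].
have vn : N (embed (v n) - l) <= e / 3.
  have vl' := represents_shift n0 vl.
  have := representsZD (-1) vl' (represents_embed (v n)).
  rewrite scaleN1r addrC => /cnrm_le; apply => k.
  by rewrite scaleN1r addrC; apply/ltW/H0; rewrite ?leq_addr.
apply: (@le_lt_trans _ _ (N (embed (v n) - F n) + N (embed (v n) - l))).
  by rewrite (norm_distC N (embed (v n)) (F n)); exact: norm_dist_trans.
apply: (@lt_trans _ _ (e / 3 + e / 3)).
  by apply: ltr_leD => //; exact: le_lt_trans (vP n) (H1 _ m1).
by rewrite -[ltRHS](_ : e / 3 + e / 3 + e / 3 = e) ?ltrDl//; field.
Qed.

End CompletionForm.

(** The adjoint is part of the data because elements of the completion are functionals: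
    [<w, T f> = <T' w, f>] says that [T] extends by precomposition with its adjoint [T']. *)
Record adjointable (R : realType) (V W : lmodType R[i]) (h : hermForm V) (k : hermForm W) :=
  Adjointable {
  adj_fun :> V -> W;
  adj_star : W -> V;
  adj_linear : linear adj_fun;
  adj_starP : forall w v, k w (adj_fun v) = h (adj_star w) v;
  adj_bounded : exists M, forall v, hnorm k (adj_fun v) <= M * hnorm h v
}.

Section Extend.
Context (R : realType) (V W : lmodType R[i]) (h : hermForm V) (k : hermForm W).
Hypotheses (h_ge0 : forall x, 0 <= h x x) (k_ge0 : forall x, 0 <= k x x).
Variable T : adjointable h k.
Implicit Types (f : completion h_ge0) (u : nat -> V).

Lemma adjointable_cauchy u : psd_cauchy h u -> psd_cauchy k (T \o u).
Proof.
move=> cu e e0; have [M TM] := adj_bounded T.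
have D0 : 0 < `|M| + 1 by rewrite ltr_wpDl.
have [n0 H0] := cu _ (divr_gt0 e0 D0); exists n0 => m n nm nn.
have -> : (T \o u) m - (T \o u) n = T (u m - u n).
  by rewrite /= -scaleN1r addrC -(adj_linear T) scaleN1r addrC.
apply: le_lt_trans (TM _) _; have := H0 _ _ nm nn; rewrite ltr_pdivlMr// mulrC.
apply: le_lt_trans; rewrite ler_wpM2r ?hnorm_ge0//.
by apply: le_trans (ler_norm _) _; rewrite lerDl.
Qed.

Let extend_subproof f : val f \o adj_star T \in completion_pred k.
Proof.
have [u [cu uf]] := represents_ex f.
apply/asboolP; exists (T \o u); first exact: adjointable_cauchy.
by move=> w /=; under eq_fun do rewrite adj_starP; exact: uf.
Qed.

Definition extend f : completion k_ge0 :=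
  exist (fun F : W -> R[i] => F \in completion_pred k) _ (extend_subproof f).

Lemma extendE f : val (extend f) = val f \o adj_star T.
Proof. by []. Qed.

Lemma extend_linear : linear extend.
Proof.
by move=> a f g; apply: val_inj; rewrite linearP !extendE linearP.
Qed.

Lemma represents_extend u f : represents u f -> represents (T \o u) (extend f).
Proof.
move=> [cu uf]; split; first exact: adjointable_cauchy.
by move=> w /=; under eq_fun do rewrite adj_starP; exact: uf.
Qed.

Lemma extend_bound M f : 0 <= M -> (forall v, hnorm k (T v) <= M * hnorm h v) ->
  hnorm (completion_form k_ge0) (extend f) <= M * hnorm (completion_form h_ge0) f.
Proof.
move=> M0 TM; have [u uf] := represents_ex f.
rewrite -(@ler_pXn2r _ 2) ?nnegrE ?mulr_ge0 ?hnorm_ge0// exprMn.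
have sq (U : lmodType R[i]) (l : hermForm U) (l0 : forall x, 0 <= l x x) x :
  hnorm l x ^+ 2 = complex.Re (l x x) by rewrite -(psd_sqr l0).
rewrite !sq; try exact: completion_form_ge0.
have := completion_form_sqr (represents_extend uf) => t1.
have t2 : (fun n => M ^+ 2 * hnorm h (u n) ^+ 2) @ \oo -->
    M ^+ 2 * complex.Re (completion_form h_ge0 f f).
  by apply: cvgM; [exact: cvg_cst|exact: completion_form_sqr].
apply: ler_cvg_to t1 t2 _; apply: nearW => n /=.
by rewrite -exprMn ler_pXn2r ?nnegrE ?mulr_ge0 ?hnorm_ge0.
Qed.

Lemma extend_embed v : extend (embed h_ge0 v) = embed k_ge0 (T v).
Proof. by apply/val_inj/funext => w /=; rewrite adj_starP. Qed.

End Extend.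

Lemma extend_adjoint (R : realType) (V W : lmodType R[i]) (h : hermForm V) (k : hermForm W)
    (h_ge0 : forall x, 0 <= h x x) (k_ge0 : forall x, 0 <= k x x)
    (T : adjointable h k) (S : adjointable k h) f g :
  (forall w, adj_star T w = S w) ->
  completion_form k_ge0 (extend k_ge0 T f) g =
  completion_form h_ge0 f (extend h_ge0 S g).
Proof.
move=> TS; have [u uf] := represents_ex f; have [w wg] := represents_ex g.
have t1 := completion_formP (represents_extend k_ge0 T uf) wg.
have t2 := completion_formP uf (represents_extend h_ge0 S wg).
apply: tends_unique t1 _; move: t2; congr (tends _ _); apply/funext => n /=.
by rewrite -TS form_herm -adj_starP -form_herm.
Qed.

(** * The Krein space of a symmetric involution of a Hilbert space *)

Section InvolutionSpace.
Context (R : realType) (H : lmodType R[i]) (h : hermForm H) (pd : posdef h).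
Hypothesis h_complete : forall u, cauchy_seq (form_norm pd) u ->
  exists l, converges (form_norm pd) u l.
Variable J : H -> H.
Hypotheses (J_linear : linear J) (JK : involutive J).
Hypothesis J_sym : forall x y, h (J x) y = h x (J y).

Let JD x y : J (x + y) = J x + J y.
Proof. by have := J_linear 1 x y; rewrite !scale1r. Qed.
Let J0 : J 0 = 0. Proof. by apply: (addrI (J 0)); rewrite -JD !addr0. Qed.
Let JZ a x : J (a *: x) = a *: J x.
Proof. by have := J_linear a x 0; rewrite J0 !addr0. Qed.
Let JB x y : J (x - y) = J x - J y.
Proof. by rewrite JD -[- y]scaleN1r JZ scaleN1r. Qed.

Let kform_linear x a y z : h x (J (a *: y + z)) = a * h x (J y) + h x (J z).
Proof. by rewrite J_linear form_linear. Qed.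
Let kform_herm x y : h y (J x) = (h x (J y))^*.
Proof. by rewrite -J_sym form_herm. Qed.
Definition involution_form : hermForm H := HermForm kform_linear kform_herm.

Definition eigen_pred (c : R[i]) : {pred H} := fun x => `[< J x = c *: x >].

Lemma eigen_submod c : submod_closed (eigen_pred c).
Proof.
split; first by apply/asboolP; rewrite J0 scaler0.
move=> a x y /asboolP xc /asboolP yc; apply/asboolP.
by rewrite J_linear xc yc scalerDr !scalerA mulrC.
Qed.
HB.instance Definition _ c :=
  GRing.isSubmodClosed.Build R[i] H (eigen_pred c) (eigen_submod c).

Let J_iso x : hnorm h (J x) = hnorm h x.
Proof. by rewrite /hnorm J_sym JK. Qed.

(** An eigenspace is closed in a complete space. The form [k] is left abstract to cover the
    restricted form for the eigenvalue 1 and its opposite for -1. *)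
Lemma eigen_hilbert (c : R[i]) (k : hermForm (subvect (eigen_pred c))) :
  (forall x, k x x = h (val x) (val x)) -> hilbert k.
Proof.
move=> kh.
have kpd : posdef k.
  by move=> x x0; rewrite kh; apply: pd; apply: contra_neq x0 => x0; apply: val_inj.
exists kpd; apply: banach_of_seq => u cu.
have NE x : form_norm kpd x = form_norm pd (val x) by rewrite /= /hnorm kh.
have [|l ul] := h_complete (u := fun n => val (u n)).
  by move=> e /cu[n0 Hn]; exists n0 => m n nm nn; rewrite -linearB -NE Hn.
have lc : l \in eigen_pred c.
  apply/asboolP/eqP; rewrite -subr_eq0; apply/eqP.
  apply: (@norm_eq0 _ _ (form_norm pd)); apply/le_anti; rewrite norm_ge0 andbT.
  apply/ler_addgt0Pl => e e0; rewrite addr0.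
  have D0 : 0 < 1 + modulus c by rewrite ltr_pwDl// modulus_ge0.
  have [n0 Hn] := ul _ (divr_gt0 e0 D0).
  have := Hn n0 (leqnn _); set x := val (u n0).
  have xc : J x = c *: x by apply/asboolP; exact: (valP (u n0)).
  have -> : J l - c *: l = c *: (x - l) - J (x - l).
    by rewrite JB xc scalerBr; abel.
  rewrite ltr_pdivlMr// => /ltW; apply: le_trans.
  apply: le_trans (norm_triangle _ _ _) _; rewrite normN norm_homog.
  by rewrite [form_norm _ (J _)]J_iso mulrDr mulr1 addrC mulrC.
exists (exist (fun x => x \in eigen_pred c) l lc) => e /ul[n0 Hn].
by exists n0 => n /Hn; rewrite NE linearB.
Qed.

Let half (x : H) : x = (2^-1 : R)%:C *: (x + J x) + (2^-1 : R)%:C *: (x - J x).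
Proof.
have -> : (2^-1 : R)%:C *: (x + J x) + (2^-1 : R)%:C *: (x - J x) =
    ((2^-1 : R)%:C + (2^-1 : R)%:C) *: x.
  by rewrite !scalerDr scalerDl scalerN; abel.
by rewrite -realcD (_ : _ + _ = 1) ?scale1r//; field.
Qed.

Lemma involution_decomposition :
  krein_decomposition involution_form (eigen_pred 1) (eigen_pred (-1)).
Proof.
split.
- move=> x y /asboolP; rewrite scale1r => xp /asboolP; rewrite scaleN1r => ym.
  have : h x (J y) = - h x (J y) by rewrite {2}ym Defs.formNr opprK -J_sym xp.
  move/eqP; rewrite -subr_eq0 opprK -mulr2n mulrn_eq0 => /eqP /=.
  by [].
- move=> x; exists ((2^-1 : R)%:C *: (x + J x)), ((2^-1 : R)%:C *: (x - J x)).
  split; last exact: half.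
  + by apply/asboolP; rewrite JZ JD JK scale1r [J x + x]addrC.
  + by apply/asboolP; rewrite JZ JB JK scaleN1r -scalerN opprB.
- move=> x /asboolP; rewrite scale1r => xp /asboolP; rewrite xp scaleN1r => /eqP.
  rewrite -subr_eq0 opprK -mulr2n -scaler_nat scaler_eq0 pnatr_eq0 /=.
  by move/eqP.
- apply: eigen_hilbert => -[x xp] /=.
  by move: xp => /asboolP; rewrite scale1r => ->.
- apply: eigen_hilbert => -[x xp] /=.
  by move: xp => /asboolP; rewrite scaleN1r => ->; rewrite Defs.formNr opprK.
Qed.

Definition involution_space : kreinSpace R :=
  KreinSpace (ex_intro _ _ (ex_intro _ _ involution_decomposition)).

Let involution_symP : exists Kp Km : submodClosed H,
  krein_decomposition involution_form Kp Km /\ forall x y, x \in Kp -> y \in Km -> J (x + y) = x - y.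
Proof.
apply: (ex_intro _ _ (ex_intro _ _ (conj involution_decomposition _))).
by move=> x y /asboolP xp /asboolP ym; rewrite JD xp ym scale1r scaleN1r.
Qed.
Definition involution_sym : fundSym involution_space :=
  @FundSym R involution_space J involution_symP.

Lemma involution_norm (x : involution_space) : fundsym_norm involution_sym x = hnorm h x.
Proof. by rewrite /= /hnorm /= JK. Qed.

End InvolutionSpace.

(** * Invariant states *)

Section Composition.
Context (R : realType) (C : starCat R).
Implicit Types A B D E : C.

Lemma mcompDl A B D (g g' : mor B D) (f : mor A B) :
  mcomp (g + g') f = mcomp g f + mcomp g' f.
Proof. by have := mcomp_linearl f 1 g g'; rewrite !scale1r. Qed.
Lemma mcompDr A B D (g : mor B D) (f f' : mor A B) :
  mcomp g (f + f') = mcomp g f + mcomp g f'.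
Proof. by have := mcomp_linearr g 1 f f'; rewrite !scale1r. Qed.
Lemma mcomp0l A B D (f : mor A B) : mcomp (0 : mor B D) f = 0.
Proof. by apply: (addrI (mcomp 0 f)); rewrite -mcompDl !addr0. Qed.
Lemma mcomp0r A B D (g : mor B D) : mcomp g (0 : mor A B) = 0.
Proof. by apply: (addrI (mcomp g 0)); rewrite -mcompDr !addr0. Qed.
Lemma mcompZl A B D a (g : mor B D) (f : mor A B) : mcomp (a *: g) f = a *: mcomp g f.
Proof. by have := mcomp_linearl f a g 0; rewrite mcomp0l !addr0. Qed.
Lemma mcompZr A B D a (g : mor B D) (f : mor A B) : mcomp g (a *: f) = a *: mcomp g f.
Proof. by have := mcomp_linearr g a f 0; rewrite mcomp0r !addr0. Qed.
Lemma mcompBl A B D (g g' : mor B D) (f : mor A B) :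
  mcomp (g - g') f = mcomp g f - mcomp g' f.
Proof. by rewrite mcompDl -scaleN1r mcompZl scaleN1r. Qed.

Lemma mcomp_idmor0 A B (f : mor A B) : idmor A = 0 -> f = 0.
Proof. by move=> A0; rewrite -(mcompf1 f) A0 mcomp0r. Qed.
End Composition.

(* The proof that the identity is nonzero is carried along because algebras are
   required to be nontrivial. *)
Definition endo (R : realType) (C : starCat R) (A : C) (nz : idmor A != 0) : Type := mor A A.

Section EndomorphismAlgebra.
Context (R : realType) (C : starCat R) (A : C) (nz : idmor A != 0).
Local Notation T := (endo nz).
HB.instance Definition _ := GRing.Lmodule.on T.
Let mul (x y : T) : T := mcomp x y.
HB.instance Definition _ := GRing.Zmodule_isNzRing.Build T
  (fun x y z => mcompA x y z : mul x (mul y z) = mul (mul x y) z)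
  (fun x => mcomp1f x : mul (idmor A) x = x) (fun x => mcompf1 x : mul x (idmor A) = x)
  (fun x y z => mcompDl x y z : mul (x + y) z = mul x z + mul y z)
  (fun x y z => mcompDr x y z : mul x (y + z) = mul x y + mul x z) nz.
HB.instance Definition _ := GRing.Lmodule_isLalgebra.Build R[i] T
  (fun a x y => esym (mcompZl a x y)).
HB.instance Definition _ := GRing.Lalgebra_isAlgebra.Build R[i] T
  (fun a x y => esym (mcompZr a x y)).

End EndomorphismAlgebra.

Section Sharp.
Context (R : realType) (C : starCat R) (alpha : forall A B : C, mor A B -> mor A B).
Arguments alpha {A B}.
Hypothesis alpha_functor : isStarFunctor (F := fun A => A) (@alpha).
Hypothesis alphaK : forall A B (x : mor A B), alpha (alpha x) = x.
Implicit Types A B D E : C.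

Definition sharp A B (x : mor A B) : mor B A := alpha (star x).

Lemma alpha_linear A B : linear (@alpha A B).
Proof. exact: functor_linear alpha_functor _ _. Qed.
Lemma alphaM A B D (g : mor B D) (f : mor A B) : alpha (mcomp g f) = mcomp (alpha g) (alpha f).
Proof. exact: functor_comp alpha_functor _ _ _ _ _. Qed.
Lemma alpha_id A : alpha (idmor A) = idmor A.
Proof. exact: functor_idmor alpha_functor _. Qed.
Lemma alpha_star A B (f : mor A B) : alpha (star f) = star (alpha f).
Proof. exact: functor_star alpha_functor _ _ _. Qed.
Lemma alphaD A B (f g : mor A B) : alpha (f + g) = alpha f + alpha g.
Proof. by have := alpha_linear 1 f g; rewrite !scale1r. Qed.
Lemma alpha0 A B : alpha (0 : mor A B) = 0.
Proof. by apply: (addrI (alpha 0)); rewrite -alphaD !addr0. Qed.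
Lemma alphaZ A B a (f : mor A B) : alpha (a *: f) = a *: alpha f.
Proof. by have := alpha_linear a f 0; rewrite alpha0 !addr0. Qed.

Lemma sharp_conj_linear A B (a : R[i]) (x y : mor A B) :
  sharp (a *: x + y) = a^* *: sharp x + sharp y.
Proof. by rewrite /sharp star_conj_linear alpha_linear. Qed.
Lemma sharpM A B D (g : mor B D) (f : mor A B) :
  sharp (mcomp g f) = mcomp (sharp f) (sharp g).
Proof. by rewrite /sharp star_mcomp alphaM. Qed.
Lemma sharpK A B (x : mor A B) : sharp (sharp x) = x.
Proof. by rewrite /sharp -alpha_star starK alphaK. Qed.
Lemma sharp_alpha A B (x : mor A B) : sharp (alpha x) = alpha (sharp x).
Proof. by rewrite /sharp -alpha_star. Qed.
Lemma sharpZ A B (a : R[i]) (x : mor A B) : sharp (a *: x) = a^* *: sharp x.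
Proof.
have s0 : sharp (0 : mor A B) = 0.
  have := sharp_conj_linear 1 (0 : mor A B) 0; rewrite rmorph1 !scale1r addr0.
  by move/eqP; rewrite -subr_eq0 opprD addNKr oppr_eq0 => /eqP.
by have := sharp_conj_linear a x 0; rewrite s0 !addr0.
Qed.

(** Positivity is required for [x] with any codomain because the forms live on all Hom(A, B).
    Normalization is left out; [endo_state] bounds the value at the identity. *)
Record state A := State {
  state_fun :> mor A A -> R[i];
  state_linear : forall a x y, state_fun (a *: x + y) = a * state_fun x + state_fun y;
  state_sharp : forall x, state_fun (sharp x) = (state_fun x)^*;
  state_alpha : forall x, state_fun (alpha x) = state_fun x;
  state_ge0 : forall B (x : mor A B), 0 <= state_fun (mcomp (sharp x) x)
}.

Variable N : forall A B : C, normOn (mor A B).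
Hypothesis N_banach : forall A B, banach (N A B).
Hypothesis N_Cstar : forall A B (x : mor A B), N A A (mcomp (sharp x) x) = N A B x ^+ 2.
Hypothesis sharp_pos : forall A B (x : mor A B),
  cstar_positive (fun y => sharp y) (mcomp (sharp x) x).

Lemma sharp_sqr_sa A B (x : mor A B) : sharp (mcomp (sharp x) x) = mcomp (sharp x) x.
Proof. by rewrite sharpM sharpK. Qed.

Section Nonzero.
Variables (A : C) (nz : idmor A != 0).
Let T : algType R[i] := endo nz.
(* [N A A] itself is not a norm on [T]: the vector space structure of [T] is only
   fieldwise convertible to that of [mor A A]. *)
Let NT : normOn T := @NormOn R T (N A A) (@norm_triangle _ _ (N A A))
  (@norm_homog _ _ (N A A)) (@norm_eq0 _ _ (N A A)).
Let sh : T -> T := @sharp A A.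
Let sh_conj_linear : forall (a : R[i]) (x y : T), sh (a *: x + y) = a^* *: sh x + sh y.
Proof. exact: sharp_conj_linear. Qed.
Let shM (x y : T) : sh (x * y) = sh y * sh x. Proof. exact: sharpM. Qed.
Let shK : involutive sh. Proof. exact: sharpK. Qed.
Let NC (x : T) : NT (sh x * x) = NT x ^+ 2. Proof. exact: N_Cstar. Qed.
Let Ncomplete u : cauchy_seq NT u -> exists l, converges NT u l.
Proof. exact: banach_seq (@N_banach A A) u. Qed.

(** If [x# x + l] were not invertible for some [l > 0], then [- l] would lie in the spectrum of
    [x# x]. *)
Lemma endo_sqr_pos B (x : mor A B) : cstar_pos NT (mcomp (sharp x) x : T).
Proof.
apply: (cstar_pos_of_inv sh_conj_linear shM shK NC Ncomplete) => [|l l0].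
  exact: sharp_sqr_sa.
apply: contrapT => H; have [_ /(_ (- l%:C))] := sharp_pos x.
have /[swap]/[apply] : spectrum (mcomp (sharp x) x) (- l%:C).
  move=> [b [b1 b2]]; apply: H; exists b.
  by move: b1 b2; rewrite scaleNr opprK.
by rewrite oppr_ge0 lecR leNgt l0.
Qed.

Lemma endo_sqrt B (x : mor A B) t : N A B x ^+ 2 < t ->
  exists2 d : mor A A, sharp d = d & t%:C *: idmor A - mcomp (sharp x) x = mcomp d d.
Proof.
rewrite -N_Cstar => xt.
have [d [ds dd _]] := sqrt_of_norm_lt sh_conj_linear shM shK NC Ncomplete
  (sharp_sqr_sa x : sh (mcomp (sharp x) x) = mcomp (sharp x) x) xt.
by exists d.
Qed.

Lemma endo_functional B (x0 : mor A B) : exists f : mor A A -> R,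
  [/\ forall x y, f (x + y) = f x + f y,
      forall (t : R) x, f (t%:C *: x) = t * f x,
      f (idmor A) <= 1,
      forall D (x : mor A D), 0 <= f (mcomp (sharp x) x) &
      forall k, sharp k = - k -> f k = 0] /\
  N A B x0 ^+ 2 <= f (mcomp (sharp x0) x0).
Proof.
have [f [[fD fZ fN fp fskew] fx]] := state_ex sh_conj_linear shM shK NC Ncomplete
  (sharp_sqr_sa x0 : sh (mcomp (sharp x0) x0) = mcomp (sharp x0) x0) (@endo_sqr_pos B x0).
exists f; split; last by rewrite -N_Cstar.
split=> //; last by move=> D x; exact/fp/endo_sqr_pos.
by apply: le_trans (fN _) _; rewrite (norm1 shM shK NC).
Qed.

Lemma endo_state B (x0 : mor A B) : exists st : state A,
  N A B x0 ^+ 2 / 2 <= complex.Re (st (mcomp (sharp x0) x0)) /\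
  complex.Re (st (idmor A)) <= 1.
Proof.
have [f [[fD fZ f1 fp fskew] fx]] := endo_functional x0.
(* averaging over [alpha] makes the state invariant, and costs a factor 2 *)
pose g (x : mor A A) : R := (f x + f (alpha x)) / 2.
have gD x y : g (x + y) = g x + g y by rewrite /g alphaD !fD; lra.
have gZ (t : R) x : g (t%:C *: x) = t * g x by rewrite /g alphaZ !fZ; lra.
have gskew k : sharp k = - k -> g k = 0.
  move=> ks; rewrite /g fskew// fskew ?addr0 ?mul0r//.
  by rewrite sharp_alpha ks -scaleN1r alphaZ scaleN1r.
have g0 : g 0 = 0 by have := gZ 0 0; rewrite scaler0 mul0r.
have gN x : g (- x) = - g x by apply/eqP; rewrite -addr_eq0 -gD addNr g0.
have galpha x : g (alpha x) = g x by rewrite /g alphaK addrC.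
have gpos D (x : mor A D) : 0 <= g (mcomp (sharp x) x).
  by rewrite /g alphaM -sharp_alpha divr_ge0// addr_ge0// fp.
have g_i x : sharp x = x -> g ('i *: x) = 0.
  by move=> xs; rewrite gskew// sharpZ conjCi xs scaleNr.
(* The complex linear functional with real part [g]. That [g] vanishes on skew elements makes it
   hermitian, and real on self-adjoint elements. *)
pose Om x : R[i] := g x +i* (- g ('i *: x)).
have Om_linear a x y : Om (a *: x + y) = a * Om x + Om y.
  case: a => p q.
  have E z : (p +i* q) *: z = p%:C *: z + q%:C *: ('i *: z).
    by rewrite scalerA -scalerDl [LHS](_ : _ = (p%:C + q%:C * 'i) *: z)// [p +i* q]complexE mulrC.
  have Ei z : 'i *: ((p +i* q) *: z) = p%:C *: ('i *: z) + (- q)%:C *: z.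
    rewrite E scalerDr !scalerA mulrC; congr (_ + _ *: _).
    by rewrite mulrAC -expr2 sqrCi mulN1r realcN.
  rewrite /Om scalerDr Ei E !gD !gZ.
  by apply/eqP; rewrite eq_complex /=; apply/andP; split; apply/eqP; ring.
have Om_sharp x : Om (sharp x) = (Om x)^*.
  have sD (u v : mor A A) : sharp (u + v) = sharp u + sharp v.
    by have := sharp_conj_linear 1 u v; rewrite rmorph1 !scale1r.
  have sN (u : mor A A) : sharp (- u) = - sharp u.
    by rewrite -scaleN1r sharpZ rmorphN1 scaleN1r.
  have e1 : g (sharp x) = g x.
    apply/eqP; rewrite -subr_eq0 -gN -gD gskew//.
    by rewrite sD sN sharpK opprB addrC.
  have e2 : g ('i *: sharp x) = - g ('i *: x).
    apply/eqP; rewrite -addr_eq0 -gD -scalerDr g_i//.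
    by rewrite sD sharpK addrC.
  by rewrite /Om e1 e2.
have Om_alpha x : Om (alpha x) = Om x by rewrite /Om -alphaZ !galpha.
have Om_ge0 D (x : mor A D) : 0 <= Om (mcomp (sharp x) x).
  by rewrite /Om g_i ?oppr0 ?lecE /= ?eqxx ?gpos//; exact: sharp_sqr_sa.
exists (State Om_linear Om_sharp Om_alpha Om_ge0); split => /=.
- rewrite ler_pM2r//; apply: le_trans fx _.
  by rewrite lerDl alphaM -sharp_alpha fp.
- by rewrite /g alpha_id; lra.
Qed.

End Nonzero.

Lemma stateZ A (st : state A) a x : st (a *: x) = a * st x.
Proof.
have st0 : st 0 = 0.
  have := state_linear st 1 0 0; rewrite scale1r addr0 mul1r => /eqP.
  by rewrite -subr_eq0 opprD addNKr oppr_eq0 => /eqP.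
by have := state_linear st a x 0; rewrite st0 !addr0.
Qed.

Lemma stateB A (st : state A) x y : st (x - y) = st x - st y.
Proof. by have := state_linear st (-1) y x; rewrite scaleN1r mulN1r addrC => ->; rewrite addrC. Qed.

(** For [t > N a ^ 2] write [t - a# a = d ^ 2] with [d] self-adjoint. Then
    [(d x)# (d x) = t x# x - (a x)# (a x)], on which the state is nonnegative; [t] then tends to
    [N a ^ 2]. *)
Lemma state_bound A D E (st : state A) (a : mor D E) (x : mor A D) :
  st (mcomp (sharp (mcomp a x)) (mcomp a x)) <=
  (N D E a ^+ 2)%:C * st (mcomp (sharp x) x).
Proof.
have sx := state_ge0 st x; have sax := state_ge0 st (mcomp a x).
rewrite -(RRe_real (ger0_real sx)) -(RRe_real (ger0_real sax)) -realcM lecR.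
set u := complex.Re _; set v := complex.Re _.
have v0 : 0 <= v by move: sx; rewrite lecE => /andP[].
have key t : N D E a ^+ 2 < t -> u <= t * v.
  move=> at_; have [d ds dd] : exists2 d : mor D D, sharp d = d &
      t%:C *: idmor D - mcomp (sharp a) a = mcomp d d.
    (* If the identity of [D] vanishes, so do all endomorphisms of [D], and [d = 0] will do. *)
    have [D0|D0] := eqVneq (idmor D) 0; last exact: endo_sqrt.
    by exists 0; rewrite [LHS](mcomp_idmor0 _ D0)// mcomp0l.
  have := state_ge0 st (mcomp d x).
  have -> : mcomp (sharp (mcomp d x)) (mcomp d x) =
      t%:C *: mcomp (sharp x) x - mcomp (sharp (mcomp a x)) (mcomp a x).
    rewrite !sharpM ds -!mcompA (mcompA d d) -dd mcompBl mcompZl mcomp1f.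
    by rewrite mcompDr -scaleN1r !mcompZr scaleN1r -!mcompA.
  rewrite stateB stateZ lecE => /andP[_].
  by rewrite ReB subr_ge0 -/u [complex.Re (t%:C * _)](_ : _ = t * v)// /v; case: (st _) => p q /=; ring.
apply/ler_addgt0Pl => e e0; have v1 : 0 < v + 1 by rewrite ltr_wpDl.
have := key (N D E a ^+ 2 + e / (v + 1)); rewrite ltrDl divr_gt0// => /(_ isT)/le_trans; apply.
have ev : e / (v + 1) * v <= e by rewrite mulrAC ler_pdivrMr// ler_pM2l// lerDl.
by rewrite mulrDl; lra.
Qed.
End Sharp.

(** * Direct sums *)

Definition dprod (R : realType) (S : Type) (M : S -> lmodType R[i]) : Type := forall s, M s.

Section DependentProduct.
Context (R : realType) (S : Type) (M : S -> lmodType R[i]).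
Local Notation T := (dprod M).
HB.instance Definition _ := gen_eqMixin T.
HB.instance Definition _ := gen_choiceMixin T.

Let ext (f g : T) : (forall s, f s = g s) -> f = g.
Proof. exact: functional_extensionality_dep. Qed.

Let zero : T := fun=> 0.
Let opp (f : T) : T := fun s => - f s.
Let add (f g : T) : T := fun s => f s + g s.
Let scale (a : R[i]) (f : T) : T := fun s => a *: f s.

Let addA : associative add. Proof. by move=> f g h; apply: ext => s; exact: addrA. Qed.
Let addC : commutative add. Proof. by move=> f g; apply: ext => s; exact: addrC. Qed.
Let add0 : left_id zero add. Proof. by move=> f; apply: ext => s; exact: add0r. Qed.
Let addN : left_inverse zero opp add.
Proof. by move=> f; apply: ext => s; exact: addNr. Qed.
HB.instance Definition _ := GRing.isZmodule.Build T addA addC add0 addN.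

Let scaleA a b f : scale a (scale b f) = scale (a * b) f.
Proof. by apply: ext => s; exact: scalerA. Qed.
Let scale1 : left_id 1 scale. Proof. by move=> f; apply: ext => s; exact: scale1r. Qed.
Let scaleDr : right_distributive scale +%R.
Proof. by move=> a f g; apply: ext => s; exact: scalerDr. Qed.
Let scaleDl f : {morph scale^~ f : a b / a + b}.
Proof. by move=> a b; apply: ext => s; exact: scalerDl. Qed.
HB.instance Definition _ := GRing.Zmodule_isLmodule.Build R[i] T scaleA scale1 scaleDr scaleDl.

Lemma dprod_lin (a : R[i]) (f g : T) s : (a *: f + g : T) s = a *: f s + g s.
Proof. by []. Qed.

End DependentProduct.

Lemma big_seq_support (V : zmodType) (S : eqType) (r r' : seq S) (F : S -> V) :
  uniq r -> uniq r' -> (forall s, s \notin r -> F s = 0) -> (forall s, s \notin r' -> F s = 0) ->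
  \sum_(s <- r) F s = \sum_(s <- r') F s.
Proof.
have sub (q q' : seq S) : (forall s, s \notin q' -> F s = 0) ->
    \sum_(s <- q) F s = \sum_(s <- [seq s <- q | s \in q']) F s.
  by move=> F0; rewrite big_filter (bigID (mem q')) /= [X in _ + X]big1 ?addr0//.
move=> ur ur' F0 F0'; rewrite (sub r r')// (sub r' r)//; apply: perm_big.
apply: uniq_perm; rewrite ?filter_uniq// => s.
by rewrite !mem_filter andbC.
Qed.

Section DirectSum.
Context (R : realType) (S : choiceType) (M : S -> lmodType R[i]).

Definition finsupp_pred : {pred dprod M} := fun f =>
  `[< exists r : seq S, forall s, s \notin r -> f s = 0 >].

Lemma finsupp_submod : submod_closed finsupp_pred.
Proof.
split; first by apply/asboolP; exists [::].
move=> a f g /asboolP[r fr] /asboolP[q gq]; apply/asboolP; exists (r ++ q) => s.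
by rewrite mem_cat negb_or => /andP[/fr fs /gq gs]; rewrite dprod_lin fs gs scaler0 addr0.
Qed.
HB.instance Definition _ :=
  GRing.isSubmodClosed.Build R[i] (dprod M) finsupp_pred finsupp_submod.

Definition dsum : Type := subvect finsupp_pred.
HB.instance Definition _ := GRing.Lmodule.on dsum.
Definition dcoef (f : dsum) : forall s, M s := val f.

Lemma dcoef_lin a (f g : dsum) s : dcoef (a *: f + g) s = a *: dcoef f s + dcoef g s.
Proof. by []. Qed.

Lemma dsum_ext (f g : dsum) : (forall s, dcoef f s = dcoef g s) -> f = g.
Proof. by move=> fg; apply: val_inj; apply: functional_extensionality_dep. Qed.

Lemma dsum_supp_ex (f : dsum) :
  exists r : seq S, uniq r /\ forall s, s \notin r -> dcoef f s = 0.
Proof.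
have /asboolP[r fr] := valP f; exists (undup r); split; first exact: undup_uniq.
by move=> s; rewrite mem_undup; exact: fr.
Qed.
(** A chosen list that contains the support and may be larger; [dsum_formE] makes the form
    independent of the choice. *)
Definition dsupp (f : dsum) : seq S := sval (cid (dsum_supp_ex f)).
Lemma dsupp_uniq f : uniq (dsupp f). Proof. exact: (svalP (cid (dsum_supp_ex f))).1. Qed.
Lemma dsuppP f s : s \notin dsupp f -> dcoef f s = 0.
Proof. exact: (svalP (cid (dsum_supp_ex f))).2. Qed.

Definition mkDsum (f : dprod M) (fP : f \in finsupp_pred) : dsum :=
  exist (fun g => g \in finsupp_pred) f fP.

Lemma mkDsumE f (fP : f \in finsupp_pred) s : dcoef (mkDsum fP) s = f s.
Proof. by []. Qed.

Let single_subproof s0 (x : M s0) :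
  (eqtype.dfwith (fun s => 0 : M s) x : dprod M) \in finsupp_pred.
Proof.
apply/asboolP; exists [:: s0] => s; rewrite inE eq_sym => ss.
exact: dfwith_out.
Qed.
Definition dsingle s0 (x : M s0) : dsum := mkDsum (single_subproof x).

Lemma dsingle_in s0 (x : M s0) : dcoef (dsingle x) s0 = x.
Proof. exact: dfwith_in. Qed.
Lemma dsingle_out s0 (x : M s0) s : s != s0 -> dcoef (dsingle x) s = 0.
Proof. by move=> ss; apply: dfwith_out; rewrite eq_sym. Qed.

Variable h : forall s, hermForm (M s).

Let dform (f g : dsum) : R[i] := \sum_(s <- dsupp f) h s (dcoef f s) (dcoef g s).

Let dform_over r f g : uniq r ->
  (forall s, s \notin r -> h s (dcoef f s) (dcoef g s) = 0) ->
  dform f g = \sum_(s <- r) h s (dcoef f s) (dcoef g s).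
Proof.
move=> ur fr; apply: big_seq_support => //; first exact: dsupp_uniq.
by move=> s /dsuppP ->; rewrite Defs.form0l.
Qed.

Let dform_linear f a g k : dform f (a *: g + k) = a * dform f g + dform f k.
Proof.
rewrite /dform big_distrr -big_split /=; apply: eq_bigr => s _.
by rewrite dcoef_lin form_linear.
Qed.

Let dform_herm f g : dform g f = (dform f g)^*.
Proof.
rewrite (@dform_over (dsupp f)) ?dsupp_uniq//; last first.
  by move=> s /dsuppP ->; rewrite Defs.form0r.
by rewrite rmorph_sum /=; apply: eq_bigr => s _; exact: form_herm.
Qed.

Definition dsum_form : hermForm dsum := HermForm dform_linear dform_herm.

Lemma dsum_formE r f g : uniq r ->
  (forall s, s \notin r -> h s (dcoef f s) (dcoef g s) = 0) ->
  dsum_form f g = \sum_(s <- r) h s (dcoef f s) (dcoef g s).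
Proof. exact: dform_over. Qed.

Lemma dsum_form_single s0 (x y : M s0) : dsum_form (dsingle x) (dsingle y) = h s0 x y.
Proof.
rewrite (@dsum_formE [:: s0])//; first by rewrite big_seq1 !dsingle_in.
by move=> s; rewrite inE => ss; rewrite dsingle_out// Defs.form0l.
Qed.

Lemma dsum_form_ge0 : (forall s x, 0 <= h s x x) -> forall f, 0 <= dsum_form f f.
Proof. by move=> h0 f; apply: sumr_ge0 => s _. Qed.

End DirectSum.

Section DirectSumMap.
Context (R : realType) (S : choiceType) (M M' : S -> lmodType R[i]).
Variables (h : forall s, hermForm (M s)) (h' : forall s, hermForm (M' s)).
Variables (T : forall s, M s -> M' s) (T' : forall s, M' s -> M s).
Arguments T : clear implicits.
Arguments T' : clear implicits.
Hypotheses (T_linear : forall s, linear (T s)) (T'0 : forall s, T' s 0 = 0).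
Hypothesis TT' : forall s w v, h' s w (T s v) = h s (T' s w) v.
Variable c : R.
Hypothesis c_ge0 : 0 <= c.
Hypothesis T_bound : forall s v, h' s (T s v) (T s v) <= (c ^+ 2)%:C * h s v v.
Hypotheses (h_ge0 : forall s x, 0 <= h s x x) (h'_ge0 : forall s x, 0 <= h' s x x).

Let T0 s : T s 0 = 0.
Proof.
have := @T_linear s 1 0 0; rewrite !scale1r addr0 => /eqP.
by rewrite -subr_eq0 opprD addNKr oppr_eq0 => /eqP.
Qed.

Let map_subproof (f : dsum M) : ((fun s => T s (dcoef f s)) : dprod M') \in @finsupp_pred R S M'.
Proof.
have [r [_ fr]] := dsum_supp_ex f; apply/asboolP; exists r => s /fr ->; exact: T0.
Qed.
Let star_subproof (f : dsum M') : ((fun s => T' s (dcoef f s)) : dprod M) \in @finsupp_pred R S M.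
Proof.
have [r [_ fr]] := dsum_supp_ex f; apply/asboolP; exists r => s /fr ->; exact: T'0.
Qed.

Let map_linear : linear (fun f => mkDsum (map_subproof f)).
Proof. by move=> a f g; apply: dsum_ext => s; exact: T_linear. Qed.

Let map_starP w v : dsum_form h' w (mkDsum (map_subproof v)) =
  dsum_form h (mkDsum (star_subproof w)) v.
Proof.
rewrite (@dsum_formE _ _ _ h (dsupp w)) ?dsupp_uniq//.
  by apply: eq_bigr => s _; exact: TT'.
by move=> s sw; rewrite mkDsumE (dsuppP sw) T'0 Defs.form0l.
Qed.

Lemma dsum_map_bound v : hnorm (dsum_form h') (mkDsum (map_subproof v)) <=
  c * hnorm (dsum_form h) v.
Proof.
rewrite -(@ler_pXn2r _ 2) ?nnegrE ?mulr_ge0 ?hnorm_ge0// exprMn.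
rewrite -lecR [leRHS]realcM !psd_sqr; try exact: dsum_form_ge0.
rewrite (@dsum_formE _ _ _ h' (dsupp v)) ?dsupp_uniq//; last first.
  by move=> s sv; rewrite mkDsumE (dsuppP sv) T0 Defs.form0l.
by rewrite [dsum_form h v v]/= mulr_sumr; apply: ler_sum => s _; exact: T_bound.
Qed.

Definition dsum_map : adjointable (dsum_form h) (dsum_form h') :=
  Adjointable map_linear map_starP (ex_intro _ c dsum_map_bound).

Lemma dsum_mapE f s : dcoef (dsum_map f) s = T s (dcoef f s). Proof. by []. Qed.
Lemma dsum_map_starE f s : dcoef (adj_star dsum_map f) s = T' s (dcoef f s). Proof. by []. Qed.

End DirectSumMap.

(** * Equivalence of operator norms, and transport of norms *)

Section BoundedOperatorNorms.
Context (R : realType).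
Implicit Types K L : kreinSpace R.

Lemma continuous_linear_bounded K L (f : K -> L) (J : fundSym K) (J' : fundSym L) (c : R) :
  linear f -> (forall x, fundsym_norm J' (f x) <= c * fundsym_norm J x) ->
  f \in continuous_linear (K := K) (L := L).
Proof.
move=> fl fc; apply/continuous_linearP; split=> // J1 J1'.
have [M1 H1] := fundsym_norm_equiv J1' J'; have [M2 H2] := fundsym_norm_equiv J J1.
exists (`|M1| * (`|c| * `|M2|)) => x; apply: le_trans (H1 _) _.
apply: (@le_trans _ _ (`|M1| * fundsym_norm J' (f x))).
  by rewrite ler_wpM2r ?norm_ge0// ler_norm.
rewrite -!mulrA ler_wpM2l//; apply: le_trans (fc x) _.
apply: (@le_trans _ _ (`|c| * fundsym_norm J x)).
  by rewrite ler_wpM2r ?norm_ge0// ler_norm.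
rewrite ler_wpM2l//; apply: le_trans (H2 x) _.
by rewrite ler_wpM2r ?norm_ge0// ler_norm.
Qed.

Lemma opnorm_le_bound K L (J : fundSym K) (J' : fundSym L) (T : bop K L) (c : R) : 0 <= c ->
  (forall x, fundsym_norm J' (T x) <= c * fundsym_norm J x) -> opnorm J J' T <= c.
Proof.
move=> c0 Tc; apply: opnorm_le => x x1; apply: le_trans (Tc x) _.
by rewrite ler_piMr.
Qed.

Lemma opnorm_equiv K L (J1 J2 : fundSym K) (J1' J2' : fundSym L) :
  exists2 c, 0 <= c & forall T : bop K L, opnorm J1 J1' T <= c * opnorm J2 J2' T.
Proof.
have [M1 H1] := fundsym_norm_equiv J1' J2'; have [M2 H2] := fundsym_norm_equiv J2 J1.
exists (`|M1| * `|M2|) => [|T]; first exact: mulr_ge0.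
apply: opnorm_le_bound => [|x]; first by rewrite !mulr_ge0// norm_ge0.
apply: le_trans (H1 _) _.
apply: (@le_trans _ _ (`|M1| * fundsym_norm J2' (T x))).
  by rewrite ler_wpM2r ?norm_ge0// ler_norm.
rewrite -!mulrA ler_wpM2l//; apply: le_trans (opnorm_bound J2 J2' T x) _.
rewrite mulrCA ler_wpM2l ?opnorm_fun_ge0//.
apply: le_trans (H2 x) _; by rewrite ler_wpM2r ?norm_ge0// ler_norm.
Qed.

End BoundedOperatorNorms.

Section NormPullback.
Context (R : realType) (V W : lmodType R[i]) (N : normOn W) (f : V -> W).
Hypotheses (f_linear : linear f) (f_inj : injective f).

Let fD x y : f (x + y) = f x + f y.
Proof. by have := f_linear 1 x y; rewrite !scale1r. Qed.
Let f0 : f 0 = 0. Proof. by apply: (addrI (f 0)); rewrite -fD !addr0. Qed.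
Let fZ a x : f (a *: x) = a *: f x.
Proof. by have := f_linear a x 0; rewrite f0 !addr0. Qed.

Let pb_triangle x y : N (f (x + y)) <= N (f x) + N (f y).
Proof. by rewrite fD norm_triangle. Qed.
Let pb_homog a x : N (f (a *: x)) = modulus a * N (f x).
Proof. by rewrite fZ norm_homog. Qed.
Let pb_eq0 x : N (f x) = 0 -> x = 0.
Proof. by move=> /norm_eq0 fx; apply: f_inj; rewrite fx f0. Qed.
Definition norm_pullback : normOn V := NormOn pb_triangle pb_homog pb_eq0.

Lemma banach_pullback : bijective f -> banach N -> banach norm_pullback.
Proof.
move=> [g fK gK] bN; apply: banach_of_seq => u cu.
have fB x y : f (x - y) = f x - f y by rewrite fD -scaleN1r fZ scaleN1r.
have [|l ul] := banach_seq bN (u := f \o u).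
  by move=> e /cu[n0 H]; exists n0 => m n nm nn /=; rewrite -fB; exact: H.
exists (g l) => e /ul[n0 H]; exists n0 => n nn /=.
by rewrite /= fB gK; exact: H.
Qed.
End NormPullback.

(** * The representation *)

Section FundamentalSymmetryPullback.
Context (R : realType) (C D : starCat R) (G : D -> C).
Variable psi : forall A B : D, mor A B -> mor (G A) (G B).
Arguments psi {A B}.
Hypotheses (psi_functor : isStarFunctor (@psi)) (psi_bij : forall A B, bijective (@psi A B)).
Variable alpha : forall A B : C, mor A B -> mor A B.
Arguments alpha {A B}.
Hypothesis alpha_sym : fundamental_symmetry (@alpha).

Let psi_inj A B : injective (@psi A B). Proof. exact: bij_inj. Qed.
Let psi_lin A B : linear (@psi A B). Proof. exact: functor_linear psi_functor A B. Qed.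
Let psi_id A : psi (idmor A) = idmor (G A). Proof. exact: functor_idmor psi_functor A. Qed.
Let psiM A B E (g : mor B E) (f : mor A B) : psi (mcomp g f) = mcomp (psi g) (psi f).
Proof. exact: functor_comp psi_functor _ _ _ _ _. Qed.
Let psi_star A B (f : mor A B) : psi (star f) = star (psi f).
Proof. exact: functor_star psi_functor _ _ _. Qed.

Let beta_ex A B (y : mor A B) : exists x : mor A B, psi x = alpha (psi y).
Proof. by have [g _ gK] := @psi_bij A B; exists (g (alpha (psi y))). Qed.
Definition symmetry_pullback A B (y : mor A B) : mor A B := sval (cid (beta_ex y)).
Local Notation beta := symmetry_pullback.
Let betaE A B (y : mor A B) : psi (beta y) = alpha (psi y).
Proof. exact: svalP (cid (beta_ex y)). Qed.

(** Every clause is transported along the bijections [psi], including norms and inverses. The case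
    needed is the inverse of the representation on its image, which thereby becomes a Kreĭn
    C*-category. *)
Lemma fundamental_symmetry_pullback : fundamental_symmetry (@symmetry_pullback).
Proof.
have [[al ai ac as_] aK [N [Nb NC]] ap] := alpha_sym; split.
- split.
  + by move=> A B a x y; apply: psi_inj; rewrite betaE !psi_lin !betaE al.
  + by move=> A; apply: psi_inj; rewrite betaE psi_id ai.
  + by move=> A B E g f; apply: psi_inj; rewrite betaE !psiM !betaE ac.
  + by move=> A B f; apply: psi_inj; rewrite betaE !psi_star betaE as_.
- by move=> A B x; apply: psi_inj; rewrite !betaE aK.
- exists (fun A B => norm_pullback (N (G A) (G B)) (@psi_lin A B) (@psi_inj A B)); split.
    by move=> A B; exact: banach_pullback.
  by move=> A B x /=; rewrite psiM betaE psi_star NC.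
- move=> A B x; have [sx px] := ap _ _ (psi x).
  have E : psi (mcomp (beta (star x)) x) = mcomp (alpha (star (psi x))) (psi x).
    by rewrite psiM betaE psi_star.
  split; first by apply: psi_inj; rewrite betaE psi_star E.
  move=> l sl; apply: px => -[b [b1 b2]]; apply: sl.
  have [g _ gK] := @psi_bij A A; exists (g b).
  have psiB : psi (mcomp (beta (star x)) x - l *: idmor A) =
      mcomp (alpha (star (psi x))) (psi x) - l *: idmor (G A).
    by rewrite addrC -scaleNr psi_lin E psi_id scaleNr addrC.
  by split; apply: psi_inj; rewrite psiM psiB gK psi_id.
Qed.

End FundamentalSymmetryPullback.

Section Representation.
Context (R : realType) (C : starCat R) (alpha : forall A B : C, mor A B -> mor A B).
Arguments alpha {A B}.
Hypothesis alpha_functor : isStarFunctor (F := fun A => A) (@alpha).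
Hypothesis alphaK : forall A B (x : mor A B), alpha (alpha x) = x.
Variable N : forall A B : C, normOn (mor A B).
Hypothesis N_banach : forall A B, banach (N A B).
Local Notation sh := (sharp (@alpha)).
Hypothesis N_Cstar : forall A B (x : mor A B), N A A (mcomp (sh x) x) = N A B x ^+ 2.
Hypothesis sharp_pos : forall A B (x : mor A B),
  cstar_positive (fun y => sh y) (mcomp (sh x) x).
Implicit Types A B D E : C.

Let S : choiceType := {classic {A : C & state (@alpha) A}}.

Definition gns_mor D (s : S) : lmodType R[i] := mor (projT1 s) D.

Let gns_linear D (s : S) (x : gns_mor D s) a y z :
  projT2 s (mcomp (sh x) (a *: y + z)) =
  a * projT2 s (mcomp (sh x) y) + projT2 s (mcomp (sh x) z).
Proof. by rewrite mcomp_linearr state_linear. Qed.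

Let gns_herm D (s : S) (x y : gns_mor D s) :
  projT2 s (mcomp (sh y) x) = (projT2 s (mcomp (sh x) y))^*.
Proof. by rewrite -state_sharp sharpM// sharpK. Qed.

Definition gns_form D (s : S) : hermForm (gns_mor D s) :=
  HermForm (@gns_linear D s) (@gns_herm D s).

Lemma gns_ge0 D (s : S) x : 0 <= gns_form D s x x.
Proof. exact: state_ge0. Qed.

Lemma gns_sum_ge0 D x : 0 <= dsum_form (gns_form D) x x.
Proof. exact/dsum_form_ge0/gns_ge0. Qed.

Definition rep_space D : lmodType R[i] := completion (@gns_sum_ge0 D).
Definition rep_form D : hermForm (rep_space D) := completion_form (@gns_sum_ge0 D).
Definition rep_posdef D : posdef (rep_form D) :=
  @completion_posdef _ _ _ (@gns_sum_ge0 D).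

Lemma gns_act_bound D E (a : mor D E) (s : S) (v : gns_mor D s) :
  gns_form E s (mcomp a v) (mcomp a v) <= (N D E a ^+ 2)%:C * gns_form D s v v.
Proof. exact: (state_bound alpha_functor alphaK N_banach N_Cstar). Qed.

Lemma gns_act_adj D E (a : mor D E) (s : S) (w : gns_mor E s) (v : gns_mor D s) :
  gns_form E s w (mcomp a v) = gns_form D s (mcomp (sh a) w) v.
Proof. by rewrite /= sharpM// sharpK// mcompA. Qed.

Definition act D E (a : mor D E) : adjointable (dsum_form (gns_form D)) (dsum_form (gns_form E)) :=
  @dsum_map R S (gns_mor D) (gns_mor E) (gns_form D) (gns_form E)
    (fun s x => mcomp a x) (fun s y => mcomp (sh a) y)
    (fun s => mcomp_linearr a) (fun s => mcomp0r _ (sh a)) (@gns_act_adj D E a)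
    (N D E a) (norm_ge0 (N D E) a) (@gns_act_bound D E a) (@gns_ge0 D) (@gns_ge0 E).

(** Invariance of the state enters here: applying [alpha] to [w# (alpha v)] inside the state gives
    [(alpha w)# v]. *)
Lemma gns_flip_adj D (s : S) (w v : gns_mor D s) :
  gns_form D s w (alpha v) = gns_form D s (alpha w) v.
Proof.
rewrite /= -[LHS]state_alpha; congr (projT2 s _).
by rewrite alphaM// alphaK -sharp_alpha.
Qed.

Lemma gns_flip_bound D (s : S) (v : gns_mor D s) :
  gns_form D s (alpha v) (alpha v) <= (1 ^+ 2)%:C * gns_form D s v v.
Proof. by rewrite gns_flip_adj alphaK expr1n mul1r. Qed.

Definition flip D : adjointable (dsum_form (gns_form D)) (dsum_form (gns_form D)) :=
  @dsum_map R S (gns_mor D) (gns_mor D) (gns_form D) (gns_form D)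
    (fun s x => alpha x) (fun s x => alpha x)
    (fun s => @alpha_linear _ _ _ alpha_functor _ _) (fun s => alpha0 alpha_functor _ _) (@gns_flip_adj D)
    1 ler01 (@gns_flip_bound D) (@gns_ge0 D) (@gns_ge0 D).

Lemma act_bound D E (a : mor D E) v :
  hnorm (dsum_form (gns_form E)) (act a v) <= N D E a * hnorm (dsum_form (gns_form D)) v.
Proof.
exact: (dsum_map_bound _ (norm_ge0 (N D E) a) (@gns_act_bound D E a) (@gns_ge0 D) (@gns_ge0 E)).
Qed.

Definition rep_flip D : rep_space D -> rep_space D := extend (@gns_sum_ge0 D) (flip D).

Lemma rep_flip_linear D : linear (@rep_flip D).
Proof. exact: extend_linear. Qed.

Lemma flipK D v : flip D (flip D v) = v.
Proof. by apply: dsum_ext => s; rewrite !dsum_mapE alphaK. Qed.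

Lemma rep_flipK D : involutive (@rep_flip D).
Proof.
move=> f; have [u uf] := represents_ex f.
apply: represents_unique (uf).
have := represents_extend (@gns_sum_ge0 D) (flip D)
  (represents_extend (@gns_sum_ge0 D) (flip D) uf).
by congr (represents _ _); apply/funext => n; exact: flipK.
Qed.

Lemma rep_flip_sym D x y : rep_form D (rep_flip x) y = rep_form D x (rep_flip y).
Proof. by apply: extend_adjoint => w; apply: dsum_ext => s; rewrite dsum_map_starE. Qed.

Lemma rep_complete D u : cauchy_seq (form_norm (@rep_posdef D)) u ->
  exists l, converges (form_norm (@rep_posdef D)) u l.
Proof. exact: completion_complete. Qed.

Definition rep_krein D : kreinSpace R :=
  involution_space (@rep_complete D) (@rep_flip_linear D) (@rep_flipK D) (@rep_flip_sym D).
Definition rep_sym D : fundSym (rep_krein D) :=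
  involution_sym (@rep_complete D) (@rep_flip_linear D) (@rep_flipK D) (@rep_flip_sym D).

Lemma rep_normE D (x : rep_krein D) : fundsym_norm (rep_sym D) x = hnorm (rep_form D) x.
Proof. exact: involution_norm. Qed.

Definition rep_fun D E (a : mor D E) : rep_space D -> rep_space E :=
  extend (@gns_sum_ge0 E) (act a).

Lemma rep_fun_bound D E (a : mor D E) (x : rep_krein D) :
  fundsym_norm (rep_sym E) (rep_fun a x) <= N D E a * fundsym_norm (rep_sym D) x.
Proof.
rewrite !rep_normE; apply: extend_bound; first exact: norm_ge0.
exact: act_bound.
Qed.

Let rep_subproof D E (a : mor D E) :
  (rep_fun a : rep_krein D -> rep_krein E) \in continuous_linear (K := rep_krein D) (L := rep_krein E).
Proof.
apply: continuous_linear_bounded (@rep_fun_bound D E a); exact: extend_linear.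
Qed.
Definition rep D E (a : mor D E) : bop (rep_krein D) (rep_krein E) := mkBop (rep_subproof a).

Lemma repE D E (a : mor D E) x : rep a x = rep_fun a x. Proof. by []. Qed.

Lemma represents_rep D E (a : mor D E) u f :
  represents u f -> represents (act a \o u) (rep_fun a f).
Proof. exact: represents_extend. Qed.

Lemma actE D E (a : mor D E) v s : dcoef (act a v) s = mcomp a (dcoef v s).
Proof. by []. Qed.
Lemma flipE D v s : dcoef (flip D v) s = alpha (dcoef v s).
Proof. by []. Qed.

Lemma rep_linear D E : linear (@rep D E).
Proof.
move=> c a b; apply: bop_ext => f; rewrite bopD bopZ !repE.
have [u uf] := represents_ex f; apply: represents_unique (represents_rep _ uf) _.
have := representsZD c (represents_rep a uf) (represents_rep b uf).
congr (represents _ _); apply/funext => n; apply: dsum_ext => s.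
by rewrite dcoef_lin !actE mcompDl mcompZl.
Qed.

Lemma rep_idmor D : rep (idmor D) = idop (rep_krein D).
Proof.
apply: bop_ext => f; rewrite repE; have [u uf] := represents_ex f.
apply: represents_unique (represents_rep _ uf) _.
move: uf; congr (represents _ _); apply/funext => n; apply: dsum_ext => s.
by rewrite actE mcomp1f.
Qed.

Lemma rep_mcomp A D E (b : mor D E) (a : mor A D) : rep (mcomp b a) = compop (rep b) (rep a).
Proof.
apply: bop_ext => f; have [u uf] := represents_ex f.
apply: represents_unique (represents_rep _ uf) _.
have := represents_rep b (represents_rep a uf).
congr (represents _ _); apply/funext => n; apply: dsum_ext => s.
by rewrite !actE mcompA.
Qed.

(** On coefficients this is multiplicativity of [alpha]. Both the compatibility with adjoints and
    the covariance of the representation rest on it. *)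
Lemma rep_fun_flip D E (a : mor D E) f :
  rep_flip (rep_fun a f) = rep_fun (alpha a) (rep_flip f).
Proof.
have [u uf] := represents_ex f.
have r1 := represents_extend (@gns_sum_ge0 E) (flip E) (represents_rep a uf).
have r2 := represents_rep (alpha a) (represents_extend (@gns_sum_ge0 D) (flip D) uf).
apply: represents_unique r1 _; move: r2.
congr (represents _ _); apply/funext => n; apply: dsum_ext => s.
by rewrite !(actE, flipE) alphaM.
Qed.

(** Moving J past [a] replaces [a] by [alpha a], and [alpha a] is [(star a)#], so composition with
    it is the inner product adjoint of composition with [star a]. *)
Lemma rep_star D E (a : mor D E) : rep (star a) = adjop (rep a).
Proof.
apply: adjop_unique => y x.
rewrite -[RHS]/(rep_form E y (rep_flip (rep_fun a x))) rep_fun_flip.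
apply: extend_adjoint => w; apply: dsum_ext => s.
by rewrite dsum_map_starE actE /sharp starK.
Qed.

Lemma rep_alpha D E (a : mor D E) x :
  rep (alpha a) x = rep_sym E (rep a (rep_sym D x)).
Proof.
rewrite -[RHS]/(rep_flip (rep_fun a (rep_flip x))) rep_fun_flip.
by rewrite rep_flipK.
Qed.

Lemma opnorm_rep_le D E (a : mor D E) : opnorm (rep_sym D) (rep_sym E) (rep a) <= N D E a.
Proof. by apply: opnorm_le_bound; [exact: norm_ge0|exact: rep_fun_bound]. Qed.

(** The test vector is the identity of D in the summand of a state that is at least [N a ^ 2 / 2] at
    [a# a]. It has norm at most 1 and is sent to the vector [a]. *)
Lemma opnorm_rep_ge D E (a : mor D E) :
  N D E a <= 2 * opnorm (rep_sym D) (rep_sym E) (rep a).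
Proof.
have o0 : 0 <= opnorm (rep_sym D) (rep_sym E) (rep a) by exact: norm_ge0.
have [D0|D0] := eqVneq (idmor D) 0.
  by rewrite (mcomp_idmor0 a D0) norm0 mulr_ge0 ?norm_ge0.
have [st [st1 st2]] := endo_state alpha_functor alphaK N_banach N_Cstar sharp_pos D0 a.
pose s : S := existT _ D st.
have sqr B (w : gns_mor B s) (f := embed (@gns_sum_ge0 B) (dsingle w)) :
    fundsym_norm (rep_sym B) f ^+ 2 = complex.Re (st (mcomp (sh w) w)).
  rewrite rep_normE /rep_form cnrm_embed.
  have := psd_sqr (@gns_sum_ge0 B) (dsingle w).
  by rewrite dsum_form_single => /(congr1 (@complex.Re R)).
pose x : rep_krein D := embed (@gns_sum_ge0 D) (dsingle (idmor D : gns_mor D s)).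
have x1 : fundsym_norm (rep_sym D) x <= 1.
  rewrite -(@ler_pXn2r _ 2) ?nnegrE ?norm_ge0// sqr expr1n mcompf1.
  by rewrite /sharp star_idmor alpha_id.
have ax : rep a x = embed (@gns_sum_ge0 E) (dsingle (a : gns_mor E s)).
  rewrite repE /rep_fun extend_embed; congr (embed _ _); apply: dsum_ext => r.
  rewrite actE; have [->|rs] := eqVneq r s; first by rewrite !dsingle_in mcompf1.
  by rewrite !dsingle_out// mcomp0r.
have ox : fundsym_norm (rep_sym E) (rep a x) <= opnorm (rep_sym D) (rep_sym E) (rep a).
  exact: opnorm_ge.
rewrite -(@ler_pXn2r _ 2) ?nnegrE ?mulr_ge0 ?norm_ge0//.
have : fundsym_norm (rep_sym E) (rep a x) ^+ 2 <= opnorm (rep_sym D) (rep_sym E) (rep a) ^+ 2.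
  by rewrite ler_pXn2r ?nnegrE ?norm_ge0.
rewrite {1}ax sqr exprMn => h.
(* This gives [N a ^ 2 <= 2 o ^ 2] for the operator norm [o]; the constant 2 in place of [sqrt 2] is
   a convenience. *)
by have := le_trans st1 h; have := sqr_ge0 (opnorm (rep_sym D) (rep_sym E) (rep a)); lra.
Qed.

Lemma rep_inj D E : injective (@rep D E).
Proof.
move=> a b ab; apply/eqP; rewrite -subr_eq0; apply/eqP.
apply: (norm_le0_eq0 (N := N D E)); apply: le_trans (opnorm_rep_ge _) _.
have -> : rep (a - b) = 0.
  by rewrite addrC -scaleN1r rep_linear ab scaleN1r addNr.
by rewrite norm0 mulr0.
Qed.

(** * The image of the representation *)

Definition rep_image D E : {pred bop (rep_krein D) (rep_krein E)} :=
  fun T => `[< exists a : mor D E, rep a = T >].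

Lemma rep_image_submod D E : submod_closed (@rep_image D E).
Proof.
split.
  apply/asboolP; exists 0.
  by have := rep_linear (-1) (0 : mor D E) 0; rewrite scaler0 addr0 scaleN1r addNr.
move=> c _ _ /asboolP[a <-] /asboolP[b <-]; apply/asboolP; exists (c *: a + b).
exact: rep_linear.
Qed.
HB.instance Definition _ D E :=
  GRing.isSubmodClosed.Build R[i] (bop (rep_krein D) (rep_krein E)) (@rep_image D E)
    (@rep_image_submod D E).

Lemma repB D E (a b : mor D E) : rep (a - b) = rep a - rep b.
Proof. by rewrite addrC -scaleN1r rep_linear scaleN1r addrC. Qed.

(** By the lower bound, preimages of operators approaching [T] form a Cauchy sequence for the
    complete norm of Hom(D, E); by the upper bound, its limit is sent to [T]. Equivalence of
    operator norms reduces arbitrary [J] and [J'] to the constructed symmetries. *)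
Lemma rep_image_closed D E (J : fundSym (rep_krein D)) (J' : fundSym (rep_krein E)) :
  closed ([set` @rep_image D E] : set (normed (opnorm J J'))).
Proof.
move=> T0 clT; pose T : bop (rep_krein D) (rep_krein E) := T0.
have [c c0 Hc] := opnorm_equiv (rep_sym D) J (rep_sym E) J'.
have [d d0 Hd] := opnorm_equiv J (rep_sym D) J' (rep_sym E).
pose M := opnorm J J'.
have up a : M (rep a) <= d * N D E a.
  by apply: le_trans (Hd _) _; rewrite ler_wpM2l// opnorm_rep_le.
have low a : N D E a <= 2 * c * M (rep a).
  by apply: le_trans (opnorm_rep_ge a) _; rewrite -mulrA ler_wpM2l.
have /choice[x xP] : forall n : nat, exists a : mor D E, M (rep a - T) < n.+1%:R^-1.
  move=> n; have e0 : 0 < (n.+1%:R^-1 : R)%:C by rewrite ltcR invr_gt0.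
  have [_ [/asboolP[a <-]]] := clT _ (nbhsx_ballx T0 _ e0).
  rewrite -ball_normE /= normedE ltcR => aT.
  have symE : M (rep a - T) = M (T - rep a) by exact: norm_distC.
  by exists a; apply: le_lt_trans aT; rewrite le_eqVlt; apply/orP; left; apply/eqP.
have [|a ax] := banach_seq (N_banach (A := D) (B := E)) (u := x).
  move=> e e0; have k0 : 0 < 2 * c + 1 by rewrite ltr_wpDl// mulr_ge0.
  have e1 : 0 < e / (2 * c + 1) / 2 by rewrite !divr_gt0.
  have [n0 H] := invS_lt e1; exists n0 => m n nm nn.
  apply: le_lt_trans (low _) _; rewrite repB.
  have : M (rep (x m) - rep (x n)) < e / (2 * c + 1).
    apply: le_lt_trans (norm_dist_trans M T _ _) _; rewrite [ltRHS]splitr ltrD//.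
    - exact: lt_trans (xP m) (H _ nm).
    - by rewrite norm_distC; exact: lt_trans (xP n) (H _ nn).
  rewrite ltr_pdivlMr// mulrC; apply: le_lt_trans.
  by rewrite ler_wpM2r ?norm_ge0// lerDl.
apply/asboolP; exists a; rewrite -/T; apply/eqP; rewrite -subr_eq0; apply/eqP.
apply: (norm_le0_eq0 (N := M)); apply/ler_addgt0Pl => e e0; rewrite addr0.
have k0 : 0 < d + 1 by rewrite ltr_wpDl.
have e1 : 0 < e / 2 / (d + 1) by rewrite !divr_gt0.
have e2 : 0 < e / 2 by rewrite divr_gt0.
have [n0 H0] := ax _ e1; have [n1 H1] := invS_lt e2; pose n := maxn n0 n1.
apply: le_trans (norm_dist_trans M (rep (x n)) _ _) _; rewrite [leRHS]splitr lerD//.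
- rewrite norm_distC -repB; apply: le_trans (up _) _.
  have := H0 n (leq_maxl _ _); rewrite ltr_pdivlMr// mulrC => /ltW; apply: le_trans.
  by rewrite ler_wpM2r ?norm_ge0// lerDl.
- by apply/ltW; apply: lt_trans (xP n) (H1 n (leq_maxr _ _)).
Qed.

Local Notation repCat := (kreinCat rep_krein).

Lemma rep_functor : isStarFunctor (C := C) (D := repCat) (F := fun A => A) (@rep).
Proof.
split.
- exact: rep_linear.
- exact: rep_idmor.
- by move=> A D E g f; exact: rep_mcomp.
- by move=> A D f; exact: rep_star.
Qed.

Lemma rep_image_rep D E (a : mor D E) : rep a \in @rep_image D E.
Proof. by apply/asboolP; exists a. Qed.

Lemma rep_image_id (A : repCat) : [set: repCat] A -> idmor A \in @rep_image A A.
Proof. by move=> _; rewrite -[idmor A]rep_idmor; exact: rep_image_rep. Qed.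

Lemma rep_image_mcomp (A D E : repCat) (g : mor D E) (f : mor A D) :
  [set: repCat] A -> [set: repCat] D -> [set: repCat] E ->
  g \in @rep_image D E -> f \in @rep_image A D -> mcomp g f \in @rep_image A E.
Proof.
move=> _ _ _ /asboolP[b <-] /asboolP[a <-].
by rewrite -[mcomp _ _]rep_mcomp; exact: rep_image_rep.
Qed.

Lemma rep_image_star (A D : repCat) (f : mor A D) : [set: repCat] A -> [set: repCat] D ->
  f \in @rep_image A D -> star f \in @rep_image D A.
Proof.
by move=> _ _ /asboolP[a <-]; rewrite -[star _]rep_star; exact: rep_image_rep.
Qed.

Definition rep_cat : subStarCat repCat :=
  SubStarCat rep_image_id rep_image_mcomp rep_image_star.

Let unrep_ex (A B : subcategory rep_cat) (T : mor A B) : exists a : mor (sval A : C) (sval B),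
  rep a = val T.
Proof. exact/asboolP/(valP T). Qed.
Let unrep (A B : subcategory rep_cat) (T : mor A B) : mor (sval A : C) (sval B) :=
  sval (cid (unrep_ex T)).
Let unrepK (A B : subcategory rep_cat) (T : mor A B) : rep (unrep T) = val T.
Proof. exact: svalP (cid (unrep_ex T)). Qed.

Let unrep_functor : isStarFunctor (C := subcategory rep_cat) (D := C)
  (F := fun X => sval X) (@unrep).
Proof.
split.
- move=> A B c S' T; apply: rep_inj.
  apply: etrans (unrepK _) _; apply: etrans (esym (rep_linear c (unrep S') (unrep T))).
  rewrite (unrepK S') (unrepK T).
  exact: (@subvect_val_linear _ _ (sub_mor rep_cat (sval A) (sval B)) c S' T).
- by move=> A; apply: rep_inj; rewrite unrepK rep_idmor.
- by move=> A B E g f; apply: rep_inj; rewrite unrepK rep_mcomp !unrepK.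
- by move=> A B f; apply: rep_inj; rewrite unrepK rep_star unrepK.
Qed.

Let unrep_bij (A B : subcategory rep_cat) : bijective (@unrep A B).
Proof.
exists (fun a : mor (sval A : C) (sval B) => exist (fun f => f \in @rep_image (sval A) (sval B))
  (rep a) (rep_image_rep a)).
- by move=> T; apply: val_inj; exact: unrepK.
- by move=> a; apply: rep_inj; rewrite unrepK.
Qed.

Lemma rep_cat_krein : fundamental_symmetry (@alpha) ->
  krein_Cstar_category (subcategory rep_cat).
Proof.
move=> alpha_sym; exists (symmetry_pullback unrep_bij (@alpha)).
exact: fundamental_symmetry_pullback unrep_functor unrep_bij _ alpha_sym.
Qed.

End Representation.

Theorem theorem3p9 (R : realType) (C : starCat R)
    (alpha : forall A B : C, mor A B -> mor A B)
    (halpha : fundamental_symmetry alpha) :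
  exists (I : Type) (K : I -> kreinSpace R) (F : C -> kreinCat K)
      (phi : forall A B : C, mor A B -> mor (F A) (F B)),
    [/\ isStarFunctor phi,
        faithful phi,
        exists D : subStarCat (kreinCat K),
          [/\ closed_subcategory D,
              krein_Cstar_category (subcategory D) &
              isomorphism_onto phi D] &
        exists J : forall i : I, fundSym (K i),
          forall (A B : C) (x : mor A B),
            phi A B (alpha A B x) = alphaJ J (phi A B x)].
Proof.
have [alphaF alphaK [N [N_banach N_Cstar]] alpha_pos] := halpha.
pose K := @rep_krein R C alpha alphaF alphaK.
(* The family is indexed by the objects of [C], so the functor is the identity on objects and
   injective there even if two of the spaces coincide. *)
exists C, K, (fun A => A), (@rep _ _ _ alphaF alphaK _ N_banach N_Cstar); split.
- exact: rep_functor.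
- by move=> A B; exact: rep_inj.
- exists (rep_cat alphaF alphaK N_banach N_Cstar); split.
  + by move=> i j _ _ J J'; exact: rep_image_closed.
  + exact: rep_cat_krein.
  + split.
    * exact: rep_functor.
    * by [].
    * by apply/seteqP; split=> // A _; exists A.
    * move=> A B; split; first exact: rep_inj.
      apply/seteqP; split=> [_ [x _ <-]|T /asboolP[x <-]]; first exact: rep_image_rep.
      by exists x.
- exists (@rep_sym R C alpha alphaF alphaK) => A B x.
  by apply: bop_ext => y; exact: rep_alpha.
Qed.
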